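(* Let $\Sigma$ be a closed, connected, oriented surface and let $L\subset\Sigma\times I$ be a non-split checkerboard colorable link. If $L$ is not a minimal genus representative, then one of the determinants of $L$ is zero; that is, $\det(L,F_\xi)=0$ or $\det(L,F_{\xi^*})=0$, where $F_\xi$ and $F_{\xi^*}$ are the two checkerboard surfaces (black surface and dual, i.e. white, surface) of a checkerboard colored diagram of $L$ on $\Sigma$.
   Context: $I=[0,1]$; a link $L\subset\Sigma\times I$ is an embedded disjoint union of circles, considered up to isotopy; $p\colon\Sigma\times I\to\Sigma$ is the projection. $L$ is non-split if it has no disconnected diagram on $\Sigma$. Destabilization: given a vertical annulus $A$ in $\Sigma\times I$ (isotopic rel boundary to $\gamma\times I$, $\gamma\subset\Sigma$ an embedded circle) disjoint from $L$ and with $\gamma$ essential, cut $\Sigma\times I$ along $A$, glue in two thickened disks, and (if disconnected) keep the component containing the link. $L\subset\Sigma\times I$ is a minimal genus representative (has minimal support genus) if it cannot be destabilized; by Kuperberg's theorem, equivalently $g(\Sigma)$ is minimal among all links in thickened surfaces stably equivalent to $L$ (i.e. representing the same virtual link). A diagram $D\subset\Sigma$ is checkerboard colorable if the components of $\Sigma\smallsetminus D$ can be colored black and white so that regions sharing an edge have different colors; $L$ is checkerboard colorable if it has such a diagram. For a coloring $\xi$, the checkerboard surface $F_\xi\subset\Sigma\times I$ is the union of the black regions (placed in $\Sigma\times\{1/2\}$) and one half-twisted band at each crossing, so $\partial F_\xi=L$. The dual coloring $\xi^*$ interchanges black and white. Relative linking: for disjoint oriented knots $J,K\subset\Sigma\times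 I$, $\ell k_\Sigma(J,K)$ is the intersection number $J\cdot B$, where $B$ is a 2-chain with $\partial B=K+c$ for a 1-cycle $c\subset\Sigma\times\{1\}$; equivalently the signed count of crossings where $J$ passes over $K$. It extends bilinearly to disjoint 1-cycles. Gordon-Litherland pairing: for a compact surface $F\subset\Sigma\times I$ with $\partial F=L$, a closed tubular neighborhood of $F$ is a $[-1,1]$-bundle over $F$; let $\widetilde F\to F$ be the associated $\{\pm1\}$-bundle (double cover) and $\tau\colon H_1(F;\mathbb Z)\to H_1(\widetilde F;\mathbb Z)$ the transfer. Then $\mathcal G_F(\alpha,\beta)=\ell k_\Sigma(\tau\alpha,\beta)-p_*(\alpha)\cdot p_*(\beta)$ is a symmetric bilinear form on $H_1(F;\mathbb Z)$, where $\cdot$ is the intersection form on $H_1(\Sigma;\mathbb Z)$. For $F$ connected, $\det(L,F)=|\det(\mathcal G_F)|$ (computed from any matrix representing $\mathcal G_F$). *)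

(* Defs.v *)
From mathcomp Require Import all_boot all_order all_algebra.

Set Implicit Arguments.
Unset Strict Implicit.
Unset Printing Implicit Defensive.

Import Order.TTheory GRing.Theory Num.Theory.

(* Everything is cellular (piecewise linear): surfaces are cell complexes,
   Sigma x I is the product of such a complex with a subdivided interval, links
   are embedded 1-dimensional subcomplexes, and isotopy is generated by pushing
   an arc across a 2-cell and by changing the subdivision. *)

(** * Closed connected oriented surfaces *)

(* A cell decomposition of Sigma, given by its darts (oriented edges).  A dart d
   sits at its origin; node d is the next dart counterclockwise around the
   origin, edge d is the reversed dart. *)
Record surface := Surface {
  dart : finType;
  node : dart -> dart;
  edge : dart -> dart;
  node_inj : injective node;
  edgeK : involutive edge;
  edge_neq : forall d, edge d != d;
  surface_connected :
    forall d e, connect [rel x y | (y == node x) || (y == edge x)] d e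
}.
Arguments node {s} d.
Arguments edge {s} d.

(* The next dart along the boundary of the face lying to the left of d: turn
   left as sharply as possible at the target.  The vertices, edges and faces of
   Sigma are the orbits of node, edge and face. *)
Definition face (S : surface) (d : dart S) : dart S := finv node (edge d).

Definition same_vertex (S : surface) : rel (dart S) := fconnect node.

(** * Links in Sigma x I *)

(* I is subdivided at the levels 0, 1, 2, ... up to some bound.  Hor d k is the
   edge of d at level k; Ver d k is the segment [k, k+1] over the origin of d.
   The pair (d, k) stands for the 0-cell at level k over the origin of d. *)
Inductive arc (S : surface) :=
  | Hor of dart S & nat
  | Ver of dart S & nat.

Definition same_arc (S : surface) (a b : arc S) : bool :=
  match a, b with
  | Hor d k, Hor e l => (k == l) && ((e == d) || (e == edge d))
  | Ver d k, Ver e l => (k == l) && same_vertex d e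
  | _, _ => false
  end.

Definition degree (S : surface) (A : arc S -> bool) (d : dart S) (k : nat) : nat :=
  \sum_(e | same_vertex d e) A (Hor e k) + A (Ver d k)
  + (if k is l.+1 then A (Ver d l) else false).

(* A nonempty finite 1-dimensional subcomplex in which every 0-cell has degree
   0 or 2, i.e. an embedded disjoint union of circles. *)
Record link (S : surface) := Link {
  arcs :> arc S -> bool;
  height_bound : nat;
  arcs_compat : forall a b, same_arc a b -> arcs a = arcs b;
  arcs_bounded : forall d k, (height_bound < k -> ~~ arcs (Hor d k))
                          /\ (height_bound <= k -> ~~ arcs (Ver d k));
  arcs_manifold : forall d k, degree arcs d k \in [:: 0; 2];
  arcs_nonempty : exists a, arcs a
}.

(** * Isotopy *)

(* The boundary of a 2-cell of Sigma x I, as a cyclic sequence of arcs, each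
   paired with the 0-cell at which it starts. *)
Definition face_cycle (S : surface) (d : dart S) (k : nat) :=
  [seq (Hor e k, (e, k)) | e <- orbit (@face S) d].

Definition wall_cycle (S : surface) (d : dart S) (k : nat) :=
  [:: (Hor d k, (d, k)); (Ver (edge d) k, (edge d, k));
      (Hor (edge d) k.+1, (edge d, k.+1)); (Ver d k, (d, k.+1))].

Definition two_cell (S : surface) (c : seq (arc S * (dart S * nat))) : Prop :=
  (exists d k, c = face_cycle d k) \/
  (exists d k r, c = rot r (wall_cycle d k)).

(* L' is the symmetric difference of L and the boundary of a 2-cell c which is
   an embedded disc meeting L exactly in a (nontrivial, proper) arc c1 of its
   boundary. *)
Definition push (S : surface) (L L' : link S) : Prop :=
  exists c1 x c2, let c := c1 ++ x :: c2 in
  [/\ two_cell c,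
      uniq [seq (froot node y.2.1, y.2.2) | y <- c],
      0 < size c1 /\ all (fun y => L y.1) c1,
      ~~ L x.1 /\ all (fun y => ~~ L y.1 && (degree L y.2.1 y.2.2 == 0)) c2 &
      forall a, L' a = L a (+) has (fun y => same_arc a y.1) c].

(* The first dart after d, counterclockwise, that does not lie on the edge
   of x. *)
Definition node_skip (S : surface) (x d : dart S) : dart S :=
  let P := mem [:: x; edge x] in
  if P (node d) then
    if P (node (node d)) then node (node (node d)) else node (node d)
  else node d.

(* The cell decomposition S' is S with one face divided by a new edge x (the
   two sides of which are different faces of S'). *)
Definition face_division (S S' : surface) (L : link S) (L' : link S') : Prop :=
  exists (i : dart S -> dart S') (x : dart S'),
  [/\ injective i /\ (forall y, (y \in codom i) = (y \notin [:: x; edge x])),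
      forall d, i (edge d) = edge (i d),
      forall d, i (node d) = node_skip x (i d),
      ~~ fconnect (@face S') x (edge x) &
      forall d k, [/\ L' (Hor (i d) k) = L (Hor d k),
                      L' (Ver (i d) k) = L (Ver d k) &
                      L' (Hor x k) = false]].

(* S' is S with the edge of a divided by a new vertex, whose two darts are
   edge (i a) and edge (i (edge a)). *)
Definition edge_division (S S' : surface) (L : link S) (L' : link S') : Prop :=
  exists (i : dart S -> dart S') (a : dart S),
  let x := edge (i a) in let y := edge (i (edge a)) in
  [/\ injective i /\ (forall z, (z \in codom i) = (z \notin [:: x; y])),
      forall d, d != a -> d != edge a -> edge (i d) = i (edge d),
      forall d, node (i d) = i (node d),
      node x = y /\ node y = x &
      forall d k, [/\ L' (Hor (i d) k) = L (Hor d k),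
                      L' (Ver (i d) k) = L (Ver d k) &
                      L' (Ver x k) = false]].

(* The surfaces S and S' are decompositions of the same Sigma; the relation
   therefore identifies links that differ by an isotopy, or by the product with
   I of an orientation preserving homeomorphism of Sigma. *)
Inductive isotopic : forall S S' : surface, link S -> link S' -> Prop :=
  | isotopic_refl S (L : link S) : isotopic L L
  | isotopic_push S (L L' : link S) : push L L' -> isotopic L L'
  | isotopic_face S S' (L : link S) (L' : link S') :
      face_division L L' -> isotopic L L'
  | isotopic_edge S S' (L : link S) (L' : link S') :
      edge_division L L' -> isotopic L L'
  | isotopic_sym S S' (L : link S) (L' : link S') :
      isotopic L L' -> isotopic L' L
  | isotopic_trans S S' S'' (L : link S) (L' : link S') (L'' : link S'') :
      isotopic L L' -> isotopic L' L'' -> isotopic L L''.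

(** * Diagrams *)

Section Diagram.
Variables (S : surface) (L : link S).
Implicit Types d e : dart S.

(* The edge of d lies in the projection p(L); height d is then the level at
   which L runs over it. *)
Definition strand d : bool := has (fun k => L (Hor d k)) (iota 0 (height_bound L).+1).
Definition height d : nat := find (fun k => L (Hor d k)) (iota 0 (height_bound L).+1).

(* The darts of p(L) at the origin of d, counterclockwise; it starts with d when
   strand d holds. *)
Definition around d : seq (dart S) := [seq e <- orbit node d | strand e].

Definition crossing d : bool := strand d && (size (around d) == 4).
Definition across d : dart S := nth d (around d) 2.
Definition under d : bool := crossing d && (height d < height (nth d (around d) 1)).

(* The projection of L is regular: it is injective over the edges, and its only
   multiple points are 4-valent vertices at which two strands cross transversely,
   one of them being entirely above the other. *)
Definition diagram : Prop :=
  (forall d k l, L (Hor d k) -> L (Hor d l) -> k = l) /\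
  (forall d, strand d ->
     size (around d) = 2 \/
     let e := nth d (around d) 1 in
     [/\ size (around d) = 4, height d != height e &
         (height d < height e) = (height (across d) < height e)]).

Definition connected_diagram : Prop :=
  forall d e, strand d -> strand e ->
  connect [rel x y | [&& strand x, strand y & (y == edge x) || same_vertex x y]]
    d e.

(* xi d is the colour of the face to the left of d, true meaning black.  The
   colour is constant on each component of the complement of the diagram. *)
Definition coloring (xi : dart S -> bool) : Prop :=
  (forall d, xi (face d) = xi d) /\
  (forall d, xi (edge d) = xi d (+) strand d).

End Diagram.

Definition dual_coloring (S : surface) (xi : dart S -> bool) (d : dart S) : bool := ~~ xi d.

Definition nonsplit (S : surface) (L : link S) : Prop :=
  forall (S' : surface) (L' : link S'),
  isotopic L L' -> diagram L' -> connected_diagram L'.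

Definition checkerboard_colorable (S : surface) (L : link S) : Prop :=
  exists (S' : surface) (L' : link S') (xi : dart S' -> bool),
  [/\ isotopic L L', diagram L' & coloring L' xi].

(** * Destabilization *)

Section Circle.
Variables (S : surface) (g : seq (dart S)).
Implicit Types d e : dart S.

(* g is an embedded circle in the 1-skeleton of Sigma. *)
Definition embedded_circle : bool :=
  [&& g != [::], cycle (fun d e => same_vertex (edge d) e) g,
      uniq [seq froot node d | d <- g] & all (fun d => edge d \notin g) g].

Definition edge_on d : bool := (d \in g) || (edge d \in g).
Definition vertex_on d : bool := has (same_vertex d) g.

(* The component of the complement of the circle that contains the face to the
   left of d. *)
Definition side d : {set dart S} :=
  [set e | connect [rel x y | (y == face x) || (~~ edge_on x && (y == edge x))] d e].

(* A component of the complement is an open disc if and only if its Euler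
   characteristic V - E + F is 1. *)
Definition disc (U : {set dart S}) : bool :=
  #|[set froot node e | e in U & ~~ vertex_on e]| + #|[set froot (@face S) e | e in U]|
  == #|[set [set e; edge e] | e in U & ~~ edge_on e]| + 1.

Definition essential : Prop := forall d, ~~ disc (side d).

End Circle.

(* The vertical annulus over g is disjoint from L. *)
Definition annulus_disjoint (S : surface) (L : link S) (g : seq (dart S)) : Prop :=
  forall d k, d \in g -> degree L d k = 0.

(* An annulus isotopic to g x I and disjoint from L is carried by an ambient
   isotopy to g x I itself. *)
Definition destabilizable (S : surface) (L : link S) : Prop :=
  exists (S' : surface) (L' : link S') (g : seq (dart S')),
  [/\ isotopic L L', embedded_circle g, essential g & annulus_disjoint L' g].

Definition minimal_genus (S : surface) (L : link S) : Prop := ~ destabilizable L.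

(** * Intersection and linking numbers *)

Local Open Scope ring_scope.

Section Linking.
Variable S : surface.

(* A germ at a vertex: (d, false) is the half-edge d, and (d, true) is a short
   arc into the corner between d and node d. *)
Definition germ : finType := (dart S * bool)%type.

(* The coefficient of a 1-chain on a germ is its outward flow. *)
Definition chain := germ -> int.

(* The cyclic order of the germs at a vertex, cut open at an arbitrary place. *)
Definition rank (p : germ) : nat :=
  ((findex node (froot node p.1) p.1).*2 + p.2)%N.

(* The signed number of crossings of a and b, with sign +1 when b crosses a from
   right to left, for 1-chains whose flow adds up to 0 at every vertex (the cut in
   rank is then immaterial).  The double sum counts a transverse crossing twice.
   Chains running along a common edge are counted with the average of the two
   ways of pushing them apart: each end of the common part contributes 1/2 or
   -1/2.  On cycles this is the intersection form of H_1(Sigma). *)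
Definition intersection (a b : chain) : rat :=
  (\sum_(p : germ) \sum_(q : germ | same_vertex p.1 q.1)
     Num.sg ((rank q)%:Z - (rank p)%:Z) * a p * b q)%:~R / 2%:R.

(* A 1-cycle of Sigma x I whose horizontal part lies on three levels, 0, 1 and
   2; it moves from one level to another inside the corners, J k (d, true) being
   the amount that leaves level k in the corner of d. *)
Definition cycle3 := 'I_3 -> chain.

(* The relative linking number: signed count of the crossings at which J passes
   over K. *)
Definition lk (J K : cycle3) : rat :=
  \sum_(k < 3) \sum_(l < 3 | (l < k)%N) intersection (J k) (K l).

End Linking.

(** * Checkerboard surfaces and the Gordon-Litherland pairing *)

Section GordonLitherland.
Variables (S : surface) (L : link S) (xi : dart S -> bool).
Implicit Types d e : dart S.

(* A cell structure on the checkerboard surface F, obtained from the black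
   regions and the half-twisted bands by collapsing each band to its core:
   - the 2-cells are the black faces;
   - the 1-cells are the edges with a black side, and the core of the band at
     each crossing;
   - the 0-cells are the black sectors at the vertices.  At a crossing there are
     two of them, joined by the core. *)
Definition sector : rel (dart S) :=
  connect [rel d e | (xi d && (e == node d)) || (xi e && (d == node e))].

(* A 1-chain z of F: z.1 d is its coefficient on the oriented edge d, and, for u
   an under-dart of a crossing, z.2 u is its coefficient on the core oriented away
   from the black sector bounded by u (each of the two black sectors at a crossing
   is bounded by exactly one under-dart). *)
Definition fchain := ({ffun dart S -> int} * {ffun dart S -> int})%type.

Definition is_fchain (z : fchain) : Prop :=
  [/\ forall d, z.1 (edge d) = - z.1 d,
      forall d, ~~ xi d -> ~~ xi (edge d) -> z.1 d = 0,
      forall d, ~~ under L d -> z.2 d = 0 &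
      forall d, under L d -> z.2 (across L d) = - z.2 d].

Definition is_cycle (z : fchain) : Prop :=
  is_fchain z /\ forall d, \sum_(e | sector d e) (z.1 e + z.2 e) = 0.

Definition is_boundary (z : fchain) : Prop :=
  exists x : dart S -> int,
  [/\ forall d, x (face d) = x d,
      forall d, ~~ xi d -> x d = 0,
      forall d, z.1 d = x d - x (edge d) &
      forall d, z.2 d = 0].

Definition combination n (z : 'I_n -> fchain) (a : 'I_n -> int) : fchain :=
  \sum_i z i *~ a i.

(* The classes of the cycles z form a basis of H_1(F; Z), which is free. *)
Definition homology_basis n (z : 'I_n -> fchain) : Prop :=
  [/\ forall i, is_cycle (z i),
      forall w, is_cycle w -> exists a, is_boundary (w - combination z a) &
      forall a, is_boundary (combination z a) -> forall i, a i = 0].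

(* p_* : the core of a band projects to the crossing. *)
Definition proj (z : fchain) : chain S := fun p => if p.2 then 0 else z.1 p.1.

(* The surface F is placed at level 1. *)
Definition on_surface (z : fchain) : cycle3 S :=
  fun k => if k == 1%N :> nat then proj z else fun=> 0.

(* The double cover is the push-off of F to both sides: over the black regions
   its sheets lie at levels 2 and 0.  The band at a crossing is vertical over the
   crossing itself, so its push-offs run beside it, one in each of the two white
   corners.  The side of the band that faces up in the black sector bounded by the
   under-dart u passes through the white sector on the other side of u, and then
   faces down in the opposite black sector. *)
Definition turn (z : fchain) d : int := if xi d then 0 else z.2 d + z.2 (node d).

Definition transfer (z : fchain) : cycle3 S := fun k p =>
  if k == 1%N :> nat then 0
  else if p.2 then (if k == 2%N :> nat then turn z p.1 else - turn z p.1)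
  else z.1 p.1.

Definition gordon_litherland (a b : fchain) : rat :=
  lk (transfer a) (on_surface b) - intersection (proj a) (proj b).

(* delta = det(L, F), the absolute value of the determinant of a matrix
   representing the pairing on H_1(F; Z). *)
Definition determinant_is (delta : rat) : Prop :=
  exists n (z : 'I_n -> fchain),
  homology_basis z /\
  delta = `| \det (\matrix_(i, j) gordon_litherland (z i) (z j)) |.

End GordonLitherland.

(* Main.v *)
(* The determinant of F_xi vanishes exactly when the pairing on H_1(F_xi) is degenerate.  An
   element of the radical is read off from a class in H^1 of the complement of L with
   coefficients in a rank one local system on which the meridians act by -1, such that the
   restrictions of the class to the top and the bottom of Sigma x I agree up to a sign.  The
   existence of a nonzero such class depends only on the complement, so it is invariant under
   isotopy.

   A class is recorded layer by layer (above, between and below the levels of I), in the gauge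
   in which vertical transport through the faces is trivial; it is then a family of affine
   transition maps x |-> +-x + t between adjacent faces, flat around every vertex away from
   the vertical arcs of L, and constant from layer to layer away from the horizontal ones.  It
   is nontrivial when it has no flat section.

   If the annulus over an essential circle misses L, a 1-cycle of Sigma supported on the
   circle, or on a side of the circle that L avoids, gives such a class: its Poincare dual.

   On a regular diagram, normalize the class so that the difference between its top and
   bottom restrictions is the coboundary of a function X on the faces of one colour, say black.
   The bottom restriction is then a 1-cycle supported on the edges with a black side; adding
   (X - X') / 2, up to sign, on the core of the band joining two black sectors makes it a cycle
   of F_xi.  Its pairing with a cycle b is a sum of differences of X against b, that is, the
   boundary of b evaluated on a function which is constant on the black regions, hence 0; and
   it bounds only if the class has a flat section. *)
Require Import Defs.
From HB Require Import structures.
From mathcomp Require Import all_boot all_order all_algebra.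
From mathcomp Require Import ring lra zify.
From Stdlib Require Import Classical.

Set Implicit Arguments.
Unset Strict Implicit.
Unset Printing Implicit Defensive.

Import Order.TTheory GRing.Theory Num.Theory.
Local Open Scope ring_scope.

(** * Orbits of an injection *)

(** A destabilizing annulus is vertical only for a link isotopic to [L], which need not be a
    diagram, while the determinant needs a diagram. Hence the detour through [admits_class], which
    makes sense for every link and is carried both ways by an isotopy: with [b = false] it brings
    colourability to the destabilizing position, with [b = true] it brings the class back. Meridians
    act by reflections, and one reflection serves a whole run of arcs of [L] around a 2-cell; this
    is what makes pushes tractable. Which of the two surfaces is singular depends on the sign [s]:
    the function [X] can be gauged away on the colour where the signs of top and bottom are
    opposite, and the other colour must be the black one. Essentialness enters through an Euler
    characteristic. If the dual of the circle is trivial, its flat section vanishes next to [L], so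
    some side avoids [L]; a side that is not a disc has a relative cycle which does not bound.
    Non-splitness enters through connectedness of the diagram: if the radical element bounds, all
    core coefficients vanish, so [X] has one value along the whole diagram, and this value completes
    a flat section. *)

Section Orbits.
Variables (T : finType) (f : T -> T).
Hypothesis f_inj : injective f.

Lemma orbit_ind (P : T -> Prop) q :
    P q -> (forall e, fconnect f q e -> P e -> f e != q -> P (f e)) ->
  forall e, fconnect f q e -> P e.
Proof.
move=> Pq Pf e qe; rewrite -(iter_findex qe).
elim: (findex f q e) (findex_max qe) => //= n IHn lt_n.
apply: Pf (fconnect_iter f n q) (IHn (ltnW lt_n)) _.
by rewrite -iterS eq_sym -(findex_eq0 f) findex_iter.
Qed.

(** The wrap-around equation at [q] is left out because it measures the holonomy around the orbit;
    [partial_section_sum] computes its defect for translations, and [partial_section_diff] compares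
    defects for affine maps. *)
Lemma partial_section_exists (V : Type) (A : T -> V -> V) q c :
  exists u, u q = c /\
    forall e, fconnect f q e -> f e != q -> u (f e) = A (f e) (u e).
Proof.
pose F := fix F n := if n is m.+1 then A (iter n f q) (F m) else c.
exists (fun e => F (findex f q e)); split=> [|e qe fe]; first by rewrite findex0.
have lt_e := findex_max qe.
have Eit : f e = iter (findex f q e).+1 f q by rewrite iterS iter_findex.
case: (ltngtP (findex f q e).+1 (order f q)) => [lt_Se||eq_Se]; last 1 first.
- by rewrite Eit eq_Se iter_order // eqxx in fe.
- by rewrite Eit findex_iter //=; congr (A _ _); rewrite iter_findex.
- by rewrite ltnNge lt_e.
Qed.

Lemma fconnect_f_r q e : fconnect f q (f e) = fconnect f q e.
Proof. by rewrite -same_fconnect1_r. Qed.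

Lemma fconnect_finv_r q e : fconnect f q (finv f e) = fconnect f q e.
Proof. by rewrite -{2}(f_finv f_inj e) fconnect_f_r. Qed.

Lemma sum_orbit_f (V : zmodType) (u : T -> V) q :
  \sum_(e | fconnect f q e) u (f e) = \sum_(e | fconnect f q e) u e.
Proof.
rewrite [RHS](reindex_inj f_inj) /=.
by apply: eq_bigl => e; rewrite fconnect_f_r.
Qed.

(** Summing [u (f e) - u e - t (f e)] over the orbit telescopes to minus the sum of [t], and only
    the term at [finv f q] can be nonzero. *)
Lemma partial_section_sum (V : zmodType) (t u : T -> V) q :
    (forall e, fconnect f q e -> f e != q -> u (f e) = u e + t (f e)) ->
  u q + \sum_(e | fconnect f q e) t e = u (finv f q) + t q.
Proof.
move=> uE; have: \sum_(e | fconnect f q e) (u (f e) - u e - t (f e)) =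
                - \sum_(e | fconnect f q e) t e.
  by rewrite !sumrB !sum_orbit_f subrr add0r.
rewrite (bigD1 (finv f q)) ?fconnect_finv //= big1 ?addr0 => [|e /andP[qe ne]].
  rewrite f_finv // => sumE; rewrite -[X in _ + X]opprK -sumE !opprB.
  by rewrite addrCA [u q + _]addrC subrK addrC.
rewrite uE ?addrK ?[u e + _]addrC ?addrK ?subrr //.
by apply: contraNneq ne => <-; rewrite finv_f.
Qed.

Lemma section_exists (V : zmodType) (t : T -> V) q :
    \sum_(e | fconnect f q e) t e = 0 ->
  exists u, forall e, fconnect f q e -> u (f e) = u e + t (f e).
Proof.
move=> t0; have [u [_ uE]] := partial_section_exists (fun e x => x + t e) q 0.
exists u => e qe; case: (eqVneq (f e) q) => [fe|]; last exact: uE.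
by have := partial_section_sum uE; rewrite t0 addr0 -fe finv_f.
Qed.

Lemma section_sum0 (V : zmodType) (t u : T -> V) q :
    (forall e, fconnect f q e -> u (f e) = u e + t (f e)) ->
  \sum_(e | fconnect f q e) t e = 0.
Proof.
move=> uE; rewrite -sum_orbit_f.
rewrite (eq_bigr (fun e => u (f e) - u e)) ?sumrB ?sum_orbit_f ?subrr // => e /uE ->.
by rewrite addrC addKr.
Qed.

End Orbits.

(** * Parity of the levels *)

Section Surfaces.
Variable S : surface.
Implicit Types d e : dart S.

Lemma face_inj : injective (@face S).
Proof.
apply: inj_comp (finv_inj (@node_inj S)) _; exact: inv_inj (@edgeK S).
Qed.

Lemma node_face d : node (face d) = edge d.
Proof. by rewrite /face f_finv //; apply: node_inj. Qed.

Lemma face_edge d : face (edge d) = finv node d.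
Proof. by rewrite /face edgeK. Qed.

Lemma face_edge_node d : face (edge (node d)) = d.
Proof. by rewrite face_edge finv_f //; apply: node_inj. Qed.

Lemma same_vertex_sym d e : same_vertex d e = same_vertex e d.
Proof. exact: fconnect_sym (@node_inj S) d e. Qed.

Lemma same_vertex_trans : transitive (@same_vertex S).
Proof. exact: connect_trans. Qed.

Lemma same_vertex_left d d' : same_vertex d d' -> same_vertex d =1 same_vertex d'.
Proof. by move/(same_connect (fconnect_sym (@node_inj S))). Qed.

Lemma same_vertex_node d e : same_vertex d (node e) = same_vertex d e.
Proof. exact: fconnect_f_r (@node_inj S) d e. Qed.

Lemma same_vertex_finv d e : same_vertex d (finv node e) = same_vertex d e.
Proof. exact: fconnect_finv_r (@node_inj S) d e. Qed.

Lemma same_vertex_froot d e : (froot node d == froot node e) = same_vertex d e.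
Proof. by rewrite root_connect //; apply: fconnect_sym (@node_inj S). Qed.

Lemma surface_ind (P : dart S -> Prop) d :
    P d -> (forall e, P e -> P (node e)) -> (forall e, P e -> P (edge e)) ->
  forall e, P e.
Proof.
move=> Pd Pn Pe e; have /connectP[p] := surface_connected d e.
elim: p d Pd => /= [|x p IHp] d Pd; first by move=> _ ->.
by case/andP=> /orP[] /eqP-> /IHp; apply; [apply: Pn | apply: Pe].
Qed.

Lemma face_invariant_surface (T : Type) (x : dart S -> T) :
    (forall d, x (face d) = x d) -> (forall d, x (edge d) = x d) ->
  forall d e, x d = x e.
Proof.
move=> xf xe d; apply: (surface_ind (d := d)) => // e ->; last by rewrite xe.
by rewrite -[RHS]xe -[RHS]xf face_edge_node.
Qed.

End Surfaces.

Section Parity.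
Variables (S : surface) (L : link S).
Implicit Types d e : dart S.

(* Layer [k] lies between the levels [k - 1] and [k], layer 0 below all levels.  The mod 2 class
   is dual to the surface swept out by moving [L] to the top, so that [par d k] tells whether
   crossing the edge of [d] in layer [k] changes the sign. *)
Fixpoint par d k : bool := if k is j.+1 then par d j (+) L (Hor d j) else false.

Definition ver d k : bool := if k is j.+1 then L (Ver d j) else false.

Definition sg d k : rat := (-1) ^+ par d k.

Lemma hor_edge d k : L (Hor (edge d) k) = L (Hor d k).
Proof. by apply: arcs_compat; rewrite /= eqxx edgeK eqxx orbT. Qed.

Lemma ver_same d e k : same_vertex d e -> L (Ver d k) = L (Ver e k).
Proof. by move=> de; apply: arcs_compat; rewrite /= eqxx. Qed.

Lemma par_edge d k : par (edge d) k = par d k.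
Proof. by elim: k => //= k ->; rewrite hor_edge. Qed.

Lemma sg_edge d k : sg (edge d) k = sg d k.
Proof. by rewrite /sg par_edge. Qed.

Lemma sg_sqr d k : sg d k * sg d k = 1.
Proof. by rewrite /sg -expr2 sqrr_sign. Qed.

Lemma sgS d k : sg d k.+1 = if L (Hor d k) then - sg d k else sg d k.
Proof. by rewrite /sg /=; case: (L _); rewrite ?addbT ?addbF ?signrN. Qed.

(** The sum is taken in [bool], so it is exclusive or. Passing level k changes it by the parity of
    the horizontal arcs there; as the degree is even, this is also the change in vertical arcs. So
    the local system has monodromy -1 around a vertex exactly where a vertical arc passes. *)
Lemma par_vertex d k : \sum_(e | same_vertex d e) par e k = ver d k :> bool.
Proof.
elim: k => [|k IHk] /=; first by rewrite big1.
rewrite (eq_bigr (fun e => (par e k : bool) + (L (Hor e k) : bool))) // big_split /= IHk.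
have -> : \sum_(e | same_vertex d e) (L (Hor e k) : bool) =
          odd (\sum_(e | same_vertex d e) L (Hor e k))%N.
  rewrite (big_morph odd oddD (erefl _)); apply: eq_bigr => e _.
  by case: (L _).
have: odd (degree L d k) = false.
  by have := arcs_manifold L d k; rewrite !inE => /orP[]/eqP->.
rewrite /degree !oddD; case: (odd _) (L (Ver d k)) => [] [];
  by case: k {IHk} => [|k] //=; case: (L _).
Qed.

(** The signs around a vertex can be trivialized up to their monodromy [ver d k], which is placed as
    a jump at [d]. *)
Lemma sign_section d k : exists h : dart S -> bool,
  forall e, same_vertex d e ->
  h (node e) = h e (+) par (node e) k (+) (ver d k && (node e == d)).
Proof.
have [h [_ hE]] := partial_section_exists (@node_inj S) (fun e x => x + par e k : bool) d false.
exists h => e de; case: (eqVneq (node e) d) => [ed|]; last first.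
  by rewrite andbF addbF; apply: hE.
have hsum := @partial_section_sum _ _ (@node_inj S) bool (par^~ k) h d hE.
move: hsum; rewrite -/(same_vertex d) par_vertex -{3 4}ed finv_f ?andbT; last exact: node_inj.
rewrite -ed -[_ + _]/(h (node e) (+) ver (node e) k) -[RHS]/(h e (+) par (node e) k).
by move=> <-; rewrite -addbA addbb addbF.
Qed.

End Parity.

(** * Twisted cocycles of the complement *)

Section Cocycles.
Variables (S : surface) (L : link S).
Implicit Types (d e : dart S) (t : dart S -> nat -> rat) (u y X : dart S -> rat).

(* In layer [k], [x |-> sg L d k * x + t d k] is the transition from the face on the right of
   [d] to the one on its left. *)
Definition step t k u e : Prop := u (node e) = sg L (node e) k * u e + t (node e) k.

Definition partial_section t k d u : Prop :=
  forall e, same_vertex d e -> node e != d -> step t k u e.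

(** The first clause makes the transitions of [d] and [edge d] inverse maps; the last one is
    triviality of the holonomy around a vertex, imposed only where no vertical arc passes through
    the layer. *)
Definition cocycle t : Prop :=
  [/\ forall d k, t (edge d) k = - (sg L d k * t d k),
      forall d k, ~~ L (Hor d k) -> t d k.+1 = t d k &
      forall d k, ~~ ver L d k -> exists u, forall e, same_vertex d e -> step t k u e].

Definition flat_section t y : Prop :=
  (forall d, y (face d) = y d) /\
  (forall d k, y d - sg L d k * y (edge d) = t d k).

(** Above all levels the colouring trivializes the local system: after multiplication by
    [(-1) ^+ xi d] the transitions are translations, comparable with those of layer 0, where all
    signs are +1. *)
Definition end_colouring (xi : dart S -> bool) K : Prop :=
  (forall d, xi (face d) = xi d) /\
  (forall d k, (K <= k)%N -> xi (edge d) = xi d (+) par L d k).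

Definition ends_match (xi : dart S -> bool) t (s : bool) X K : Prop :=
  (forall d, X (face d) = X d) /\
  (forall d k, (K <= k)%N ->
     (-1) ^+ xi d * t d k = (-1) ^+ s * t d 0%N + X d - X (edge d)).

(* For [b = false] the zero cocycle qualifies, and this only says that [L] is checkerboard
   colourable. *)
Definition admits_class (b : bool) : Prop :=
  exists xi t s X K, [/\ end_colouring xi K, cocycle t, ends_match xi t s X K &
                         b -> forall y, ~ flat_section t y].

(** The translations cancel in the difference, and [sign_section] makes the rest constant; so the
    holonomy has linear part [(-1) ^+ ver L d k]. Around a vertical arc it is a reflection, and
    [u d + sg L d k * u (finv node d)] is the same for all partial sections. *)
Lemma partial_section_diff t k d u u' :
    partial_section t k d u -> partial_section t k d u' ->
  u d - u' d = (-1) ^+ ver L d k * sg L d k * (u (finv node d) - u' (finv node d)).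
Proof.
move=> hu hu'; have [h hE] := sign_section L d k.
pose w e : rat := (-1) ^+ h e * (u e - u' e).
have wd e : same_vertex d e -> w e = w d.
  move: e; apply: (orbit_ind (f := node)) => // e de <- ne.
  rewrite /w hE // (negPf ne) andbF addbF signr_addb hu // hu' //.
  rewrite -/(sg L (node e) k).
  transitivity (sg L (node e) k * sg L (node e) k * ((-1) ^+ h e * (u e - u' e))); first by ring.
  by rewrite sg_sqr mul1r.
have := wd (finv node d); rewrite same_vertex_finv /w => /(_ (connect0 _ _)).
have := hE (finv node d); rewrite same_vertex_finv => /(_ (connect0 _ _)).
rewrite f_finv ?eqxx ?andbT; last exact: node_inj.
move=> hd; rewrite {1}hd !signr_addb -/(sg L d k).
move=> /(congr1 ( *%R ((-1) ^+ h (finv node d) * (-1) ^+ ver L d k * sg L d k))).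
set x := u d - _; set x' := u (finv _ _) - _; set a := (-1) ^+ h _; set b := (-1) ^+ ver _ _ _.
have aa : a * a = 1 by rewrite -expr2 sqrr_sign.
have bb : b * b = 1 by rewrite -expr2 sqrr_sign.
have ss := sg_sqr L d k.
rewrite (_ : _ * (a * x') = (a * a) * (b * sg L d k * x')); last by ring.
rewrite (_ : _ * (_ * x) = (a * a) * (b * b) * (sg L d k * sg L d k) * x); last by ring.
by rewrite aa bb ss !mul1r => <-.
Qed.

(** The cocycle condition supplies one section that closes up, and by [partial_section_diff] the
    difference from it closes up too. *)
Lemma flat_partial_section t k d u :
    cocycle t -> ~~ ver L d k -> partial_section t k d u ->
  u d = sg L d k * u (finv node d) + t d k.
Proof.
move=> [_ _ T3] nv hu; have [u' hu'] := T3 d k nv.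
have /partial_section_diff/(_ hu) : partial_section t k d u' by move=> e de _; apply: hu'.
rewrite (negPf nv) mul1r; have := hu' (finv node d).
rewrite same_vertex_finv /step f_finv; last exact: node_inj.
by move=> ->; [lra | exact: connect0].
Qed.

Lemma partial_sectionP t k d c : exists u, u d = c /\ partial_section t k d u.
Proof.
have [u [uc hu]] := partial_section_exists (@node_inj S)
  (fun e x => sg L e k * x + t e k) d c.
by exists u.
Qed.

Lemma cocycle_gauge t y :
  (forall d, y (face d) = y d) -> cocycle t ->
  cocycle (fun d k => t d k + y d - sg L d k * y (edge d)).
Proof.
move=> yf [T1 T2 T3]; split=> [d k|d k nL|d k nv].
- by rewrite T1 edgeK sg_edge !mulrDr mulrN mulrA sg_sqr; ring.
- by rewrite T2 // sgS (negPf nL).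
have [u uE] := T3 d k nv; exists (fun e => u e + y e) => e de.
rewrite /step uE // -[y (edge (node e))]yf face_edge_node; ring.
Qed.

Lemma flat_section_gauge t y z :
  (forall d, y (face d) = y d) ->
  flat_section (fun d k => t d k + y d - sg L d k * y (edge d)) z ->
  flat_section t (fun d => z d - y d).
Proof.
move=> yf [zf zE]; split=> [d|d k]; first by rewrite zf yf.
by have := zE d k; lra.
Qed.

(** The coboundary of [y] is twisted by the colouring at the top but not at the bottom. The
    resulting coefficient of [y] is 0 on one colour and 2 or -2 on the other, so a gauge can remove
    [X] on one colour only. *)
Lemma ends_match_gauge xi t s X K y :
  (forall d, y (face d) = y d) -> end_colouring xi K -> ends_match xi t s X K ->
  ends_match xi (fun d k => t d k + y d - sg L d k * y (edge d)) s
    (fun d => X d + ((-1) ^+ xi d - (-1) ^+ s) * y d) K.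
Proof.
move=> yf [xif xiE] [Xf XE]; split=> [d|d k Kk]; first by rewrite Xf yf xif.
rewrite !mulrDr XE // (xiE _ _ Kk) signr_addb -/(sg L d k) /=.
by rewrite /sg /= expr0; ring.
Qed.

End Cocycles.

(** * Meridians of consecutive arcs *)

Section Corners.
Variables (S : surface) (L : link S).
Implicit Types (d e p q : dart S) (t : dart S -> nat -> rat).

Lemma degree_le2 d k : (degree L d k <= 2)%N.
Proof. by have := arcs_manifold L d k; rewrite !inE => /orP[]/eqP->. Qed.

Lemma degreeE d k :
  degree L d k = (\sum_(e | same_vertex d e) L (Hor e k) + L (Ver d k) + ver L d k)%N.
Proof. by rewrite /degree; case: k. Qed.

Lemma degree_hor d k : L (Hor d k) ->
  degree L d k = (1 + \sum_(e | same_vertex d e && (e != d)) L (Hor e k) +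
                  L (Ver d k) + ver L d k)%N.
Proof.
move=> Ld; rewrite degreeE (bigD1 d) /=; last exact: connect0.
by rewrite Ld.
Qed.

Lemma degree_hor2 p q k :
    L (Hor p k) -> L (Hor q k) -> same_vertex p q -> p != q ->
  [/\ forall e, same_vertex p e -> e != p -> e != q -> ~~ L (Hor e k),
      ~~ L (Ver p k) & ~~ ver L p k].
Proof.
move=> Lp Lq pq ne; have := degree_le2 p k; rewrite degree_hor // (bigD1 q) /=; last first.
  by rewrite pq eq_sym.
rewrite Lq => le2; split; try by move: le2; case: (L _); case: (ver _ _ _) => //=; lia.
move=> e pe ep eq; apply/negP => Le; move: le2.
by rewrite (bigD1 e) /= ?pe ?ep ?eq // Le; lia.
Qed.

Lemma degree_hor_ver d k : L (Hor d k) -> L (Ver d k) ->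
  (forall e, same_vertex d e -> e != d -> ~~ L (Hor e k)) /\ ~~ ver L d k.
Proof.
move=> Ld Lv; have := degree_le2 d k; rewrite degree_hor // Lv => le2.
split; last by move: le2; case: (ver _ _ _) => //=; lia.
move=> e de ne; apply/negP => Le; move: le2.
by rewrite (bigD1 e) /= ?de ?ne // Le; lia.
Qed.

Lemma degree_ver_hor d k : L (Hor d k.+1) -> L (Ver d k) ->
  (forall e, same_vertex d e -> e != d -> ~~ L (Hor e k.+1)) /\ ~~ L (Ver d k.+1).
Proof.
move=> Ld Lv; have := degree_le2 d k.+1; rewrite degree_hor //= Lv => le2.
split; last by move: le2; case: (L _) => //=; lia.
move=> e de ne; apply/negP => Le; move: le2.
by rewrite (bigD1 e) /= ?de ?ne // Le; lia.
Qed.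

(* [t d k + t d k.+1] is the centre, doubled, of the reflection which is the holonomy
   of a meridian of the arc [Hor d k]; consecutive arcs have conjugate meridians. *)
Lemma corner_hor t d k (p := face d) (q := edge d) :
    cocycle L t -> L (Hor d k) -> L (Hor p k) -> p != q ->
  t d k + t d k.+1 = t p k + t p k.+1.
Proof.
move=> tL Ld Lp ne; have Eq : node p = q by rewrite node_face.
have Lq : L (Hor q k) by rewrite hor_edge.
have pq : same_vertex p q by have := fconnect1 node p; rewrite Eq.
have qp : same_vertex q p by rewrite same_vertex_sym.
have pE : p = finv node q by rewrite -Eq finv_f //; apply: node_inj.
have [Lo nv nv'] := degree_hor2 Lp Lq pq ne.
have [T1 T2 T3] := tL.
have [u hu] := T3 p k nv'.
(* [u] is a section in layer k and [v] one in layer k + 1 with the same value at [q]. Only [p] and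
   [q] carry arcs of level k at this vertex, so the two agree in every corner except the one between
   [p] and [q]; their values in that corner give the relation. *)
have [v [vq hv]] := partial_sectionP L t k.+1 q (u q).
have hvq := flat_partial_section tL (d := q) (k := k.+1).
rewrite /= -(ver_same _ _ pq) nv in hvq; have {}hvq := hvq v isT hv.
have uv e : same_vertex q e -> e = p \/ u e = v e.
  move: e; apply: (orbit_ind (f := node)) => [|e qe]; first by right.
  case=> [->|uve neq]; first by rewrite Eq eqxx.
  case: (eqVneq (node e) p) => [|nep]; [by left | right].
  rewrite hv // hu ?(same_vertex_left pq) // uve sgS T2.
    by rewrite (negPf (Lo _ _ _ _)) // same_vertex_node (same_vertex_left pq).
  by apply: Lo => //; rewrite same_vertex_node (same_vertex_left pq).
pose o := finv node p; have Eo : node o = p by rewrite /o f_finv //; apply: node_inj.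
have qo : same_vertex q o by rewrite same_vertex_finv.
have uvo : u o = v o.
  by case: (uv o qo) => // op; case/negP: ne; rewrite -Eq -{1}Eo op.
have up : u p = sg L p k * u o + t p k.
  by rewrite -{1}Eo hu ?Eo // (same_vertex_left pq).
have vp : v p = - sg L p k * u o + t p k.+1.
  by rewrite -{1}Eo hv ?Eo // sgS Lp uvo.
have uq : u q = sg L q k * u p + t q k.
  by rewrite -{1}Eq hu ?Eq //; apply: connect0.
rewrite -pE vq sgS Lq in hvq.
have tq : t q k = - (sg L d k * t d k) by rewrite T1.
have tq' : t q k.+1 = sg L d k * t d k.+1 by rewrite T1 sgS Ld mulNr opprK.
have sn0 : sg L d k != 0 by rewrite signr_eq0.
have E1 : sg L d k * (u p + v p) = sg L d k * (t d k + t d k.+1).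
  by move: uq hvq; rewrite sg_edge tq tq'; lra.
by move/(mulfI sn0): E1 => <-; rewrite up vp; ring.
Qed.

(** No vertical arc passes through layer k at this vertex, and its transitions there differ from
    those of layer k + 1 only across [d]. So [u] is also a partial section of layer k, where it must
    close up. *)
Lemma corner_ver_up t d k u : cocycle L t -> L (Hor d k) -> L (Ver d k) ->
    partial_section L t k.+1 d u ->
  u d = - sg L d k.+1 * u (finv node d) + t d k.
Proof.
move=> tL Ld Lv hu; have [Lo nv] := degree_hor_ver Ld Lv.
rewrite sgS Ld opprK; apply: (flat_partial_section tL nv) => e de ne.
have Le := Lo (node e); rewrite same_vertex_node in Le; have {}Le := Le de ne.
by have [_ T2 _] := tL; rewrite /step hu // sgS (negPf Le) T2.
Qed.

(** The mirror image of [corner_ver_up]: here the unobstructed layer is k + 2, above the vertical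
    arc. *)
Lemma corner_ver_down t d k u : cocycle L t -> L (Hor d k.+1) -> L (Ver d k) ->
    partial_section L t k.+1 d u ->
  u d = - sg L d k.+1 * u (finv node d) + t d k.+2.
Proof.
move=> tL Ld Lv hu; have [Lo nv] := degree_ver_hor Ld Lv.
have := @flat_partial_section S L t k.+2 d u tL nv; rewrite sgS Ld; apply => e de ne.
have Le := Lo (node e); rewrite same_vertex_node in Le; have {}Le := Le de ne.
by have [_ T2 _] := tL; rewrite /step hu // (sgS _ _ k.+1) (negPf Le) (T2 _ k.+1).
Qed.

End Corners.

(** * Isotopy invariance: pushes *)

(* Unlike [push] this relation is symmetric.  It drops the condition on degrees: that both
   links are manifolds is enough for invariance. *)
Definition swaps (S : surface) (L L' : link S) c1 c2 : Prop :=
  [/\ two_cell (c1 ++ c2), uniq [seq (froot node y.2.1, y.2.2) | y <- c1 ++ c2],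
      (0 < size c1)%N /\ (0 < size c2)%N,
      all (fun y => L y.1) c1 /\ all (fun y => ~~ L y.1) c2 &
      forall a, L' a = L a (+) has (fun y => same_arc a y.1) (c1 ++ c2)].

Lemma same_arc_refl (S : surface) (a : Defs.arc S) : same_arc a a.
Proof. by case: a => d k /=; rewrite eqxx ?eqxx //; apply: connect0. Qed.

Lemma two_cell_rot (S : surface) n (c : seq (Defs.arc S * (dart S * nat))) :
  two_cell c -> two_cell (rot n c).
Proof.
case=> [[d [k ->]]|[d [k [r ->]]]].
  left; have [le_n|lt_n] := leqP (size (face_cycle d k)) n.
    by exists d, k; rewrite rot_oversize.
  rewrite size_map in lt_n; set x := nth d (orbit (@face S) d) n.
  exists x, k; rewrite /face_cycle -map_rot; congr (map _ _).
  have cyc := cycle_orbit (@face_inj S) d; have un := orbit_uniq (@face S) d.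
  by rewrite (orbitE cyc un (mem_nth _ lt_n)) index_uniq.
right; case: (leqP (size (rot r (wall_cycle d k))) n) => [le|/ltnW ge].
  by exists d, k, r; rewrite rot_oversize.
rewrite size_rot in ge.
have [ler|] := leqP (size (wall_cycle d k)) r.
  by exists d, k, n; rewrite (rot_oversize ler).
by move/ltnW => ltr; exists d, k; eexists; rewrite rot_add_mod.
Qed.

Lemma push_swaps (S : surface) (L L' : link S) :
  push L L' -> exists c1 c2, swaps L L' c1 c2.
Proof.
case=> c1 [x [c2 [cell un [c1n Lc1] [Lx Lc2] L'E]]].
exists c1, (x :: c2); split=> //.
split=> //=; rewrite Lx; apply: sub_all Lc2 => y.
by case/andP.
Qed.

Lemma all_imp2 (T : Type) (a b c : pred T) s :
  all a s -> all b s -> (forall x, a x -> b x -> c x) -> all c s.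
Proof.
by move=> + + abc; elim: s => //= x s IHs /andP[ax /IHs as_] /andP[bx /as_ ->]; rewrite abc.
Qed.

Lemma swaps_sym (S : surface) (L L' : link S) c1 c2 :
  swaps L L' c1 c2 -> swaps L' L c2 c1.
Proof.
case=> cell un [n1 n2] [Lc1 Lc2] L'E.
have c12 : rot (size c1) (c1 ++ c2) = c2 ++ c1 by rewrite rot_size_cat.
have hasE a : has (fun y => same_arc a y.1) (c2 ++ c1) = has (fun y => same_arc a y.1) (c1 ++ c2).
  by rewrite !has_cat orbC.
have L'c : all (fun y => L' y.1 == ~~ L y.1) (c1 ++ c2).
  case E: (c1 ++ c2) => [//|y0 c]; rewrite -E; apply/(all_nthP y0) => i lti.
  rewrite L'E (_ : has _ _) ?addbT //; apply/(has_nthP y0); exists i => //.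
  exact: same_arc_refl.
move: L'c; rewrite all_cat => /andP[L'c1 L'c2].
split=> //; first by rewrite -c12; apply: two_cell_rot.
- by rewrite -c12 map_rot rot_uniq.
- split; [apply: all_imp2 Lc2 L'c2 _ | apply: all_imp2 Lc1 L'c1 _] => y.
    by move=> /negPf-> /eqP->.
  by move=> -> /eqP->.
- by move=> a; rewrite hasE L'E addbK.
Qed.

Section FaceSwap.
Variables (S : surface) (L L' : link S) (d0 : dart S) (k0 : nat).
Variables (c1 c2 : seq (Defs.arc S * (dart S * nat))).
Hypotheses (sw : swaps L L' c1 c2) (cE : c1 ++ c2 = face_cycle d0 k0).
Implicit Types (d e p q : dart S) (t : dart S -> nat -> rat).

Let O : pred (dart S) := fconnect (@face S) d0.
Let bd d := O d || O (edge d).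

Lemma face_swap_mem e : (e \in orbit (@face S) d0) = O e.
Proof. by rewrite /O -fconnect_orbit. Qed.

Lemma face_swap_hor e k : L' (Hor e k) = L (Hor e k) (+) ((k == k0) && bd e).
Proof.
case: sw => _ _ _ _ ->; congr (_ (+) _); rewrite cE has_map.
apply/hasP/andP => [[e' Oe' /= /andP[-> E]]|[/eqP-> /orP[]Oe]].
- split=> //; rewrite /bd -!face_swap_mem.
  by case/orP: E => /eqP<-; rewrite Oe' ?orbT.
- by exists e; rewrite ?face_swap_mem //= !eqxx.
by exists (edge e); rewrite ?face_swap_mem //= !eqxx orbT.
Qed.

Lemma face_swap_ver e k : L' (Ver e k) = L (Ver e k).
Proof.
by case: sw => _ _ _ _ ->; rewrite cE has_map -[RHS]addbF; congr (_ (+) _); elim: (orbit _ _).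
Qed.

Lemma face_swap_split : exists s1 s2, [/\ s1 ++ s2 = orbit (@face S) d0,
  (0 < size s1)%N, (0 < size s2)%N,
  forall e, e \in s1 -> L (Hor e k0) & forall e, e \in s2 -> ~~ L (Hor e k0)].
Proof.
case: sw => _ _ [n1 n2] [Lc1 Lc2] _.
have c1E : c1 = take (size c1) (face_cycle d0 k0) by rewrite -cE take_size_cat.
have c2E : c2 = drop (size c1) (face_cycle d0 k0) by rewrite -cE drop_size_cat.
move: (size c1) c1E c2E => m c1E c2E.
rewrite c1E -map_take size_map in n1; rewrite c2E -map_drop size_map in n2.
rewrite c1E -map_take all_map in Lc1; rewrite c2E -map_drop all_map in Lc2.
exists (take m (orbit (@face S) d0)), (drop m (orbit (@face S) d0)).
by rewrite cat_take_drop; split=> //; apply/allP.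
Qed.

Lemma face_swap_vertex d e : O d -> O e -> same_vertex d e -> d = e.
Proof.
rewrite -!face_swap_mem => Od Oe de; have: uniq [seq froot node e | e <- orbit (@face S) d0].
  case: sw => _ + _ _ _; rewrite cE -map_comp => un.
  by apply: (@map_uniq _ _ (fun v => (v, k0))); rewrite -map_comp.
move=> /uniqP un; have := un (froot node d0) (index d (orbit (@face S) d0)) (index e (orbit (@face S) d0)).
rewrite !inE !size_map !index_mem Od Oe !(nth_map d0) ?index_mem // !nth_index //.
move=> /(_ isT isT) H; rewrite -(nth_index d0 Od) -(nth_index d0 Oe); congr (nth _ _ _).
by apply: H; apply/eqP; rewrite same_vertex_froot.
Qed.

Lemma face_swap_face d : O (face d) = O d.
Proof. exact: fconnect_f_r (@face_inj S) d0 d. Qed.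

(** Corners of the face lie at distinct vertices, so a face on both sides of an edge would have just
    the two darts of that edge. The run inside [L] and the run outside it would then be the same
    arc. *)
Lemma face_swap_edge d : O d -> ~~ O (edge d).
Proof.
move=> Od; apply/negP => Oe.
have fe : face d = edge d.
  by apply: face_swap_vertex; rewrite ?face_swap_face // -node_face same_vertex_node; apply: connect0.
have fed : face (edge d) = d.
  apply: face_swap_vertex; rewrite ?face_swap_face // face_edge same_vertex_sym same_vertex_finv; exact: connect0.
have sub e : O e -> e = d \/ e = edge d.
  move: (Od); rewrite /O fconnect_sym => [dd0 d0e|]; last exact: face_inj.
  have: fconnect (@face S) d e by apply: connect_trans dd0 d0e.
  move: e {d0e}; apply: (orbit_ind (f := @face S)) => [|e _ [->|->] _]; first by left.
    by right.
  by left.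
have LO e : O e -> L (Hor e k0) = L (Hor d k0).
  by case/sub => ->; rewrite ?hor_edge.
have [s1 [s2 [sE]]] := face_swap_split.
case: s1 s2 sE => [//|x s1] [|y s2] // sE _ _ L1 L2.
have := L2 y (mem_head _ _); rewrite LO -?face_swap_mem -?sE ?mem_cat ?mem_head ?orbT //.
by rewrite -(LO x) -?face_swap_mem -?sE ?mem_head // L1 ?mem_head.
Qed.

Lemma face_swap_par e k :
  par L' e k = par L e k (+) ((k0 < k)%N && bd e).
Proof.
elim: k => //= k ->; rewrite face_swap_hor; case: (ltngtP k k0) => [lt|gt|->].
- by rewrite (_ : (k0 < k.+1)%N = false) ?addbF //; lia.
- by rewrite (_ : (k0 < k.+1)%N) ?addbF /= 1?addbAC //; lia.
by rewrite ltnSn /= addbF addbA.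
Qed.

Lemma face_swap_sg e k :
  sg L' e k = if (k0 < k)%N && bd e then - sg L e k else sg L e k.
Proof.
rewrite /sg face_swap_par; case: (_ && _); last by rewrite addbF.
by rewrite addbT signrN.
Qed.

(** The arcs of [L] on the face form one run of consecutive arcs, along which [corner_hor]
    propagates the doubled centre. *)
Lemma face_swap_centre t : cocycle L t ->
  exists r, forall e, O e -> L (Hor e k0) -> t e k0 + t e k0.+1 = r.
Proof.
move=> tL; have [s1 [s2 [sE n1 n2 L1 L2]]] := face_swap_split.
exists (t d0 k0 + t d0 k0.+1) => e Oe Le.
have {Oe}es : e \in s1.
  move: Oe; rewrite -face_swap_mem -sE mem_cat => /orP[//|/L2].
  by rewrite Le.
have s1E : s1 = traject (@face S) d0 (size s1).
  rewrite -(take_traject _ d0 (k := size s1) (n := order (@face S) d0)).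
    by rewrite -/(orbit _ _) -sE take_size_cat.
  by rewrite -size_orbit -sE size_cat leq_addr.
have [i lti ->] : exists2 i, (i < size s1)%N & e = iter i (@face S) d0.
  by move: es; rewrite {1}s1E => /trajectP.
elim: i lti => //= i IHi lti; rewrite -(IHi (ltnW lti)); set d := iter i _ _.
have Ld j : (j < size s1)%N -> L (Hor (iter j (@face S) d0) k0).
  by move=> ltj; apply: L1; rewrite s1E; apply/trajectP; exists j.
symmetry; apply: (corner_hor tL); [by apply: Ld; apply: ltnW|exact: (Ld i.+1)|].
have Od : O d by apply: fconnect_iter.
by apply: contraNneq (face_swap_edge Od) => <-; rewrite face_swap_face.
Qed.

(** Above level [k0] the fibre over the face is reflected by x |-> r - x, where r is the doubled
    centre of the run. This is a change of gauge, so flatness around vertices survives, and across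
    each arc removed from [L] it makes layers [k0] and [k0.+1] agree. At the top the colour of the
    face flips and [X] absorbs r. *)
Lemma face_swap_class b : admits_class L b -> admits_class L' b.
Proof.
case=> xi [t [s [X [K [[xif xiE] tL [Xf XE] noy]]]]].
have [r rE] := face_swap_centre tL; have [T1 T2 T3] := tL.
pose g k d x := if (k0 < k)%N && O d then r - x else x : rat.
have Oedge d : O (edge (node d)) = O d by rewrite -face_swap_face face_edge_node.
exists (fun d => xi d (+) O d).
exists (fun d k => if (k0 < k)%N then
   if O d then r - t d k else if O (edge d) then t d k + sg L d k * r else t d k
   else t d k).
exists s, (fun d => if O d then X d - (-1) ^+ xi d * r else X d), (maxn K k0.+1).
split.
- split=> [d|d k]; first by rewrite xif face_swap_face.
  rewrite geq_max => /andP[Kk ltk]; rewrite (xiE _ _ Kk) face_swap_par ltk /= /bd.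
  have := @face_swap_edge d; case: (O d) (O (edge d)) => [] [] // H; try (by have := H isT);
    by case: (xi d); case: (par _ _ _).
- split=> [d k|d k|d k].
  + rewrite face_swap_sg edgeK /bd; have := @face_swap_edge d; have := sg_sqr L d k.
    case: (_ < _)%N; case: (O d) (O (edge d)) => [] [] //= ss H; try (by have := H isT);
      rewrite T1 ?sg_edge //; first by ring.
    by rewrite mulNr mulrDr mulrA ss; ring.
  + rewrite face_swap_hor; case: (ltngtP k k0) => [lt|gt|->] /=.
    * by rewrite addbF => /T2->; rewrite (_ : (k0 < k.+1)%N = false) //; lia.
    * rewrite addbF => nL; rewrite (_ : (k0 < k.+1)%N) ?T2 //; last by lia.
      by rewrite sgS (negPf nL).
    rewrite ltnSn /bd; have Od := @face_swap_edge d.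
    case Od1: (O d) Od => Od.
      rewrite (negPf (Od isT)) /= addbT negbK => Ld.
      by rewrite -(rE d) // addrK.
    case Oe: (O (edge d)) => /=; last by rewrite addbF => /T2.
    rewrite addbT negbK => Ld; rewrite -(rE (edge d)) ?hor_edge // !T1 sgS Ld.
    transitivity (t d k0.+1 + sg L d k0 * sg L d k0 * (t d k0 - t d k0.+1)); first by ring.
    by rewrite sg_sqr; ring.
  + move=> nv; have {}nv : ~~ ver L d k by case: k nv => //= k; rewrite face_swap_ver.
    have [u uE] := T3 d k nv; exists (fun e => g k e (u e)) => e de.
    rewrite /step face_swap_sg uE // /g /bd !Oedge.
    case: (_ < _)%N => //=; have := @face_swap_edge (node e); rewrite !Oedge.
    case: (O (node e)) (O e) => [] [] //= H; try (by have := H isT); by ring.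
- split=> [d|d k]; first by rewrite face_swap_face Xf xif.
  rewrite geq_max => /andP[Kk ltk]; rewrite ltk ltn0; have := @face_swap_edge d.
  have := XE d k Kk; have := xiE d k Kk; rewrite /sg.
  case: (O d) (O (edge d)) => [] [] //= xe XEd H; try (by have := H isT).
  + by rewrite addbT signrN; move: XEd; lra.
  + rewrite addbF xe signr_addb -/(sg L d k); move: XEd.
    by rewrite mulrDr mulrA => ->; ring.
  + by rewrite addbF.
move=> hb y [yf yE]; apply: (noy hb y); split=> // d k.
(* Some boundary arc of the face is in [L'] but not in [L]. Across it [y] obeys the old transition
   in layer [k0] and the reflected one in layer [k0.+1], so its value on the face is the fixed point
   of the reflection; undoing the reflection then leaves [y] unchanged. *)
have yr d1 : O d1 -> 2 * y d1 = r.
  move=> Od1; have [s1 [s2 [sE n1 n2 L1 L2]]] := face_swap_split.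
  case: s2 sE n2 L2 => // e s2 sE _ L2; have nLe := L2 e (mem_head _ _).
  have Oe : O e by rewrite -face_swap_mem -sE mem_cat mem_head orbT.
  have -> : y d1 = y e.
    have: fconnect (@face S) e d1.
      by apply: connect_trans Od1; rewrite fconnect_sym //; apply: face_inj.
    by move: d1 {Od1}; apply: (orbit_ind (f := @face S)) => // d1 _ <- _; rewrite yf.
  have := yE e k0; have := yE e k0.+1; rewrite !face_swap_sg /bd Oe ltnn ltnSn /=.
  by rewrite sgS (negPf nLe) T2 //; lra.
have := yE d k; rewrite face_swap_sg /bd; case: (_ < _)%N => //=.
have := yr d; have := yr (edge d); have := @face_swap_edge d.
case: (O d) (O (edge d)) => [] [] //= H r1 r2; try (by have := H isT).
- by have := r2 isT; lra.
by rewrite -(r1 isT); lra.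
Qed.

End FaceSwap.

Section WallSwap.
Variables (S : surface) (L L' : link S) (d : dart S) (k0 r : nat).
Variables (c1 c2 : seq (Defs.arc S * (dart S * nat))).
Hypotheses (sw : swaps L L' c1 c2) (cE : c1 ++ c2 = rot r (wall_cycle d k0)).
Implicit Types (e p : dart S) (t : dart S -> nat -> rat) (u y : dart S -> rat).

Let q := edge d.
Let h0 := L (Hor d k0).
Let h1 := L (Hor d k0.+1).
Let v0 := L (Ver d k0).
Let v1 := L (Ver q k0).

Lemma wall_swap_has a :
  L' a = L a (+) has (fun z => same_arc a z.1) (wall_cycle d k0).
Proof.
case: sw => _ _ _ _ ->; congr (_ (+) _).
by rewrite cE has_rot.
Qed.

Lemma wall_swap_hor e k : L' (Hor e k) =
  L (Hor e k) (+) (((k == k0) || (k == k0.+1)) && ((e == d) || (e == q))).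
Proof.
rewrite wall_swap_has /= orbF /=; congr (_ (+) _); rewrite -/q.
have -> : (d == edge e) = (e == q) by rewrite -(inv_eq (@edgeK S)) eq_sym.
have -> : (q == edge e) = (e == d) by rewrite (inj_eq (inv_inj (@edgeK S))) eq_sym.
rewrite (eq_sym d) (eq_sym q).
by case: (k == k0); case: (k == k0.+1); case: (e == d); case: (e == q).
Qed.

Lemma wall_swap_ver e k : L' (Ver e k) =
  L (Ver e k) (+) ((k == k0) && (same_vertex e d || same_vertex e q)).
Proof.
rewrite wall_swap_has /= orbF /= -/q; congr (_ (+) _).
by case: (k == k0); rewrite //= orbC.
Qed.

Lemma wall_swap_vertex : ~~ same_vertex d q.
Proof.
case: sw => _ + _ _ _; rewrite cE map_rot rot_uniq /= !inE !negb_or -/q.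
case/andP => /and3P[+ _ _] _; apply: contra => dq.
by move: dq; rewrite -same_vertex_froot => /eqP->.
Qed.

Lemma wall_swap_neq : d != q.
Proof. by rewrite eq_sym edge_neq. Qed.

Lemma wall_swap_runs :
  [/\ ~~ [&& h0, h1, v0 & v1], [|| h0, h1, v0 | v1],
      h0 && h1 -> v0 || v1 & v0 && v1 -> h0 || h1].
Proof.
case: sw => _ _ [n1 n2] [Lc1 Lc2] _.
have E : rot r [:: h0; v1; h1; v0] = nseq (size c1) true ++ nseq (size c2) false.
  transitivity [seq L z.1 | z <- c1 ++ c2].
    by rewrite cE map_rot /= -/q hor_edge.
  rewrite map_cat; congr (_ ++ _).
    by elim: (c1) Lc1 => //= x s IHs /andP[-> /IHs->].
  by elim: (c2) Lc2 => //= x s IHs /andP[/negPf-> /IHs->].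
have sz : (size c1 + size c2)%N = 4.
  by have := congr1 size E; rewrite size_rot size_cat !size_nseq.
have [r' [ltr' {}E]] : exists r', (r' < 4)%N /\
   rot r' [:: h0; v1; h1; v0] = nseq (size c1) true ++ nseq (size c2) false.
  have [ler|ltr] := leqP 4 r; last by exists r.
  by exists 0%N; rewrite rot0 -E rot_oversize.
move: E; rewrite (_ : size c2 = 4 - size c1)%N; last by lia.
have: (0 < size c1 < 4)%N by lia.
case: (size c1) => [|[|[|[|n]]]] //= _; move: r' ltr' => [|[|[|[|r']]]] //= _;
  by rewrite /rot /= => -[-> -> -> ->].
Qed.

Lemma wall_swap_par e k :
  par L' e k = par L e k (+) ((k == k0.+1) && ((e == d) || (e == q))).
Proof.
elim: k => //= k ->; rewrite wall_swap_hor !eqSS.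
case: (eqVneq k k0) => [->|_] /=; last first.
  by case: (_ == _); case: (_ || _); rewrite ?addbF // !addbT addNb addbN negbK.
by rewrite (ltn_eqF (ltnSn k0)) addbF addbA.
Qed.

Lemma wall_swap_sg e k : sg L' e k =
  if (k == k0.+1) && ((e == d) || (e == q)) then - sg L e k else sg L e k.
Proof.
rewrite /sg wall_swap_par; case: (_ && _); last by rewrite addbF.
by rewrite addbT signrN.
Qed.

Let sigma := sg L d k0.+1.

(** [tau] is to be the translation of the new transition across [d] in layer [k0.+1], whose sign is
    reversed. Each side of the wall in [L] prescribes it: a horizontal one through the adjacent
    layer, with which layer [k0.+1] must now agree, a vertical one through the closing condition at
    a vertex it no longer blocks. Consecutive arcs prescribe the same value. *)
Lemma wall_swap_value t : cocycle L t -> exists tau,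
  [/\ h0 -> tau = t d k0, h1 -> tau = t d k0.+2,
      v0 -> forall u, partial_section L t k0.+1 d u ->
            u d = - sigma * u (finv node d) + tau &
      v1 -> forall u, partial_section L t k0.+1 q u ->
            u q = - sigma * u (finv node q) + sigma * tau].
Proof.
move=> tL; have [T1 T2 T3] := tL; have [_ or hh vv] := wall_swap_runs.
have ss : sigma * sigma = 1 by apply: sg_sqr.
have sn0 : sigma != 0 by rewrite signr_eq0.
have sq : sg L q k0.+1 = sigma by rewrite sg_edge.
have U0 : h0 -> v1 -> forall u, partial_section L t k0.+1 q u ->
    u q = - sigma * u (finv node q) + sigma * t d k0.
  move=> H0 V1 u hu; have Lq : L (Hor q k0) by rewrite /q hor_edge; exact: H0.
  by rewrite (corner_ver_up tL Lq V1 hu) sq T1 /sigma sgS -/h0 H0; ring.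
have U1 : h1 -> v1 -> forall u, partial_section L t k0.+1 q u ->
    u q = - sigma * u (finv node q) + sigma * t d k0.+2.
  move=> H1 V1 u hu; have Lq : L (Hor q k0.+1) by rewrite /q hor_edge; exact: H1.
  by rewrite (corner_ver_down tL Lq V1 hu) sq T1 (sgS _ _ k0.+1) -/h1 H1 -/sigma; ring.
have H0v : h0 -> h1 -> t d k0 = t d k0.+2.
  move=> H0 H1; case/orP: (hh (introT andP (conj H0 H1))) => V.
    have [u [_ hu]] := partial_sectionP L t k0.+1 d 0.
    by have := corner_ver_up tL H0 V hu; rewrite (corner_ver_down tL H1 V hu); lra.
  have [u [_ hu]] := partial_sectionP L t k0.+1 q 0.
  have := U0 H0 V u hu; rewrite (U1 H1 V u hu) => /addrI.
  by move/(mulfI sn0).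
have [H0|nH0] := boolP h0.
  by exists (t d k0); split=> // [/(H0v H0)|V u /(corner_ver_up tL H0 V)|/(U0 H0)].
have [H1|nH1] := boolP h1.
  by exists (t d k0.+2); split=> // [V u /(corner_ver_down tL H1 V)|/(U1 H1)].
(* Only one vertical side is left. It prescribes the value read off from any one partial section, by
   [partial_section_diff]. *)
have D x : L (Ver x k0) -> forall u u', partial_section L t k0.+1 x u ->
    partial_section L t k0.+1 x u' ->
    u x + sg L x k0.+1 * u (finv node x) = u' x + sg L x k0.+1 * u' (finv node x).
  move=> Vx u u' hu hu'; have := partial_section_diff hu hu'.
  by rewrite /= Vx expr1; lra.
rewrite (negPf nH0) (negPf nH1) /= in or vv.
have [V0|nV0] := boolP v0.
  have nV1 : ~~ v1 by apply/negP => V1; have := vv (introT andP (conj V0 V1)).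
  have [u0 [_ hu0]] := partial_sectionP L t k0.+1 d 0.
  exists (u0 d + sigma * u0 (finv node d)).
  split=> // [_ u hu|V1]; last by rewrite V1 in nV1.
  by have := D d V0 u u0 hu hu0; rewrite -/sigma; lra.
rewrite (negPf nV0) /= in or.
have [u0 [_ hu0]] := partial_sectionP L t k0.+1 q 0.
exists (sigma * (u0 q + sigma * u0 (finv node q))).
split=> // _ u hu.
by have := D q or u u0 hu hu0; rewrite sq mulrA ss mul1r; lra.
Qed.

Lemma wall_swap_class b : admits_class L b -> admits_class L' b.
Proof.
case=> xi [t [s [X [K [[xif xiE] tL [Xf XE] noy]]]]].
have [tau [th0 th1 tv0 tv1]] := wall_swap_value tL; have [T1 T2 T3] := tL.
have ss : sigma * sigma = 1 by apply: sg_sqr.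
have dq := wall_swap_neq.
have sq : sg L q k0.+1 = sigma by rewrite sg_edge.
have ndq := wall_swap_vertex.
have [nall _ _ _] := wall_swap_runs.
pose t' e k := if k == k0.+1 then
   if e == d then tau else if e == q then sigma * tau else t e k else t e k.
have t'E e k : k != k0.+1 -> t' e k = t e k by rewrite /t' => /negPf->.
exists xi, t', s, X, (maxn K k0.+2).
split.
- split=> // e k; rewrite geq_max => /andP[Kk ltk]; rewrite (xiE _ _ Kk) wall_swap_par.
  by rewrite (gtn_eqF ltk) addbF.
- split=> [e k|e k|e k].
  + rewrite wall_swap_sg /t'; case: eqP => [->|_] /=; last exact: T1.
    rewrite (inv_eq (@edgeK S)) -/q (inj_eq (inv_inj (@edgeK S))).
    case: (eqVneq e d) => [->|ned] /=; first by rewrite (negPf dq) -/sigma; ring.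
    case: (eqVneq e q) => [->|neq] /=; last exact: T1.
    by rewrite sq mulNr opprK mulrA ss mul1r.
  + rewrite wall_swap_hor /t' eqSS.
    case: (eqVneq k k0) => [->|nk] /=.
      rewrite (ltn_eqF (ltnSn k0)).
      case: (eqVneq e d) => [->|ned] /=; first by rewrite addbT negbK => /th0.
      case: (eqVneq e q) => [->|neq] /=; last by rewrite addbF => /T2.
      rewrite addbT negbK hor_edge => H0.
      by rewrite th0 // T1 /sigma sgS H0 mulNr.
    case: (eqVneq k k0.+1) => [->|nk'] /=; last by rewrite addbF => /T2.
    case: (eqVneq e d) => [->|ned] /=; first by rewrite addbT negbK => /th1.
    case: (eqVneq e q) => [->|neq] /=; last by rewrite addbF => /T2.
    rewrite addbT negbK hor_edge => H1.
    by rewrite th1 // T1 (sgS _ _ k0.+1) H1 mulNr opprK.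
  case: (eqVneq k k0.+1) => [->|nk] nv; last first.
    have {}nv : ~~ ver L e k.
      case: k nk nv => //= k; rewrite eqSS wall_swap_ver => /negPf->.
      by rewrite addbF.
    have [u uE] := T3 e k nv; exists u => x ex.
    by rewrite /step t'E // wall_swap_sg (negPf nk) uE.
  move: nv; rewrite /= wall_swap_ver eqxx /=.
  case: (boolP (same_vertex e d)) => [ed|ned] /=.
    rewrite addbT negbK (ver_same _ _ ed) => V0.
    have [u [_ hu]] := partial_sectionP L t k0.+1 d 0.
    exists u => x; rewrite (same_vertex_left ed) => dx.
    rewrite /step /t' wall_swap_sg eqxx /=.
    case: (eqVneq (node x) d) => [xd|nxd] /=.
      rewrite xd tv0 // -[in finv node d]xd finv_f //; exact: node_inj.
    case: eqP => [xq|_] /=; last exact: hu.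
    by move: ndq; rewrite -xq same_vertex_node dx.
  case: (boolP (same_vertex e q)) => [eq|neq] /=.
    rewrite addbT negbK (ver_same _ _ eq) => V1.
    have [u [_ hu]] := partial_sectionP L t k0.+1 q 0.
    exists u => x; rewrite (same_vertex_left eq) => qx.
    rewrite /step /t' wall_swap_sg eqxx /=.
    case: (eqVneq (node x) d) => [xd|nxd] /=.
      by move: ndq; rewrite same_vertex_sym -xd same_vertex_node qx.
    case: (eqVneq (node x) q) => [xq|nxq] /=; last exact: hu.
    rewrite xq tv1 // sq -[in finv node q]xq finv_f //; exact: node_inj.
  rewrite addbF => nv; have [u uE] := T3 e k0.+1 nv; exists u => x ex.
  rewrite /step /t' wall_swap_sg eqxx uE //=.
  case: (eqVneq (node x) d) => [xd|nxd] /=.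
    by move: ned; rewrite -xd same_vertex_node ex.
  case: (eqVneq (node x) q) => [xq|nxq] //=.
  by move: neq; rewrite -xq same_vertex_node ex.
- split=> // e k; rewrite geq_max => /andP[Kk ltk].
  by rewrite !t'E ?(XE _ _ Kk) // gtn_eqF.
move=> hb y [yf yE]; apply: (noy hb y); split=> //.
have yk e k : k != k0.+1 -> y e - sg L e k * y (edge e) = t e k.
  by move=> nk; have := yE e k; rewrite t'E // wall_swap_sg (negPf nk).
have yo e : e != d -> e != q -> y e - sg L e k0.+1 * y (edge e) = t e k0.+1.
  by move=> nd nq; have := yE e k0.+1; rewrite /t' wall_swap_sg eqxx (negPf nd) (negPf nq).
have stepy x : node x != d -> node x != q -> step L t k0.+1 y x.
  by move=> nd nq; rewrite /step -(yo _ nd nq) -[y (edge _)]yf face_edge_node; ring.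
have swapE : y d - sigma * y q = t d k0.+1 <-> y q - sigma * y d = t q k0.+1.
  rewrite T1 -/sigma; split=> [<-|H]; first by rewrite mulrBr mulrA ss; ring.
  have : sigma * (y q - sigma * y d) = sigma * - (sigma * t d k0.+1) by rewrite H.
  by rewrite mulrBr mulrN !mulrA ss; lra.
(* The one equation that [L'] does not supply. Some side of the wall is missing from [L]: a missing
   horizontal side copies the equation from the adjacent layer, and at a missing vertical side the
   old cocycle closes up around the vertex. *)
have yd : y d - sigma * y q = t d k0.+1.
  move: nall; rewrite !negb_and => /or4P[nH0|nH1|nV0|nV1].
  - have := yk d k0; rewrite (ltn_eqF (ltnSn k0)) -/q => /(_ isT).
    by rewrite /sigma sgS -/h0 (negPf nH0) T2.
  - have := yk d k0.+2; rewrite (gtn_eqF (ltnSn k0.+1)) -/q => /(_ isT).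
    by rewrite (sgS _ _ k0.+1) -/h1 (negPf nH1) (T2 _ k0.+1).
  - have /(flat_partial_section tL) -> // : partial_section L t k0.+1 d y; last first.
      by rewrite -face_edge yf -/sigma -/q; ring.
    move=> x dx nx; apply: stepy => //.
    by apply: contraNneq ndq => <-; rewrite same_vertex_node.
  apply/swapE; have /(flat_partial_section tL) -> // : partial_section L t k0.+1 q y; last first.
    by rewrite -face_edge yf sq /q edgeK; ring.
  move=> x qx nx; apply: stepy => //.
  by apply: contraNneq ndq => <-; rewrite same_vertex_sym same_vertex_node.
move=> e k; case: (eqVneq k k0.+1) => [->|]; last exact: yk.
case: (eqVneq e d) => [-> //|nd].
case: (eqVneq e q) => [->|nq]; last exact: yo.
by rewrite sq /q edgeK; apply/swapE.
Qed.

End WallSwap.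

Lemma push_class (S : surface) (L L' : link S) b :
  push L L' -> admits_class L b <-> admits_class L' b.
Proof.
move=> /push_swaps[c1 [c2 sw]].
have oneway (A A' : link S) a1 a2 : swaps A A' a1 a2 -> admits_class A b -> admits_class A' b.
  move=> sw1; have [[[d [k E]]|[d [k [r E]]]] _ _ _ _] := sw1.
    exact: face_swap_class sw1 E b.
  exact: wall_swap_class sw1 E b.
by split; [apply: oneway sw | apply: oneway (swaps_sym sw)].
Qed.

(** * Isotopy invariance: subdivisions *)

Lemma extend_along (T T' : finType) (V : Type) (i : T -> T') (f : T -> V) (g : T' -> V) :
  injective i ->
  exists h, (forall d, h (i d) = f d) /\ (forall z, z \notin codom i -> h z = g z).
Proof.
move=> i_inj; exists (fun z => if [pick d | i d == z] is Some d then f d else g z).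
split=> [d|z zi]; case: pickP => [e /eqP|] //.
- by move/i_inj->.
- by move/(_ d); rewrite eqxx.
by move=> ez; rewrite -ez codom_f in zi.
Qed.

Section FaceDivision.
Variables (S S' : surface) (L : link S) (L' : link S').
Variables (i : dart S -> dart S') (x : dart S').
Implicit Types (d e : dart S) (z w : dart S').
Hypotheses (i_inj : injective i)
  (i_codom : forall z, (z \in codom i) = (z \notin [:: x; edge x]))
  (i_edge : forall d, i (edge d) = edge (i d))
  (i_node : forall d, i (node d) = node_skip x (i d))
  (x_faces : ~~ fconnect (@face S') x (edge x))
  (L'E : forall d k, [/\ L' (Hor (i d) k) = L (Hor d k),
                         L' (Ver (i d) k) = L (Ver d k) &
                         L' (Hor x k) = false]).

Let P : pred (dart S') := mem [:: x; edge x].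

Lemma face_div_im d : ~~ P (i d).
Proof. by rewrite /P inE -i_codom codom_f. Qed.

Lemma face_divP z : P z \/ exists d, z = i d.
Proof.
have [/codomP[d ->]|] := boolP (z \in codom i); first by right; exists d.
by rewrite i_codom negbK; left.
Qed.

Lemma face_div_edge z : P (edge z) = P z.
Proof.
rewrite /P /= !inE (inj_eq (inv_inj (@edgeK S'))) orbC; congr (_ || _).
by rewrite (inv_eq (@edgeK S')).
Qed.

Lemma face_div_par d k : par L' (i d) k = par L d k.
Proof. by elim: k => //= k ->; have [-> _ _] := L'E d k. Qed.

Lemma face_div_sg d k : sg L' (i d) k = sg L d k.
Proof. by rewrite /sg face_div_par. Qed.

Lemma face_div_ver d k : ver L' (i d) k = ver L d k.
Proof. by case: k => //= k; have [_ -> _] := L'E d k. Qed.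

Hypothesis d_wit : dart S.

Lemma face_div_horP z k : P z -> L' (Hor z k) = false.
Proof.
by have [_ _ Lx] := L'E d_wit k; rewrite /P /= !inE => /orP[]/eqP->; rewrite ?hor_edge.
Qed.

Lemma face_div_sgP z k : P z -> sg L' z k = 1.
Proof.
by move=> Pz; rewrite /sg (_ : par _ _ _ = false) //; elim: k => //= k ->; rewrite face_div_horP.
Qed.

Lemma node_skipE w : exists z, [/\ node z = node_skip x w, same_vertex w z &
    forall (V : Type) (f : dart S' -> V),
      (forall z', same_vertex w z' -> P (node z') -> f (node z') = f z') -> f z = f w].
Proof.
rewrite /node_skip -/P; have ww : same_vertex w w by apply: connect0.
case: ifP => Pn; last by exists w; split.
case: ifP => Pnn; last by exists (node w); split=> [||V f fE]; rewrite ?same_vertex_node ?fE.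
by exists (node (node w)); split=> [||V f fE]; rewrite ?same_vertex_node ?fE ?same_vertex_node.
Qed.

Lemma face_div_node e : exists z, [/\ node z = i (node e), same_vertex (i e) z &
    forall (V : Type) (f : dart S' -> V),
      (forall z', same_vertex (i e) z' -> P (node z') -> f (node z') = f z') -> f z = f (i e)].
Proof. by have := node_skipE (i e); rewrite -i_node. Qed.

Lemma face_div_same_vertex d e : same_vertex d e -> same_vertex (i d) (i e).
Proof.
move: e; apply: (orbit_ind (f := node)) => [|e _ de _]; first exact: connect0.
have [z [<- ez _]] := face_div_node e.
by rewrite same_vertex_node; apply: same_vertex_trans de ez.
Qed.

Lemma face_div_face (V : Type) (f : dart S' -> V) :
    (forall z, f (face z) = f z) -> f (edge x) = f x ->
  forall d, f (i (face d)) = f (i d).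
Proof.
move=> ff fx d; have [z [zE _ zf]] := face_div_node (face d).
have {}zE : z = face (i d) by rewrite node_face i_edge -node_face in zE; apply: node_inj zE.
rewrite -[RHS]ff -zE zf // => z' _ Pz'; rewrite -[z' in RHS](face_edge_node z') ff.
by move: Pz'; rewrite /P /= !inE => /orP[]/eqP->; rewrite ?edgeK.
Qed.

Lemma face_div_face_cases d :
  [\/ face (i d) = i (face d),
      P (face (i d)) /\ face (edge (face (i d))) = i (face d) |
      P (face (i d)) /\ P (face (edge (face (i d))))].
Proof.
have := i_node (face d); rewrite node_face i_edge -node_face /node_skip -/P.
have inj := @node_inj S'.
case: ifP => Pn; last by move/inj => ->; constructor 1.
case: ifP => Pnn /inj ->; last by constructor 2; rewrite face_edge_node.
by constructor 3; rewrite face_edge_node.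
Qed.

Lemma face_div_faceP w z : P w -> fconnect (@face S') w z -> z != edge w.
Proof.
move=> Pw wz; apply/eqP => zE; move: x_faces Pw wz; rewrite zE /P /= !inE.
move=> nx /orP[]/eqP->; first by rewrite (negPf nx).
by rewrite edgeK fconnect_sym ?(negPf nx) //; apply: face_inj.
Qed.

Lemma face_div_P w z : P w -> P z -> z = w \/ z = edge w.
Proof.
rewrite /P /= !inE => /orP[]/eqP-> /orP[]/eqP->; rewrite ?edgeK; by [left | right].
Qed.

(** If both sides of the new edge were bounded by that edge alone, [x] and [edge x] would be all the
    darts of [S'], against [d_wit]. *)
Lemma face_div_open : exists w d, P w /\ face w = i d.
Proof.
have Px : P x by rewrite /P /= inE eqxx.
have Pex : P (edge x) by rewrite face_div_edge.
have [Pf|[d fE]] := face_divP (face x); last by exists x, d.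
have [Pf'|[d fE]] := face_divP (face (edge x)); last by exists (edge x), d.
have fx : face x = x.
  case: (face_div_P Px Pf) => // E; have := face_div_faceP Px (fconnect1 _ x).
  by rewrite E eqxx.
have fex : face (edge x) = edge x.
  case: (face_div_P Pex Pf') => // E; have := face_div_faceP Pex (fconnect1 _ (edge x)).
  by rewrite E eqxx.
suff /(_ (i d_wit)) : forall z, P z by rewrite (negPf (face_div_im _)).
apply: (surface_ind (d := x)) => // z Pz; last by rewrite face_div_edge.
case: (face_div_P Px Pz) => ->; first by rewrite -fx node_face.
by rewrite -fex node_face edgeK.
Qed.

(** The two sides of the new edge together form one face of [S]. Its value is read off at [d2], the
    dart following the new edge on a side that has other edges; the other side need not have any. *)
Lemma face_div_extend (V : Type) (f : dart S -> V) : (forall d, f (face d) = f d) ->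
  exists f', [/\ forall z, f' (face z) = f' z, forall d, f' (i d) = f d & f' (edge x) = f' x].
Proof.
move=> ff; have [w0 [d2 [Pw0 w0E]]] := face_div_open.
have [f' [f'i f'P]] := extend_along f (fun _ => f d2) i_inj.
have {}f'P z : P z -> f' z = f d2 by move=> Pz; apply: f'P; rewrite i_codom negbK.
exists f'; split=> //; last by rewrite !f'P // /P /= !inE eqxx ?orbT.
have Pe : P (edge w0) by rewrite face_div_edge.
have along z : fconnect (@face S') w0 z -> z != w0 -> exists2 a, z = i a & f a = f d2.
  move: z; apply: (orbit_ind (f := @face S')) => [|z wz IHz fz _]; first by rewrite eqxx.
  have [{}/IHz[a zE fa]|/negPn/eqP zE] := boolP (z != w0); last first.
    by exists d2 => //; rewrite zE.
  have [Pf|[b fb]] := face_divP (face z).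
    case: (face_div_P Pw0 Pf) => E; first by rewrite E eqxx in fz.
    have := face_div_faceP Pw0 (z := face z); rewrite fconnect_f_r; last exact: face_inj.
    by rewrite wz E eqxx => /(_ isT).
  exists b => //; rewrite zE in fb; case: (face_div_face_cases a); rewrite fb.
  - by move/i_inj->; rewrite ff.
  - by rewrite (negPf (face_div_im _)) => -[].
  - by rewrite (negPf (face_div_im _)) => -[].
have nP d : P (i d) = false by exact: negPf (face_div_im d).
move=> z; have [Pz|[a zE]] := face_divP z.
  rewrite (f'P z) //; case: (face_div_P Pw0 Pz) => zE; first by rewrite zE w0E f'i.
  have [Pf|[e fE]] := face_divP (face z); first by rewrite f'P.
  rewrite fE f'i; pose p := finv (@face S') w0.
  have pf : face p = w0 by rewrite /p f_finv //; apply: face_inj.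
  have [||a pa fa] := along p; first by rewrite fconnect_finv.
    by apply/eqP => pw; move: Pw0; rewrite -pf pw w0E nP.
  rewrite -fa; rewrite pa in pf; case: (face_div_face_cases a); rewrite pf.
  - by move=> E; rewrite E nP in Pw0.
  - by rewrite -zE fE => -[_ /i_inj->]; rewrite ff.
  - by rewrite -zE fE nP => -[].
rewrite {}zE f'i; case: (face_div_face_cases a) => [->|[Pf fE]|[Pf fE]].
- by rewrite f'i ff.
- rewrite (f'P _ Pf); case: (face_div_P Pw0 Pf) => E.
    have [||b /i_inj<-] // := along (i a).
      by rewrite -(fconnect_f_r (@face_inj S')) E connect0.
    by apply: contraTneq Pw0 => <-; rewrite nP.
  by move: fE; rewrite E edgeK w0E => /i_inj->; rewrite ff.
rewrite (f'P _ Pf); case: (face_div_P Pw0 Pf) => E.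
  have [||b /i_inj<-] // := along (i a).
    by rewrite -(fconnect_f_r (@face_inj S')) E connect0.
  by apply: contraTneq Pw0 => <-; rewrite nP.
by move: fE; rewrite E edgeK w0E nP.
Qed.

Lemma face_div_restrict b : admits_class L' b -> admits_class L b.
Proof.
case=> xi [t0 [s [X0 [K [[xif xiE] t0L XE0 noy0]]]]].
have [t [X [tL [Xf XE] noy tx]]] : exists t X, [/\ cocycle L' t, ends_match xi t s X K,
    b -> forall y, ~ flat_section L' t y & t x 0%N = 0].
  (* Across the new edge all signs are +1 and the translation is the same in all layers. As its two
     sides are different faces, a gauge supported on the side of [x] makes this translation zero. *)
  pose y z := if fconnect (@face S') x z then - t0 x 0%N else 0.
  have yf z : y (face z) = y z by rewrite /y fconnect_f_r //; apply: face_inj.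
  eexists; eexists; split; first exact: (cocycle_gauge yf t0L).
  - exact: ends_match_gauge yf (conj xif xiE) XE0.
  - by move=> hb z /(flat_section_gauge yf)/(noy0 hb).
  by rewrite /y connect0 (negPf x_faces) /sg /=; ring.
have [T1 T2 T3] := tL.
have Px : P x by rewrite /P /= inE eqxx.
have {}tx k : t x k = 0 by elim: k => // k IHk; rewrite T2 ?face_div_horP.
have tP z k : P z -> t z k = 0.
  by case/(face_div_P Px) => ->; rewrite ?T1 tx ?mulr0 ?oppr0.
have xix : xi (edge x) = xi x.
  rewrite (xiE x K) // (_ : par _ _ _ = false) ?addbF //.
  by elim: (K) => //= k ->; rewrite face_div_horP.
have Xx : X (edge x) = X x by have := XE x K (leqnn K); rewrite !tx !mulr0; lra.
exists (fun d => xi (i d)), (fun d k => t (i d) k), s, (fun d => X (i d)), K; split.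
- split=> [d|d k Kk]; first exact: face_div_face.
  by rewrite i_edge (xiE _ _ Kk) face_div_par.
- split=> [d k|d k|d k].
  + by rewrite i_edge T1 face_div_sg.
  + by have [<- _ _] := L'E d k; apply: T2.
  rewrite -face_div_ver => /T3[u uE]; exists (fun e => u (i e)) => e de.
  have [z [zE iz zf]] := face_div_node e; rewrite /step -zE uE; last first.
    by apply: same_vertex_trans (face_div_same_vertex de) iz.
  rewrite zE face_div_sg zf // => z' iz' Pz'; rewrite uE; last first.
    exact: same_vertex_trans (face_div_same_vertex de) iz'.
  by rewrite face_div_sgP // tP // mul1r addr0.
- split=> [d|d k Kk]; first exact: face_div_face.
  by rewrite XE // i_edge.
move=> hb y [yf yE]; have [y' [y'f y'i y'x]] := face_div_extend yf.
apply: (noy hb y'); split=> // z k; have [Pz|[d ->]] := face_divP z.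
  have yz w : P w -> y' w = y' x by case/(face_div_P Px) => ->.
  by rewrite face_div_sgP // tP // !yz ?face_div_edge // mul1r subrr.
by rewrite -i_edge !y'i face_div_sg yE.
Qed.

(** The new edge gets the identity transition in every layer, so sections pass through it
    unchanged. *)
Lemma face_div_lift b : admits_class L b -> admits_class L' b.
Proof.
case=> xi [t [s [X [K [[xif xiE] tL [Xf XE] noy]]]]]; have [T1 T2 T3] := tL.
have [xi' [xi'f xi'i xi'x]] := face_div_extend xif.
have [X' [X'f X'i X'x]] := face_div_extend Xf.
have [t' [t'i t'P]] := extend_along t (fun _ _ => 0 : rat) i_inj.
have {}t'P z k : P z -> t' z k = 0 by move=> Pz; rewrite t'P // i_codom negbK.
have Px : P x by rewrite /P /= inE eqxx.
have parP z k : P z -> par L' z k = false.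
  by move=> Pz; elim: k => //= k ->; rewrite face_div_horP.
have cE (V : Type) (f : dart S' -> V) z : f (edge x) = f x -> P z -> f (edge z) = f z.
  by move=> fx /(face_div_P Px)[]->; rewrite ?edgeK.
exists xi', t', s, X', K; split.
- split=> // z k Kk; have [Pz|[d ->]] := face_divP z.
    by rewrite parP // addbF (cE _ xi').
  by rewrite -i_edge !xi'i (xiE _ _ Kk) face_div_par.
- split=> [z k|z k|z k].
  + have [Pz|[d ->]] := face_divP z; first by rewrite !t'P ?face_div_edge // mulr0 oppr0.
    by rewrite -i_edge !t'i T1 face_div_sg.
  + have [Pz|[d ->]] := face_divP z; first by rewrite !t'P.
    by have [-> _ _] := L'E d k; rewrite !t'i; apply: T2.
  (* A vertex without darts of [S] could meet only the new edge, and there zero is a section. *)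
  move=> nv; have [[d0 zd]|none] := classic (exists d0, same_vertex z (i d0)); last first.
    exists (fun=> 0) => w zw; rewrite /step t'P ?mulr0 ?addr0 //.
    have [//|[d wE]] := face_divP (node w).
    by case: none; exists d; rewrite -wE same_vertex_node.
  have {}nv : ~~ ver L d0 k.
    by rewrite -face_div_ver; case: k nv => //= k; rewrite (ver_same _ _ zd).
  have [u' [_ hu']] := partial_sectionP L' t' k (i d0) 0.
  have uP w : same_vertex (i d0) w -> P (node w) -> u' (node w) = u' w.
    move=> dw Pw; rewrite hu' ?face_div_sgP ?t'P ?mul1r ?addr0 //.
    by apply: contraTneq Pw => ->; rewrite face_div_im.
  have hu : partial_section L t k d0 (fun e => u' (i e)).
    move=> e de ne; have [w [wE iw wf]] := face_div_node e.
    have dw := same_vertex_trans (face_div_same_vertex de) iw.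
    rewrite /step -wE hu' // ?wE ?(inj_eq i_inj) // face_div_sg t'i wf //.
    by move=> w' iw'; apply: uP; apply: same_vertex_trans (face_div_same_vertex de) iw'.
  have closing := flat_partial_section tL nv hu; rewrite /= in closing.
  exists u' => w zw; case: (eqVneq (node w) (i d0)) => [wd|]; last first.
    by apply: hu'; rewrite -(same_vertex_left zd).
  pose e := finv node d0; have ed : node e = d0 by rewrite /e f_finv //; apply: node_inj.
  have de : same_vertex d0 e by rewrite same_vertex_finv; apply: connect0.
  have [w1 [w1E iw1 w1f]] := face_div_node e.
  have ww1 : w1 = w by apply: (@node_inj S'); rewrite w1E ed wd.
  rewrite /step wd face_div_sg t'i closing -/e -ww1 w1f // => w' iw'; apply: uP.
  exact: same_vertex_trans (face_div_same_vertex de) iw'.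
- split=> // z k Kk; have [Pz|[d ->]] := face_divP z.
    by rewrite !t'P // !mulr0 add0r (cE _ X') // subrr.
  by rewrite -i_edge xi'i !t'i !X'i XE.
move=> hb y' [y'f y'E]; apply: (noy hb (fun d => y' (i d))); split=> [|d k].
  apply: face_div_face => //; have := y'E x 0%N.
  by rewrite t'P // face_div_sgP // mul1r => /eqP; rewrite subr_eq0 => /eqP.
by rewrite i_edge -face_div_sg y'E t'i.
Qed.

End FaceDivision.

Lemma link_dart (S : surface) (L : link S) : exists d : dart S, True.
Proof. by have [[d k|d k] _] := arcs_nonempty L; exists d. Qed.

Lemma face_division_class (S S' : surface) (L : link S) (L' : link S') b :
  face_division L L' -> admits_class L b <-> admits_class L' b.
Proof.
case=> i [x [[i_inj i_codom] i_edge i_node x_faces L'E]]; have [d _] := link_dart L.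
split; first exact: (face_div_lift i_inj i_codom i_edge i_node x_faces L'E d).
exact: (face_div_restrict i_inj i_codom i_edge i_node x_faces L'E d).
Qed.

Section EdgeDivision.
Variables (S S' : surface) (L : link S) (L' : link S').
Variables (i : dart S -> dart S') (a : dart S).
Implicit Types (d e : dart S) (z w : dart S').
Let x := edge (i a).
Let y := edge (i (edge a)).
Hypotheses (i_inj : injective i)
  (i_codom : forall z, (z \in codom i) = (z \notin [:: x; y]))
  (i_edge : forall d, d != a -> d != edge a -> edge (i d) = i (edge d))
  (i_node : forall d, node (i d) = i (node d))
  (node_x : node x = y) (node_y : node y = x)
  (L'E : forall d k, [/\ L' (Hor (i d) k) = L (Hor d k),
                         L' (Ver (i d) k) = L (Ver d k) &
                         L' (Ver x k) = false]).

Lemma edge_div_edgex : edge x = i a. Proof. exact: edgeK. Qed.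
Lemma edge_div_edgey : edge y = i (edge a). Proof. exact: edgeK. Qed.

Lemma edge_divP z : [\/ z = x, z = y | exists d, z = i d].
Proof.
have [/codomP[d ->]|] := boolP (z \in codom i); first by constructor 3; exists d.
rewrite i_codom negbK !inE => /orP[]/eqP->; by [constructor 1 | constructor 2].
Qed.

Lemma edge_div_cases d : [\/ d = a, d = edge a | edge (i d) = i (edge d)].
Proof.
case: (eqVneq d a) => [->|da]; first by constructor 1.
case: (eqVneq d (edge a)) => [->|de]; first by constructor 2.
by constructor 3; apply: i_edge.
Qed.

Lemma edge_div_par d k : par L' (i d) k = par L d k.
Proof. by elim: k => //= k ->; have [-> _ _] := L'E d k. Qed.

Lemma edge_div_sg d k : sg L' (i d) k = sg L d k.
Proof. by rewrite /sg edge_div_par. Qed.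

Lemma edge_div_sgx k : sg L' x k = sg L a k.
Proof. by rewrite sg_edge edge_div_sg. Qed.

Lemma edge_div_sgy k : sg L' y k = sg L a k.
Proof. by rewrite sg_edge edge_div_sg sg_edge. Qed.

Lemma edge_div_ver d k : ver L' (i d) k = ver L d k.
Proof. by case: k => //= k; have [_ -> _] := L'E d k. Qed.

Lemma edge_div_verx k : ver L' x k = false.
Proof. by case: k => //= k; have [_ _ ->] := L'E a k. Qed.

Lemma edge_div_face_a : face (i a) = y.
Proof. by apply: (@node_inj S'); rewrite node_face node_y. Qed.

Lemma edge_div_face_y : face y = i (face a).
Proof. by apply: (@node_inj S'); rewrite node_face edge_div_edgey i_node node_face. Qed.

Lemma edge_div_face_ea : face (i (edge a)) = x.
Proof. by apply: (@node_inj S'); rewrite node_face node_x. Qed.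

Lemma edge_div_face_x : face x = i (face (edge a)).
Proof. by apply: (@node_inj S'); rewrite node_face edge_div_edgex i_node node_face edgeK. Qed.

Lemma edge_div_face d : edge (i d) = i (edge d) -> face (i d) = i (face d).
Proof. by move=> E; apply: (@node_inj S'); rewrite node_face i_node node_face. Qed.

Lemma edge_div_face_restrict (V : Type) (f : dart S' -> V) :
  (forall z, f (face z) = f z) -> forall d, f (i (face d)) = f (i d).
Proof.
move=> ff d; case: (edge_div_cases d) => [->|->|/edge_div_face<-] //.
- by rewrite -edge_div_face_y ff -edge_div_face_a ff.
- by rewrite -edge_div_face_x ff -edge_div_face_ea ff.
Qed.

Lemma edge_div_same_vertex d e : same_vertex d e -> same_vertex (i d) (i e).
Proof.
move: e; apply: (orbit_ind (f := node)) => [|e _ de _]; first exact: connect0.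
by rewrite -i_node same_vertex_node.
Qed.

Lemma edge_div_same_vertex_im d z : same_vertex (i d) z -> exists2 e, z = i e & same_vertex d e.
Proof.
move: z; apply: (orbit_ind (f := node)) => [|z _ [e -> de] _].
  by exists d => //; apply: connect0.
by exists (node e); rewrite ?i_node // same_vertex_node.
Qed.

Lemma edge_div_same_vertex_x z : same_vertex x z -> z = x \/ z = y.
Proof.
move: z; apply: (orbit_ind (f := node)) => [|z _ [->|->] _]; first by left.
  by right.
by left.
Qed.

Lemma edge_div_extend (V : Type) (f : dart S -> V) : (forall d, f (face d) = f d) ->
  exists f', [/\ forall z, f' (face z) = f' z, forall d, f' (i d) = f d,
                 f' x = f (edge a) & f' y = f a].
Proof.
move=> ff; have [f' [f'i f'P]] := extend_along f (fun z => if z == x then f (edge a) else f a) i_inj.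
have f'x : f' x = f (edge a) by rewrite f'P ?eqxx // i_codom !inE eqxx.
have f'y : f' y = f a.
  rewrite f'P; last by rewrite i_codom !inE eqxx orbT.
  rewrite (inj_eq (inv_inj (@edgeK S'))) (inj_eq i_inj).
  by rewrite (negPf (edge_neq a)).
exists f'; split=> // z; case: (edge_divP z) => [->|->|[d ->]].
- by rewrite edge_div_face_x f'i ff.
- by rewrite edge_div_face_y f'i ff.
case: (edge_div_cases d) => [->|->|/edge_div_face->]; last by rewrite !f'i ff.
  by rewrite edge_div_face_a f'y f'i.
by rewrite edge_div_face_ea f'x f'i.
Qed.

Lemma edge_div_restrict b : admits_class L' b -> admits_class L b.
Proof.
case=> xi [t [s [X [K [[xif xiE] tL [Xf XE] noy]]]]]; have [T1 T2 T3] := tL.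
have ss k := sg_sqr L a k.
have tx k : t x k = - (sg L a k * t (i a) k) by rewrite T1 edge_div_sg.
have ty k : t y k = - (sg L a k * t (i (edge a)) k) by rewrite T1 edge_div_sg sg_edge.
(* No vertical arc lies over the new vertex, so the holonomy around it is trivial; this forces the
   two halves of the divided edge to carry the same transition. *)
have tea k : t (i (edge a)) k = - (sg L a k * t (i a) k).
  have [u uE] := T3 x k (negbT (edge_div_verx k)).
  have ux := uE x (connect0 _ _); rewrite /step node_x edge_div_sgy in ux.
  have uy := uE y; rewrite /step node_y edge_div_sgx -node_x same_vertex_node node_x in uy.
  have {}uy := uy (connect0 _ _).
  rewrite -tx; move: uy; rewrite ux ty mulrDr mulrN !mulrA ss !mul1r; lra.
have ext (f : dart S' -> rat) : (forall z, f (face z) = f z) -> f x = f (i (edge a)) /\ f y = f (i a).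
  by move=> ff; rewrite -edge_div_face_ea -edge_div_face_a !ff.
exists (fun d => xi (i d)), (fun d k => t (i d) k), s, (fun d => X (i d)), K; split.
- split=> [d|d k Kk]; first exact: edge_div_face_restrict.
  rewrite -edge_div_par -(xiE _ _ Kk); case: (edge_div_cases d) => [->|->|->] //.
    by rewrite -[LHS]xif edge_div_face_ea.
  by rewrite edgeK -[LHS]xif edge_div_face_a.
- split=> [d k|d k|d k].
  + rewrite -edge_div_sg; case: (edge_div_cases d) => [->|->|<-]; last exact: T1.
      by rewrite tea edge_div_sg.
    by rewrite edgeK tea edge_div_sg sg_edge mulrN mulrA ss mul1r opprK.
  + by have [<- _ _] := L'E d k; apply: T2.
  rewrite -edge_div_ver => /T3[u uE]; exists (fun e => u (i e)) => e de.
  by rewrite /step -i_node uE ?edge_div_same_vertex // i_node edge_div_sg.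
- split=> [d|d k Kk]; first exact: edge_div_face_restrict.
  rewrite XE //; congr (_ - _); have [Xx Xy] := ext X Xf.
  by case: (edge_div_cases d) => [->|->|->]; rewrite ?edgeK.
move=> hb v [vf vE]; have [v' [v'f v'i v'x v'y]] := edge_div_extend vf.
apply: (noy hb v'); split=> // z k; case: (edge_divP z) => [->|->|[d ->]].
- by rewrite edge_div_edgex edge_div_sgx v'x v'i tx -tea -vE edgeK sg_edge.
- by rewrite edge_div_edgey edge_div_sgy v'y v'i ty tea mulrN mulrA ss mul1r opprK -vE.
rewrite edge_div_sg v'i -vE; congr (_ - _ * _).
case: (edge_div_cases d) => [->|->|->]; last exact: v'i.
  by rewrite -v'x.
by rewrite edgeK -v'y.
Qed.

Lemma edge_div_lift b : admits_class L b -> admits_class L' b.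
Proof.
case=> xi [t [s [X [K [[xif xiE] tL [Xf XE] noy]]]]]; have [T1 T2 T3] := tL.
have ss k := sg_sqr L a k.
have [xi' [xi'f xi'i xi'x xi'y]] := edge_div_extend xif.
have [X' [X'f X'i X'x X'y]] := edge_div_extend Xf.
have xy : (y == x) = false.
  by rewrite (inj_eq (inv_inj (@edgeK S'))) (inj_eq i_inj) (negPf (edge_neq a)).
have [t' [t'i t'P]] := extend_along t (fun z => if z == x then t (edge a) else t a) i_inj.
have t'x : t' x = t (edge a) by rewrite t'P ?eqxx // i_codom !inE eqxx.
have t'y : t' y = t a by rewrite t'P ?xy // i_codom !inE eqxx orbT.
exists xi', t', s, X', K; split.
- split=> // z k Kk; case: (edge_divP z) => [->|->|[d ->]].
  + rewrite edge_div_edgex xi'i xi'x par_edge edge_div_par -par_edge -(xiE _ _ Kk).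
    by rewrite edgeK.
  + by rewrite edge_div_edgey xi'i xi'y !par_edge edge_div_par par_edge -(xiE _ _ Kk).
  rewrite xi'i edge_div_par -(xiE _ _ Kk); case: (edge_div_cases d) => [->|->|->]; last exact: xi'i.
    by rewrite -xi'x.
  by rewrite edgeK -xi'y.
- split=> [z k|z k|z k].
  + case: (edge_divP z) => [->|->|[d ->]].
    * by rewrite edge_div_edgex t'i t'x edge_div_sgx T1 mulrN mulrA ss mul1r opprK.
    * by rewrite edge_div_edgey t'i t'y edge_div_sgy T1.
    rewrite t'i edge_div_sg; case: (edge_div_cases d) => [->|->|->]; last by rewrite t'i T1.
      by rewrite -/x t'x T1.
    by rewrite -/y t'y T1 sg_edge mulrN mulrA ss mul1r opprK.
  + case: (edge_divP z) => [->|->|[d ->]].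
    * by rewrite t'x hor_edge; have [-> _ _] := L'E a k; rewrite -hor_edge; apply: T2.
    * by rewrite t'y hor_edge; have [-> _ _] := L'E (edge a) k; rewrite hor_edge; apply: T2.
    by have [-> _ _] := L'E d k; rewrite t'i; apply: T2.
  have hx : exists u, forall w, same_vertex x w -> step L' t' k u w.
    exists (fun w => if w == x then 0 else t a k) => w /edge_div_same_vertex_x[]->.
      by rewrite /step node_x xy eqxx t'y mulr0 add0r.
    by rewrite /step node_y xy eqxx t'x edge_div_sgx T1 subrr.
  case: (edge_divP z) => [->|->|[d ->]] nv.
  + exact: hx.
  + have [u uE] := hx; exists u => w yw; apply: uE; apply: same_vertex_trans yw.
    by rewrite -node_x same_vertex_node; apply: connect0.
  rewrite edge_div_ver in nv; have [u uE] := T3 d k nv.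
  have [u' [u'i _]] := extend_along u (fun=> 0) i_inj.
  exists u' => w /edge_div_same_vertex_im[e -> de].
  by rewrite /step i_node !u'i edge_div_sg t'i uE.
- split=> // z k Kk; case: (edge_divP z) => [->|->|[d ->]].
  + by rewrite edge_div_edgex xi'x X'x X'i t'x XE // edgeK.
  + by rewrite edge_div_edgey xi'y X'y X'i t'y XE.
  rewrite xi'i X'i !t'i XE //; congr (_ - _); case: (edge_div_cases d) => [->|->|->]; last by rewrite X'i.
    by rewrite -X'x.
  by rewrite edgeK -X'y.
move=> hb v [vf vE]; apply: (noy hb (fun d => v (i d))); split=> [|d k].
  exact: edge_div_face_restrict.
rewrite -t'i -vE edge_div_sg; congr (_ - _ * _).
case: (edge_div_cases d) => [->|->|->] //.
  by rewrite -/x -edge_div_face_ea vf.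
by rewrite edgeK -/y -edge_div_face_a vf.
Qed.

End EdgeDivision.

Lemma edge_division_class (S S' : surface) (L : link S) (L' : link S') b :
  edge_division L L' -> admits_class L b <-> admits_class L' b.
Proof.
case=> i [a [[i_inj i_codom] i_edge i_node [node_x node_y] L'E]].
split; first exact: (edge_div_lift i_inj i_codom i_edge i_node node_x node_y L'E).
exact: (edge_div_restrict i_inj i_codom i_edge i_node node_x node_y L'E).
Qed.

Lemma isotopic_class (S S' : surface) (L : link S) (L' : link S') b :
  isotopic L L' -> admits_class L b <-> admits_class L' b.
Proof.
elim=> {S S' L L'}.
- by [].
- by move=> S L L'; apply: push_class.
- by move=> S S' L L'; apply: face_division_class.
- by move=> S S' L L'; apply: edge_division_class.
- by move=> S S' L L' _ ->.
by move=> S S' S'' L L' L'' _ -> _ ->.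
Qed.

(** * The Gordon-Litherland form *)

Lemma ex_least_nat (P : nat -> Prop) : (exists n, P n) ->
  exists n, P n /\ forall m, P m -> (n <= m)%N.
Proof.
case=> n; elim/ltn_ind: n => n IHn Pn.
have [[m [lt_mn Pm]]|none] := classic (exists m, (m < n)%N /\ P m); first exact: IHn Pm.
exists n; split=> // m Pm; rewrite leqNgt; apply/negP => lt_mn.
by apply: none; exists m.
Qed.

(** Induction on the functionals: to a basis for the kernel of [phi j] in [A] add an element on
    which [phi j] takes its least positive value, if there is one; division with remainder shows
    that this value generates the image. The lemma replaces freeness of H_1 as an abstract group. *)
Lemma subgroup_basis (V : zmodType) (I : eqType) (phi : I -> {additive V -> int})
    (s : seq I) (A : V -> Prop) :
    A 0 -> (forall u v, A u -> A v -> A (u - v)) ->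
  exists n (z : 'I_n -> V),
  [/\ forall i, A (z i),
      forall w, A w -> exists a : 'I_n -> int,
        all (fun j => phi j (w - \sum_i z i *~ a i) == 0) s &
      forall a : 'I_n -> int, all (fun j => phi j (\sum_i z i *~ a i) == 0) s ->
        forall i, a i = 0].
Proof.
elim: s A => [|j s IHs] A A0 AB.
  exists 0%N, (fun=> 0); split=> // [w _|a _ []//].
  by exists (fun=> 0).
have AN u : A u -> A (- u) by move=> Au; rewrite -sub0r; apply: AB.
have AD u v : A u -> A v -> A (u + v).
  by move=> Au Av; rewrite -[v]opprK; apply: AB => //; apply: AN.
have AMn u n : A u -> A (u *+ n).
  by move=> Au; elim: n => [|n IHn]; rewrite ?mulr0n // mulrS; apply: AD.
have AMz u (n : int) : A u -> A (u *~ n).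
  move=> Au; case: n => n; first by rewrite -pmulrn; apply: AMn.
  by rewrite NegzE -nmulrn; apply/AN/AMn.
have [n [z [Az zE zI]]] := IHs (fun v => A v /\ phi j v = 0) (conj A0 (raddf0 _))
  (fun u v Au Av => conj (AB u v Au.1 Av.1) (etrans (raddfB (phi j) u v)
    (etrans (congr2 (fun a b => a - b) Au.2 Av.2) (subrr 0)))).
have phi_sum (a : 'I_n -> int) : phi j (\sum_i z i *~ a i) = 0.
  by rewrite raddf_sum big1 // => i _; rewrite raddfMz (Az i).2 mul0rz.
have [[w [Aw nw]]|all0] := classic (exists w, A w /\ phi j w <> 0); last first.
  exists n, z; split=> [i|w Aw|a /= /andP[_ /zI]//]; first by case: (Az i).
  have w0 : phi j w = 0 by apply: NNPP => nw; apply: all0; exists w.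
  have [a aE] := zE w (conj Aw w0); exists a => /=.
  by rewrite raddfB phi_sum w0 subr0 eqxx.
have /ex_least_nat[m [[m_gt0 [w0 [Aw0 w0E]]] m_min]] :
    exists m, (0 < m)%N /\ exists w, A w /\ phi j w = m%:Z.
  exists `|phi j w|%N; split; first by rewrite absz_gt0; apply/eqP.
  have [le0|lt0] := lerP 0 (phi j w); first by exists w; rewrite gez0_abs.
  by exists (- w); split; [exact: AN | rewrite raddfN ltz0_abs].
exists n.+1, (fun i => oapp z w0 (unlift ord0 i)).
have sumE (a : 'I_n.+1 -> int) : \sum_i oapp z w0 (unlift ord0 i) *~ a i =
    w0 *~ a ord0 + \sum_i z i *~ a (lift ord0 i).
  rewrite big_ord_recl unlift_none /=; congr (_ + _).
  by apply: eq_bigr => i _; rewrite liftK.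
split=> [i|v Av|a].
- by case: (unlift ord0 i) => //= k; case: (Az k).
- pose c := (phi j v %/ m%:Z)%Z.
  have Av' : A (v - w0 *~ c) by apply: AB => //; apply: AMz.
  have v'E : phi j (v - w0 *~ c) = (phi j v %% m%:Z)%Z.
    by rewrite raddfB raddfMz w0E /modz mulrzz mulrC.
  have v'0 : phi j (v - w0 *~ c) = 0.
    apply/eqP; rewrite v'E; apply/negPn/negP => nz.
    have ge0 : 0 <= (phi j v %% m%:Z)%Z by rewrite modz_ge0 // eqz_nat -lt0n.
    have := m_min `|(phi j v %% m%:Z)%Z|%N; rewrite absz_gt0 nz.
    have ex : exists w, A w /\ phi j w = `|(phi j v %% m%:Z)%Z|%N.
      by exists (v - w0 *~ c); rewrite gez0_abs.
    move=> /(_ (conj isT ex)) le_m.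
    have := ltz_pmod (phi j v) (d := m%:Z); rewrite ltz_nat m_gt0 => /(_ isT).
    by rewrite -(gez0_abs ge0) ltz_nat ltnNge le_m.
  have [a aE] := zE _ (conj Av' v'0).
  exists (fun i => oapp a c (unlift ord0 i)).
  rewrite sumE unlift_none /= opprD addrA.
  rewrite (eq_bigr (fun i => z i *~ a i)) => [|i _]; last by rewrite liftK.
  by rewrite aE andbT raddfB phi_sum v'0 subr0.
rewrite sumE /= => /andP[/eqP]; rewrite raddfD phi_sum addr0 raddfMz w0E => a0 rest.
have {}a0 : a ord0 = 0.
  by move/eqP: a0; rewrite mulrzz mulf_eq0 eqz_nat -leqn0 leqNgt m_gt0 /= => /eqP.
rewrite a0 mulr0z in rest; rewrite add0r in rest.
move=> i; case: (unliftP ord0 i) => [k ->|-> //].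
exact: (zI (fun k => a (lift ord0 k)) rest).
Qed.

Section Homology.
Variables (S : surface) (L : link S) (xi : dart S -> bool).
Implicit Types (d e : dart S) (z a b w : fchain S).

Lemma fchain1B z w d : (z - w).1 d = z.1 d - w.1 d.
Proof. by rewrite !ffunE. Qed.

Lemma fchain2B z w d : (z - w).2 d = z.2 d - w.2 d.
Proof. by rewrite !ffunE. Qed.

Definition additive_of (phi : fchain S -> int)
    (phiB : forall u v, phi (u - v) = phi u - phi v) : {additive fchain S -> int} :=
  HB.pack phi (GRing.isZmodMorphism.Build _ _ phi phiB).

Lemma is_cycle0 : is_cycle L xi 0.
Proof.
split=> [|d]; first by split=> [d|d _ _|d _|d _]; rewrite !ffunE ?oppr0.
by rewrite big1 // => e _; rewrite !ffunE addr0.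
Qed.

Lemma is_cycleB u v : is_cycle L xi u -> is_cycle L xi v -> is_cycle L xi (u - v).
Proof.
move=> [[u1 u2 u3 u4] u5] [[v1 v2 v3 v4] v5]; split=> [|d].
  split=> [d|d xd xe|d ud|d ud]; rewrite ?fchain1B ?fchain2B.
  - by rewrite u1 v1 opprB opprK addrC.
  - by rewrite u2 // v2 // subrr.
  - by rewrite u3 // v3 // subrr.
  by rewrite u4 // v4 // opprB opprK addrC.
rewrite (eq_bigr (fun e => (u.1 e + u.2 e) - (v.1 e + v.2 e))) => [|e _].
  by rewrite sumrB u5 v5 subrr.
by rewrite fchain1B fchain2B; ring.
Qed.

(* A 2-chain supported on the black faces is determined by its boundary as soon as there is
   a white face, and depends linearly on it: integrate along a path to that face. *)
Lemma primitive_functional d0 : ~~ xi d0 -> forall d,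
  exists l : {additive fchain S -> int}, forall z (x : dart S -> int),
    (forall d, x (face d) = x d) -> (forall d, ~~ xi d -> x d = 0) ->
    (forall d, z.1 d = x d - x (edge d)) -> x d = l z.
Proof.
move=> nd0; have shift d e (sgn : int) : (exists l : {additive fchain S -> int}, forall z x,
      (forall d, x (face d) = x d) -> (forall d, ~~ xi d -> x d = 0) ->
      (forall d, z.1 d = x d - x (edge d)) -> x d = l z) ->
    (forall z (x : dart S -> int), (forall d, x (face d) = x d) -> (forall d, ~~ xi d -> x d = 0) ->
      (forall d, z.1 d = x d - x (edge d)) -> x e = x d + sgn * z.1 e) ->
    exists l : {additive fchain S -> int}, forall z x,
      (forall d, x (face d) = x d) -> (forall d, ~~ xi d -> x d = 0) ->
      (forall d, z.1 d = x d - x (edge d)) -> x e = l z.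
  case=> l lE eE.
  have lB u v : (fun z => l z + sgn * z.1 e) (u - v) =
      (fun z => l z + sgn * z.1 e) u - (fun z => l z + sgn * z.1 e) v.
    by rewrite /= raddfB fchain1B; ring.
  exists (additive_of lB) => z x xf xw zE /=.
  by rewrite (eE z x) // (lE z x).
apply: (surface_ind (d := d0)) => [|d Pd|d Pd].
- have lB (u v : fchain S) : (fun=> 0 : int) (u - v) = (fun=> 0 : int) u - (fun=> 0 : int) v.
    by rewrite subrr.
  by exists (additive_of lB) => z x _ xw _ /=; apply: xw.
- apply: (shift d (node d) 1 Pd) => z x xf _ zE.
  by rewrite zE -[x (edge _)]xf face_edge_node mul1r; ring.
by apply: (shift d (edge d) 1 Pd) => z x _ _ zE; rewrite zE edgeK; ring.
Qed.

(** Boundaries are the common kernel of finitely many functionals: the core coefficients vanish, and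
    the only candidate for a primitive, given by [primitive_functional], has the right boundary, is
    constant on faces and is zero on white ones. *)
Lemma homology_basis_exists d0 : ~~ xi d0 -> exists n (z : 'I_n -> fchain S),
  homology_basis L xi z.
Proof.
move=> nd0; have [l lE] := fin_all_exists (primitive_functional nd0).
have B1 d u v : (fun z : fchain S => z.2 d) (u - v) = u.2 d - v.2 d by rewrite fchain2B.
have B2 d u v : (fun z : fchain S => z.1 d - (l d z - l (edge d) z)) (u - v) =
    (u.1 d - (l d u - l (edge d) u)) - (v.1 d - (l d v - l (edge d) v)).
  by rewrite /= fchain1B (raddfB (l d)) (raddfB (l (edge d))); ring.
have B3 d u v : (fun z : fchain S => l (face d) z - l d z) (u - v) =
    (l (face d) u - l d u) - (l (face d) v - l d v).
  by rewrite /= (raddfB (l d)) (raddfB (l (face d))); ring.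
have B4 d u v : (fun z : fchain S => if xi d then 0 else l d z) (u - v) =
    (if xi d then 0 else l d u) - (if xi d then 0 else l d v).
  by case: (xi d); rewrite ?subrr ?raddfB.
pose phi (j : dart S * 'I_4) := nth (additive_of (B1 j.1))
  [:: additive_of (B1 j.1); additive_of (B2 j.1); additive_of (B3 j.1); additive_of (B4 j.1)] j.2.
have phiP z : all (fun j => phi j z == 0) (enum {: dart S * 'I_4}) <-> is_boundary xi z.
  split=> [/allP all0|[x [xf xw z1 z2]]].
    have phi0 d k : phi (d, k) z = 0 by apply/eqP/all0; rewrite mem_enum.
    exists (fun d => l d z); split=> [d|d xd|d|d].
    - by have := phi0 d (@Ordinal 4 2 isT); rewrite /phi /= => /eqP; rewrite subr_eq0 => /eqP.
    - by have := phi0 d (@Ordinal 4 3 isT); rewrite /phi /= (negPf xd).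
    - by have := phi0 d (@Ordinal 4 1 isT); rewrite /phi /= => /eqP; rewrite subr_eq0 => /eqP.
    by have := phi0 d (@Ordinal 4 0 isT).
  have xl d : l d z = x d by rewrite -(lE d z x).
  apply/allP => -[d k] _; rewrite /phi; case: k => [[|[|[|[|k]]]]] //= _.
  - by rewrite z2.
  - by rewrite !xl z1 subrr.
  - by rewrite !xl xf subrr.
  by rewrite xl; case: ifP => // /negbT/xw->.
have [n [z [zc zE zI]]] := subgroup_basis phi (enum {: dart S * 'I_4}) is_cycle0 is_cycleB.
exists n, z; split=> // [w /zE[a aE]|a /phiP aB]; last exact: zI.
by exists a; apply/phiP.
Qed.

Definition gl_sum a b : int :=
  \sum_d \sum_(e | same_vertex d e)
    Num.sg ((rank (e, false))%:Z - (rank (d, true))%:Z) * turn xi a d * b.1 e.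

Lemma intersection_proj (a : chain S) b : intersection a (proj b) =
  (\sum_(p : germ S) \sum_(e | same_vertex p.1 e)
     Num.sg ((rank (e, false))%:Z - (rank p)%:Z) * a p * b.1 e)%:~R / 2%:R.
Proof.
rewrite /intersection; congr (_%:~R / _); apply: eq_bigr => p _.
rewrite big_mkcond (eq_bigr (fun q : germ S => (fun e c => if same_vertex p.1 e then
  Num.sg ((rank (e, c))%:Z - (rank p)%:Z) * a p * proj b (e, c) else 0) q.1 q.2)); last by case.
rewrite -(pair_bigA _ (fun e c => if same_vertex p.1 e then
  Num.sg ((rank (e, c))%:Z - (rank p)%:Z) * a p * proj b (e, c) else 0)) /=.
rewrite [RHS]big_mkcond; apply: eq_bigr => e _; rewrite big_bool /= /proj /=.
by case: ifP; rewrite ?mulr0 ?add0r ?addr0.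
Qed.

(** Of the two push-offs only the sheet at level 2 passes over [F] at level 1. Its horizontal part
    is [proj a] and contributes exactly the intersection number that is subtracted; the turns in the
    white corners remain. *)
Lemma gordon_litherlandE a b : gordon_litherland xi a b = (gl_sum a b)%:~R / 2%:R.
Proof.
rewrite /gordon_litherland /lk.
have i0 (c : chain S) : intersection c (fun=> 0) = 0.
  rewrite /intersection big1 ?mul0r // => p _; rewrite big1 // => q _.
  by rewrite mulr0.
have inner (k : 'I_3) (c : chain S) : \sum_(l < 3 | (l < k)%N) intersection c (on_surface b l) =
    if (1 < k)%N then intersection c (proj b) else 0.
  rewrite big_mkcond !big_ord_recl big_ord0 /on_surface /= !i0 !addr0.
  by rewrite !if_same add0r addr0.
rewrite (eq_bigr _ (fun k _ => inner k _)) !big_ord_recl big_ord0 /= addr0 !add0r.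
rewrite !intersection_proj -mulrBl -intrB; congr (_%:~R / _).
rewrite -sumrB /gl_sum.
rewrite (eq_bigr (fun p : germ S => (fun d c => if c then \sum_(e | same_vertex d e)
    Num.sg ((rank (e, false))%:Z - (rank (d, true))%:Z) * turn xi a d * b.1 e else 0) p.1 p.2)).
  rewrite -(pair_bigA _ (fun d (c : bool) => if c then \sum_(e | same_vertex d e)
    Num.sg ((rank (e, false))%:Z - (rank (d, true))%:Z) * turn xi a d * b.1 e else 0)) /=.
  by apply: eq_bigr => d _; rewrite big_bool /= addr0.
case=> d [] _ /=; rewrite -sumrB; last by rewrite big1 // => e _; rewrite subrr.
by apply: eq_bigr => e _; rewrite /proj /= /transfer /= mulr0 mul0r subr0.
Qed.

Lemma gl_sumBl b u v : gl_sum (u - v) b = gl_sum u b - gl_sum v b.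
Proof.
rewrite /gl_sum -sumrB; apply: eq_bigr => d _; rewrite -sumrB; apply: eq_bigr => e _.
by rewrite /turn; case: (xi d); rewrite ?fchain2B; ring.
Qed.

Lemma gl_sum_boundary z b : is_boundary xi z -> gl_sum z b = 0.
Proof.
case=> x [_ _ _ z2]; rewrite /gl_sum big1 // => d _; rewrite big1 // => e _.
by rewrite /turn !z2; case: (xi d); rewrite ?addr0 mulr0 mul0r.
Qed.

(** The coordinates of [w] in a homology basis form a row that the matrix kills, since boundaries
    pair to zero; the row is nonzero because [w] does not bound. *)
Lemma determinant0 d0 w : ~~ xi d0 -> is_cycle L xi w -> ~ is_boundary xi w ->
  (forall b, is_cycle L xi b -> gl_sum w b = 0) -> determinant_is L xi 0.
Proof.
move=> nd0 wc wB wG; have [n [z [zc zE zI]]] := homology_basis_exists nd0.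
exists n, z; split=> //; apply/esym/eqP; rewrite normr_eq0.
have [a aE] := zE w wc; apply/det0P; exists (\row_i (a i)%:~R).
  apply/eqP => a0; apply: wB; have a0' i : a i = 0.
    by apply/eqP; move/rowP/(_ i): a0; rewrite !mxE => /eqP; rewrite intr_eq0.
  move: aE; rewrite /combination big1 ?subr0 // => i _.
  by rewrite a0' mulr0z.
apply/rowP => j; rewrite !mxE.
pose f := additive_of (gl_sumBl (z j)).
have /eqP : f (w - combination z a) = 0 by apply: gl_sum_boundary.
rewrite raddfB [f w](wG _ (zc j)) sub0r oppr_eq0 raddf_sum => /eqP f0.
rewrite (eq_bigr (fun i => (f (z i *~ a i))%:~R / 2%:R)) => [|i _].
  by rewrite -mulr_suml -(rmorph_sum (intmul 1)) /= f0 mul0r.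
by rewrite !mxE gordon_litherlandE raddfMz mulrzz intrM [f _]/=; ring.
Qed.

End Homology.

(** * Diagrams and black sectors *)

Lemma filter_cons_split (T : eqType) (p : pred T) (s : seq T) a l :
  filter p s = a :: l -> exists s1 s2,
    [/\ s = s1 ++ a :: s2, all (predC p) s1, p a & filter p s2 = l].
Proof.
elim: s => //= x s IHs; case: ifP => px.
  by case=> <- <-; exists [::], s.
by case/IHs=> s1 [s2 [-> ns1 pa <-]]; exists (x :: s1), s2; rewrite /= px.
Qed.

Lemma filter_nil_all (T : eqType) (p : pred T) (s : seq T) : filter p s = [::] -> all (predC p) s.
Proof.
move=> E; apply/allP => x xs /=; apply/negP => px.
by have : x \in filter p s by [rewrite mem_filter px]; rewrite E.
Qed.

Section Strands.
Variables (S : surface) (D : link S).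
Implicit Types d e : dart S.

Lemma strandP d : reflect (exists k, D (Hor d k)) (strand D d).
Proof.
apply: (iffP hasP) => [[k _ Dk]|[k Dk]]; first by exists k.
exists k => //; rewrite mem_iota /= add0n ltnS leqNgt; apply/negP => lt.
by have [/(_ lt)] := arcs_bounded D d k; rewrite Dk.
Qed.

Lemma hor_height d : strand D d -> D (Hor d (height D d)).
Proof.
move=> sd; have := nth_find 0%N sd; rewrite nth_iota ?add0n //.
by have := sd; rewrite /strand has_find size_iota.
Qed.

Hypothesis reg : diagram D.

Lemma heightP d k : D (Hor d k) = strand D d && (k == height D d).
Proof.
apply/idP/andP => [Dk|[sd /eqP->]].
  have sd : strand D d by apply/strandP; exists k.
  by split=> //; apply/eqP; have [uniq_h _] := reg; apply: (uniq_h d) => //; apply: hor_height.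
exact: hor_height.
Qed.

Lemma par_diagram d k : par D d k = strand D d && (height D d < k)%N.
Proof.
elim: k => [|k IHk] /=; first by rewrite ltn0 andbF.
rewrite IHk heightP ltnS; case: (strand D d) => //=.
by case: ltngtP.
Qed.

Lemma around_mem d e : (e \in around D d) = strand D e && same_vertex d e.
Proof. by rewrite mem_filter -fconnect_orbit. Qed.

Lemma orbit_cons d : exists s, orbit node d = d :: s.
Proof. by rewrite /orbit -orderSpred /=; eexists. Qed.

End Strands.

(** A vertical arc can be followed upwards until a horizontal arc is met, which happens below the
    height bound. *)
Lemma link_strand (S : surface) (D : link S) : exists d, strand D d.
Proof.
have [a Da] := arcs_nonempty D; case: a Da => d k; first by exists d; apply/strandP; exists k.
have [n] := ubnP (height_bound D - k); elim: n k => // n IHn k le_n Dv.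
have lt_k : (k < height_bound D)%N.
  rewrite ltnNge; apply/negP => le.
  by have [_ /(_ le)] := arcs_bounded D d k; rewrite Dv.
have [Dv'|nDv'] := boolP (D (Ver d k.+1)); first by apply: (IHn k.+1) Dv'; lia.
have := arcs_manifold D d k.+1; rewrite /degree Dv (negPf nDv') addn0 addn1.
rewrite !inE /= eqSS; set sm := (\sum_(_ | _) _)%N => /eqP sm1.
have /existsP[e /andP[_ De]] : [exists e, same_vertex d e && D (Hor e k.+1)].
  apply: contraT => /existsPn none.
  move: sm1; rewrite /sm big1 // => e de; have := none e; rewrite de /=.
  by case: (D _).
by exists e; apply/strandP; exists k.+1.
Qed.

Section Segments.
Variables (S : surface).
Implicit Types (d e a b : dart S) (s r : seq (dart S)).

Lemma segment_last a s b r : fpath node a (s ++ b :: r) -> node (last a s) = b.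
Proof. by rewrite cat_path /= => /and3P[_ /eqP]. Qed.

Lemma segment_value (V : zmodType) (u F : dart S -> V) a s r :
    fpath node a (s ++ r) ->
    (forall e, e \in a :: s -> node e \in s -> u (node e) = u e + F (node e)) ->
  u (last a s) = u a + \sum_(x <- s) F x.
Proof.
elim: s a => [|x s IHs] a /=; first by rewrite big_nil addr0.
case/andP=> /eqP ax p uF; rewrite big_cons addrA.
rewrite (IHs x) // => [|e ex es]; last by apply: uF; rewrite inE ?ex ?es orbT.
by rewrite -ax uF ?ax ?mem_head.
Qed.

Lemma orbit_path d s : orbit node d = d :: s -> fpath node d s /\ node (last d s) = d.
Proof.
have := cycle_orbit (@node_inj S) d => + E; rewrite E /= rcons_path => /andP[p /eqP].
by [].
Qed.

Lemma sum_orbit (V : zmodType) (F : dart S -> V) d :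
  \sum_(e | same_vertex d e) F e = \sum_(e <- orbit node d) F e.
Proof.
rewrite [RHS]big_uniq ?orbit_uniq //=; apply: eq_bigl => e.
by rewrite -fconnect_orbit.
Qed.

End Segments.

Section Sectors.
Variables (S : surface) (D : link S) (xi : dart S -> bool).
Hypotheses (reg : diagram D) (col : coloring D xi).
Implicit Types (a b c d e : dart S) (s r : seq (dart S)).

Let nonstrand : pred (dart S) := predC (strand D).

Lemma xi_node d : xi (node d) = xi d (+) strand D (node d).
Proof.
have [xif xie] := col; have := xie (node d).
by rewrite -[xi (edge _)]xif face_edge_node => ->; rewrite addbK.
Qed.

Lemma sector_sym : connect_sym [rel d e | (xi d && (e == node d)) || (xi e && (d == node e))].
Proof. by apply: sym_connect_sym => d e /=; rewrite orbC. Qed.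

Lemma sector_symE d e : sector xi d e = sector xi e d.
Proof. exact: sector_sym. Qed.

Lemma sector_trans : transitive (sector xi).
Proof. exact: connect_trans. Qed.

Lemma sector_eq d e : sector xi d e -> sector xi d =1 sector xi e.
Proof. exact: same_connect sector_sym d e. Qed.

Lemma sector_node d : xi d -> sector xi d (node d).
Proof. by move=> xd; apply: connect1; rewrite /= xd eqxx. Qed.

Lemma segment_traject a s b r : orbit node a = a :: s ++ b :: r ->
  a :: rcons s b = traject node a (size s).+2.
Proof.
move=> oE; have le : ((size s).+2 <= order node a)%N.
  by rewrite -size_orbit oE /= size_cat /= addnS !ltnS leq_addr.
rewrite -(take_traject node a le) -/(orbit node a) oE /= -cat_rcons.
by rewrite -(size_rcons s b) take_size_cat.
Qed.

Lemma segment_xi a s b r : orbit node a = a :: s ++ b :: r -> all nonstrand s ->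
  forall e, e \in a :: s -> xi e = xi a.
Proof.
move=> /orbit_path[p _] /allP ns e /(nthP a)[i + <-]; rewrite ltnS.
elim: i => //= i IHi lti; rewrite -(IHi (ltnW lti)).
have /(pathP a)/(_ i) := p; rewrite size_cat (leq_trans lti) ?leq_addr // => /(_ isT)/=.
have nE j : (j <= size s)%N -> nth a (a :: s ++ b :: r) j = nth a (a :: s) j.
  by move=> lej; rewrite -cat_cons nth_cat /= ltnS lej.
rewrite nE ?(ltnW lti) //; have /= -> := nE i.+1 lti => /eqP <-.
rewrite xi_node; suff -> : strand D (node (nth a (a :: s) i)) = false by rewrite addbF.
have /(pathP a)/(_ i) := p; rewrite size_cat (leq_trans lti) ?leq_addr // => /(_ isT)/=.
rewrite nE ?(ltnW lti) //; have /= -> := nE i.+1 lti => /eqP ->.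
by apply/negbTE/ns/mem_nth.
Qed.

(** The corners of the sector are those after [a] and after the darts of [s]. As a class of darts,
    [sector] also contains the closing strand [b], although the corner after [b] is white. *)
Lemma sector_sum (V : zmodType) (F : dart S -> V) a s b r :
    orbit node a = a :: s ++ b :: r -> all nonstrand s -> strand D a -> strand D b -> xi a ->
  \sum_(e | sector xi a e) F e = F a + \sum_(e <- s) F e + F b.
Proof.
move=> oE ns sa sb xa; have [p lastE] := orbit_path oE.
have un : uniq (a :: rcons s b).
  by have := orbit_uniq node a; rewrite oE -cat_rcons -cat_cons cat_uniq => /andP[].
have tE := segment_traject oE.
have xs i : (i <= size s)%N -> xi (iter i node a).
  move=> lei; rewrite (segment_xi oE ns) //.
  have : nth a (a :: rcons s b) i \in a :: s.
    rewrite -rcons_cons nth_rcons /= ltnS lei; exact: mem_nth.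
  by rewrite tE nth_traject //; apply: leq_trans lei _; rewrite leqnSn.
have bE : iter (size s).+1 node a = b.
  have := congr1 (fun q => nth a q (size s).+1) tE.
  by rewrite nth_traject //= nth_rcons ltnn eqxx.
have nxb : xi b = false.
  by rewrite -bE iterS xi_node xs // -iterS bE sb.
have segE e : sector xi a e = (e \in a :: rcons s b).
  rewrite tE; apply/idP/trajectP => [/connectP[q + ->]|[i lti ->]].
    pose Q z := exists2 i, (i < (size s).+2)%N & z = iter i node a.
    have Qa : Q a by exists 0%N.
    suff: forall z, Q z -> path [rel d e | (xi d && (e == node d)) || (xi e && (d == node e))] z q ->
      Q (last z q) by apply.
    elim: q => //= y q IHq z [i lti zE] /andP[zy qp].
    apply: IHq qp; case/orP: zy => /andP[x1 /eqP yE].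
      case: (ltngtP i (size s).+1) => [lt|gt|iE]; last 1 first.
      - by move: x1; rewrite zE iE bE nxb.
      - by exists i.+1; rewrite // yE zE.
      by move: gt; rewrite ltnNge -ltnS lti.
    case: i lti zE => [|i] lti zE; last first.
      exists i; first exact: ltnW.
      by apply: (@node_inj S); rewrite -yE zE.
    by have := xi_node y; rewrite -yE zE /= sa x1 xa.
  elim: i lti => [|i IHi] lti; first exact: connect0.
  apply: sector_trans (IHi (ltnW lti)) _; rewrite iterS; apply: sector_node.
  by apply: xs; rewrite -ltnS.
rewrite (eq_bigl _ _ segE) -big_uniq //= big_cons.
by rewrite -cats1 big_cat big_seq1 addrA.
Qed.

(* Summing by parts, since a black corner lies between two darts of the same sector. *)
Lemma sector_sum0 (V : zmodType) (g u : dart S -> V) d :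
    (forall e, same_vertex d e -> g (node e) = u (node e) - u e) ->
    (forall e, same_vertex d e -> ~~ xi e -> u e = 0) ->
  \sum_(e | sector xi d e) g e = 0.
Proof.
move=> gE u0; have sv e : sector xi d e -> same_vertex d e.
  case/connectP => q + ->; have dd : same_vertex d d by apply: connect0.
  suff: forall z, same_vertex d z -> path [rel d e | (xi d && (e == node d)) || (xi e && (d == node e))] z q ->
      same_vertex d (last z q) by apply.
  elim: q => //= y q IHq z dz /andP[zy qp].
  apply: IHq qp; case/orP: zy => /andP[_ /eqP]; first by move->; rewrite same_vertex_node.
  by move=> zE; move: dz; rewrite zE same_vertex_node.
rewrite (reindex_inj (@node_inj S)) /=.
rewrite (eq_bigr (fun e => u (node e) - u e)) => [|e /sv]; last first.
  by rewrite same_vertex_node; apply: gE.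
rewrite sumrB -(reindex_inj (@node_inj S) (P := sector xi d) (F := u)) /=.
rewrite big_mkcond [X in _ - X]big_mkcond -sumrB big1 // => e _.
have [xe|nxe] := boolP (xi e).
  by rewrite !(sector_symE d) -(sector_eq (sector_node xe)) subrr.
have u0e : same_vertex d e -> u e = 0 by move=> de; apply: u0.
case: ifP => [/sv/u0e->|_]; case: ifP => [/sv|_]; rewrite ?subrr // same_vertex_node => /u0e->;
  by rewrite subrr.
Qed.

(** Turning clockwise from [d], either a strand is met, which is the first dart of the sector, or
    the whole vertex is interior to a black region. *)
Lemma black_sector_base d : xi d ->
  (exists a, [/\ strand D a, xi a & sector xi d a]) \/
  (forall e, same_vertex d e -> xi e /\ ~~ strand D e).
Proof.
move=> xd; have [ex|none] := classic (exists a, [/\ strand D a, xi a & sector xi d a]).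
  by left.
right; suff H e : same_vertex d e -> xi e /\ sector xi d e.
  move=> e /H[xe de]; split=> //; apply/negP => se.
  by apply: none; exists e.
rewrite /same_vertex -(same_fconnect_finv (@node_inj S)).
move: e; apply: (orbit_ind (f := finv node)); first by split; [|exact: connect0].
move=> e _ [xe de] _; pose e' := finv node e.
have eE : node e' = e by rewrite /e' f_finv //; apply: node_inj.
have nse : strand D e = false by apply/negP => se; apply: none; exists e.
have xe' : xi e' by have := xi_node e'; rewrite eE xe nse addbF => <-.
split=> //; apply: sector_trans de _; rewrite sector_symE -{2}eE; exact: sector_node.
Qed.

(* The darts at a crossing in counterclockwise order, cut into the four strands and the four
   sectors. *)
Definition crossing_at a b c d s1 s2 s3 s4 : Prop :=
  [/\ orbit node a = a :: s1 ++ b :: s2 ++ c :: s3 ++ d :: s4,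
      all nonstrand (s1 ++ s2 ++ s3 ++ s4) & all (strand D) [:: a; b; c; d]].

Lemma orbit_rot_at a s b r : orbit node a = (a :: s) ++ b :: r -> orbit node b = (b :: r) ++ a :: s.
Proof.
move=> oE; have un := orbit_uniq node a; rewrite oE in un.
have cyc := cycle_orbit (@node_inj S) a; rewrite oE in cyc.
rewrite (orbitE cyc un); last by rewrite mem_cat mem_head orbT.
rewrite index_cat ifN; last first.
  by move: un; rewrite cat_uniq => /and3P[_ /hasPn/(_ b (mem_head _ _))].
by rewrite /= eqxx addn0 -[(size s).+1]/(size (a :: s)) rot_size_cat.
Qed.

Lemma crossing_at_rot a b c d s1 s2 s3 s4 :
  crossing_at a b c d s1 s2 s3 s4 -> crossing_at b c d a s2 s3 s4 s1.
Proof.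
case=> oE ns sd; have [sa sb sc sd'] : [/\ strand D a, strand D b, strand D c & strand D d].
  by move: sd => /= /and5P[].
split; first by rewrite (orbit_rot_at oE) /= -!catA /= -!catA.
  by move: ns; rewrite !all_cat => /and4P[-> -> -> ->].
by rewrite /= sa sb sc sd'.
Qed.

Lemma crossing_at_around a b c d s1 s2 s3 s4 :
  crossing_at a b c d s1 s2 s3 s4 -> around D a = [:: a; b; c; d].
Proof.
case=> oE ns sd; rewrite /around oE.
have nsE s : all nonstrand s -> [seq e <- s | strand D e] = [::].
  by move=> nss; apply/eqP; rewrite -size_eq0 size_filter -leqn0 leqNgt -has_count -all_predC.
move: ns sd; rewrite !all_cat => /and4P[n1 n2 n3 n4] /and5P[sa sb sc sd _].
rewrite /= sa filter_cat nsE //= sb filter_cat nsE //= sc filter_cat nsE //= sd.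
by rewrite nsE.
Qed.

Lemma crossing_exists a : strand D a -> size (around D a) = 4 ->
  exists b c d s1 s2 s3 s4, crossing_at a b c d s1 s2 s3 s4.
Proof.
move=> sa; have [s sE] := orbit_cons a; rewrite /around sE /= sa /=.
case E: [seq _ <- s | _] => [|b [|c [|d [|]]]] // _.
have [s1 [r1 [sE1 n1 sb E1]]] := filter_cons_split E.
have [s2 [r2 [sE2 n2 sc E2]]] := filter_cons_split E1.
have [s3 [s4 [sE3 n3 sd E3]]] := filter_cons_split E2.
exists b, c, d, s1, s2, s3, s4; split; last by rewrite /= sa sb sc sd.
  by rewrite sE sE1 sE2 sE3.
by rewrite !all_cat n1 n2 n3 (filter_nil_all E3).
Qed.

Lemma crossing_at_strands a b c d s1 s2 s3 s4 : crossing_at a b c d s1 s2 s3 s4 ->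
  [/\ strand D a, strand D b, strand D c & strand D d].
Proof. by case=> _ _ /= /and5P[]. Qed.

Lemma crossing_at_across a b c d s1 s2 s3 s4 :
  crossing_at a b c d s1 s2 s3 s4 -> across D a = c.
Proof. by move=> /crossing_at_around; rewrite /across => ->. Qed.

Lemma crossing_at_under a b c d s1 s2 s3 s4 : crossing_at a b c d s1 s2 s3 s4 ->
  under D a = (height D a < height D b)%N.
Proof.
move=> H; have [sa _ _ _] := crossing_at_strands H.
by rewrite /under /crossing (crossing_at_around H) sa.
Qed.

Lemma crossing_at_heights a b c d s1 s2 s3 s4 : crossing_at a b c d s1 s2 s3 s4 ->
  height D a != height D b /\
  (height D a < height D b)%N = (height D c < height D b)%N.
Proof.
move=> H; have [sa _ _ _] := crossing_at_strands H.
have [_ /(_ a sa)] := reg; rewrite (crossing_at_around H) (crossing_at_across H) /=.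
by case=> // -[].
Qed.

Lemma crossing_at_levels a b c d s1 s2 s3 s4 : crossing_at a b c d s1 s2 s3 s4 ->
  (maxn (height D a) (height D c) < minn (height D b) (height D d))%N \/
  (maxn (height D b) (height D d) < minn (height D a) (height D c))%N.
Proof.
move=> H; have H2 := crossing_at_rot H; have H3 := crossing_at_rot H2; have H4 := crossing_at_rot H3.
move: (crossing_at_heights H) (crossing_at_heights H2) (crossing_at_heights H3) (crossing_at_heights H4).
lia.
Qed.

Lemma crossing_at_sum (V : zmodType) (F : dart S -> V) a b c d s1 s2 s3 s4 :
    crossing_at a b c d s1 s2 s3 s4 ->
  \sum_(e | same_vertex a e) F e =
    F a + \sum_(e <- s1) F e + (F b + \sum_(e <- s2) F e) +
    (F c + \sum_(e <- s3) F e) + (F d + \sum_(e <- s4) F e).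
Proof.
case=> oE _ _; rewrite sum_orbit oE.
by rewrite big_cons big_cat big_cons big_cat big_cons big_cat big_cons /= !addrA.
Qed.

Lemma crossing_at_segment a b c d s1 s2 s3 s4 : crossing_at a b c d s1 s2 s3 s4 ->
  [/\ same_vertex a b, same_vertex a (last a s1),
      node (last a s1) = b /\ xi b = ~~ xi a,
      forall e, e \in a :: s1 -> xi e = xi a &
      forall (V : zmodType) (u F : dart S -> V),
        (forall e, same_vertex a e -> ~~ strand D (node e) -> u (node e) = u e + F (node e)) ->
        u (last a s1) = u a + \sum_(e <- s1) F e].
Proof.
move=> H; have [oE ns _] := H; have [sa sb _ _] := crossing_at_strands H.
have [p _] := orbit_path oE; have nl := segment_last p.
have ns1 : all nonstrand s1 by move: ns; rewrite !all_cat => /and4P[].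
have av e : e \in a :: s1 -> same_vertex a e.
  by move=> es; rewrite /same_vertex fconnect_orbit oE -cat_cons mem_cat es.
have al := av _ (mem_last a s1); have xs := segment_xi oE ns1.
split=> //; first by rewrite -nl same_vertex_node.
  by split=> //; rewrite -nl xi_node nl sb (xs _ (mem_last _ _)) addbT.
move=> V u F uF; apply: segment_value p _ => e /av es en; apply: uF => //.
by apply: (allP ns1).
Qed.

Lemma crossing_at_sector (V : zmodType) (F : dart S -> V) a b c d s1 s2 s3 s4 :
  crossing_at a b c d s1 s2 s3 s4 -> xi a ->
  \sum_(e | sector xi a e) F e = F a + \sum_(e <- s1) F e + F b.
Proof.
move=> H xa; have [oE ns _] := H; have [sa sb _ _] := crossing_at_strands H.
apply: sector_sum oE _ sa sb xa.
by move: ns; rewrite !all_cat => /and4P[].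
Qed.

End Sectors.

(** * From a class to the radical *)

(** The elimination behind [crossing_at_middle]: [ua], ..., [ud] are the values of a section in the
    corners after the four strands, and the sign -1 marks the lower strand, here that of [a] and
    [c], in the next lemma that of [b] and [d]. *)
Lemma middle_under_first (ua ub uc ud r1 r3 ta tb tc td xa xc : rat) :
    tc + r3 + td = - (ta + r1 + tb) -> ub = 1 * (ua + r1) + tb ->
    uc = -1 * ub + (tc + xc) -> ud = 1 * (uc + r3) + td -> ua = -1 * ud + (ta + xa) ->
  xa - xc = - (2 * (ta + r1 + tb)).
Proof. lra. Qed.

Lemma middle_under_second (ua ub uc ud r1 r3 ta tb tc td xa xc : rat) :
    tc + r3 + td = - (ta + r1 + tb) -> ub = -1 * (ua + r1) + (xa - tb) ->
    uc = 1 * ub + tc -> ud = -1 * (uc + r3) + (xc - td) -> ua = 1 * ud + ta ->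
  xa - xc = 2 * (ta + r1 + tb).
Proof. lra. Qed.

Lemma maxn_lt_minn (a b c d : nat) : (maxn a c < minn b d)%N ->
  [/\ (a < b)%N, (a < d)%N, (c < b)%N & (c < d)%N] /\
  [/\ (a < (maxn a c).+1)%N, (c < (maxn a c).+1)%N, ((maxn a c).+1 <= b)%N
    & ((maxn a c).+1 <= d)%N].
Proof. by split; split; lia. Qed.

Section Radical.
Variables (S : surface) (D : link S) (xi : dart S -> bool).
Variables (t : dart S -> nat -> rat) (X : dart S -> rat) (K : nat).
Hypotheses (reg : diagram D) (col : coloring D xi) (tD : cocycle D t).
Hypotheses (Xf : forall d, X (face d) = X d) (Xoff : forall d, ~~ xi d -> X d = 0)
  (XE : forall d k, (K <= k)%N ->
     (-1) ^+ (~~ xi d) * t d k = t d 0%N + X d - X (edge d)).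
Implicit Types (a b c d e : dart S).

Lemma class_low d k : (strand D d -> (k <= height D d)%N) -> t d k = t d 0%N.
Proof.
have [_ T2 _] := tD; elim: k => // k IHk lek.
rewrite T2 ?IHk // => [sd|]; first exact: ltnW (lek sd).
rewrite heightP //; apply/negP => /andP[sd /eqP kE].
by have := lek sd; rewrite kE ltnn.
Qed.

Lemma class_const d k m : (strand D d -> (height D d < k)%N) -> t d (k + m) = t d k.
Proof.
have [_ T2 _] := tD; move=> ltk; elim: m => [|m IHm]; first by rewrite addn0.
rewrite addnS T2 // heightP //; apply/negP => /andP[/ltk + /eqP kE].
by rewrite -kE; lia.
Qed.

Lemma xi_edge d : xi (edge d) = xi d (+) strand D d.
Proof. by case: col. Qed.

(** Nothing changes above the strand, so [XE] applies right after it; of the two values of [X] the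
    one on the white side is zero. *)
Lemma class_high d k : strand D d -> (height D d < k)%N ->
  t d k = if xi d then t d 0%N + X d else X (edge d) - t d 0%N.
Proof.
move=> sd ltk; rewrite -(class_const K (fun _ => ltk)).
have := XE d (leq_addl k K); have := xi_edge d; rewrite sd addbT.
case: (boolP (xi d)) => /= xd xe; rewrite ?expr0 ?expr1 ?mul1r.
  by rewrite (Xoff (d := edge d)) ?xe // subr0.
by rewrite (Xoff xd); lra.
Qed.

(** Such an edge has one transition in all layers and one colour on both sides. Comparing the ends,
    equal signs cancel the translation between black faces, while opposite signs force it to vanish
    between white ones. *)
Lemma class_nonstrand d : ~~ strand D d -> if xi d then X (edge d) = X d else t d 0%N = 0.
Proof.
move=> nsd; have := XE d (leqnn K); rewrite class_low => [|sd]; last by rewrite sd in nsd.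
have := xi_edge d; rewrite (negPf nsd) addbF; case: (boolP (xi d)) => /= xd xe.
  by rewrite expr0 mul1r; lra.
by rewrite expr1 (Xoff xd) (Xoff (d := edge d)) ?xe //; lra.
Qed.

Lemma X_node_nonstrand e : ~~ strand D (node e) -> X (node e) = X e.
Proof.
move=> nse; have := class_nonstrand nse; have := xi_node col e; rewrite (negPf nse) addbF => xE.
rewrite -[X (edge _)]Xf face_edge_node; case: ifP => [_ ->//|/negbT nx _].
by rewrite !Xoff // -xE.
Qed.

Lemma sum_nonstrand (V : zmodType) (F : dart S -> V) s :
    all (predC (strand D)) s -> (forall e, ~~ strand D e -> e \in s -> F e = 0) ->
  \sum_(e <- s) F e = 0.
Proof. by move=> /allP ns F0; rewrite big_seq big1 // => e es; apply: F0 => //; apply: ns. Qed.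

Lemma crossing_at_X a b c d s1 s2 s3 s4 : crossing_at D a b c d s1 s2 s3 s4 ->
  X (edge b) = X a.
Proof.
move=> H; have [_ al [lE _] _ sE] := crossing_at_segment col H.
have := sE _ X (fun=> 0) _; rewrite big1_eq addr0 => <- => [|e _ /X_node_nonstrand->]; last first.
  by rewrite addr0.
by rewrite -lE -[LHS]Xf face_edge_node.
Qed.

Lemma crossing_at_white a b c d s1 s2 s3 s4 : crossing_at D a b c d s1 s2 s3 s4 ->
  ~~ xi a -> \sum_(e <- s1) t e 0%N = 0.
Proof.
move=> H nxa; have [_ _ _ xs _] := crossing_at_segment col H.
apply: sum_nonstrand => [|e nse es].
  by have [_ + _] := H; rewrite !all_cat => /and4P[].
have := class_nonstrand nse; rewrite xs ?(negPf nxa) //.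
by rewrite inE es orbT.
Qed.

Lemma vertex_sum0 d : \sum_(e | same_vertex d e) t e 0%N = 0.
Proof.
have [_ _ /(_ d 0%N isT)[u uE]] := tD; apply: (section_sum0 (@node_inj S) (u := u)) => e de.
by have := uE e de; rewrite /step /sg /= expr0 mul1r.
Qed.

Lemma crossing_at_ver a b c d s1 s2 s3 s4 k : crossing_at D a b c d s1 s2 s3 s4 ->
  ver D a k = par D a k (+) par D b k (+) par D c k (+) par D d k.
Proof.
move=> H; rewrite -par_vertex (crossing_at_sum _ H).
have par0 s : all (predC (strand D)) s -> \sum_(e <- s) (par D e k : bool) = 0 :> bool.
  by move=> ns; apply: sum_nonstrand => // e nse _; rewrite par_diagram // (negPf nse).
have [_ + _] := H; rewrite !all_cat => /and4P[n1 n2 n3 n4].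
by rewrite !par0 // !addr0.
Qed.

(* The relation on [X] says that the holonomy around the vertex is trivial in a layer between
   the two strands, where only the lower one has been crossed. *)
Lemma crossing_at_middle a b c d s1 s2 s3 s4
    (z := t a 0%N + \sum_(e <- s1) t e 0%N + t b 0%N) :
  crossing_at D a b c d s1 s2 s3 s4 -> xi a ->
  t c 0%N + \sum_(e <- s3) t e 0%N + t d 0%N = - z /\
  X a - X c = if under D a then - (2 * z) else 2 * z.
Proof.
move=> H xa; have H2 := crossing_at_rot H; have H3 := crossing_at_rot H2; have H4 := crossing_at_rot H3.
have [sa sb sc sd] := crossing_at_strands H.
have [ab al1 [l1 xb] _ m1] := crossing_at_segment col H; rewrite xa in xb.
have [bc bl2 [l2 xc] _ m2] := crossing_at_segment col H2; rewrite xb in xc.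
have [cd cl3 [l3 xd] _ m3] := crossing_at_segment col H3; rewrite xc in xd.
have [da dl4 [l4 _] _ m4] := crossing_at_segment col H4.
have w2 := crossing_at_white H2; have w4 := crossing_at_white H4.
rewrite xb in w2; rewrite xd in w4; have {}w2 := w2 isT; have {}w4 := w4 isT.
have tot := vertex_sum0 a; rewrite (crossing_at_sum _ H) w2 w4 in tot.
have E1 : t c 0%N + \sum_(e <- s3) t e 0%N + t d 0%N = - z.
  by apply/eqP; rewrite -addr_eq0 /z; apply/eqP; rewrite -[RHS]tot !addr0; ring.
split=> //; rewrite (crossing_at_under H).
have Xb := crossing_at_X H; have Xd := crossing_at_X H3.
have ac := same_vertex_trans ab bc; have ad := same_vertex_trans ac cd.
have mid k : ~~ ver D a k -> exists u : dart S -> rat,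
  [/\ u (last a s1) = u a + \sum_(e <- s1) t e 0%N, u (last b s2) = u b,
      u (last c s3) = u c + \sum_(e <- s3) t e 0%N, u (last d s4) = u d &
      forall e, same_vertex a e -> step D t k u e].
  move=> nv; have [_ _ /(_ a k nv)[u uE]] := tD.
  have uns e : same_vertex a e -> ~~ strand D (node e) -> u (node e) = u e + t (node e) 0%N.
    move=> ae ns; rewrite uE // class_low => [|sn]; last by rewrite sn in ns.
    by rewrite /sg par_diagram // (negPf ns) expr0 mul1r.
  have sv x e : same_vertex a x -> same_vertex x e -> same_vertex a e.
    by apply: same_vertex_trans.
  exists u; split=> //.
  - exact: (m1 _ u (fun e => t e 0%N)).
  - by rewrite (m2 _ u (fun e => t e 0%N)) ?w2 ?addr0 // => e /(sv _ _ ab); apply: uns.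
  - by apply: (m3 _ u (fun e => t e 0%N)) => e /(sv _ _ ac); apply: uns.
  by rewrite (m4 _ u (fun e => t e 0%N)) ?w4 ?addr0 // => e /(sv _ _ ad); apply: uns.
have sgE e k : strand D e -> sg D e k = if (height D e < k)%N then -1 else 1.
  by move=> se; rewrite /sg par_diagram // se /=; case: ifP.
case: (crossing_at_levels reg H) => /maxn_lt_minn [[hab had hcb hcd] [ka kc kb kd]].
  (* Layer k is above both darts of the lower strand and below the upper strand. Two of the four
     signs are reversed, so no vertical arc passes and a section exists. *)
  rewrite hab; set k := (maxn (height D a) (height D c)).+1 in ka kc kb kd.
  have [|u [u1 u2 u3 u4 uE]] := mid k.
    rewrite (crossing_at_ver _ H) !par_diagram // sa sb sc sd ka kc.
    by rewrite (leq_gtF kb) (leq_gtF kd).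
  move: (uE _ al1) (uE _ (same_vertex_trans ab bl2)).
  move: (uE _ (same_vertex_trans ac cl3)) (uE _ (same_vertex_trans ad dl4)).
  rewrite /step l1 l2 l3 l4 !sgE // ka kc (leq_gtF kb) (leq_gtF kd).
  rewrite (class_high sa ka) (class_high sc kc) xa xc !class_low // u1 u2 u3 u4.
  by move=> ud ua ub uc; apply: middle_under_first E1 ub uc ud ua.
rewrite ltnNge (ltnW hab) /=; set k := (maxn (height D b) (height D d)).+1 in ka kc kb kd.
have [|u [u1 u2 u3 u4 uE]] := mid k.
  rewrite (crossing_at_ver _ H) !par_diagram // sa sb sc sd ka kc.
  by rewrite (leq_gtF kb) (leq_gtF kd).
move: (uE _ al1) (uE _ (same_vertex_trans ab bl2)).
move: (uE _ (same_vertex_trans ac cl3)) (uE _ (same_vertex_trans ad dl4)).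
rewrite /step l1 l2 l3 l4 !sgE // ka kc (leq_gtF kb) (leq_gtF kd).
rewrite (class_high sb ka) (class_high sd kc) xb xd Xb Xd !class_low // u1 u2 u3 u4.
by move=> ud ua ub uc; apply: middle_under_second E1 ub uc ud ua.
Qed.

(* The value of [X] on the black side of an edge, or in the black sector of a dart. *)
Definition black_X d := if xi d then X d else X (edge d).

(** The sign records whether the black sector bounded by the under-dart lies to its left or to its
    right. *)
Definition core_coef d : rat := if under D d then
  (if xi d then 1 else -1) * (black_X d - black_X (across D d)) / 2%:R else 0.

Lemma crossing_of_under d : under D d ->
  exists b c e s1 s2 s3 s4, crossing_at D d b c e s1 s2 s3 s4.
Proof. by rewrite /under /crossing => /andP[/andP[sd /eqP]] /(crossing_exists sd). Qed.

Lemma under_strand d : under D d -> strand D d.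
Proof. by rewrite /under /crossing => /andP[/andP[]]. Qed.

Lemma under_across d : under D d ->
  [/\ under D (across D d), across D (across D d) = d & xi (across D d) = xi d].
Proof.
move=> ud; have [b [c [e [s1 [s2 [s3 [s4 H]]]]]]] := crossing_of_under ud.
have H2 := crossing_at_rot H; have H3 := crossing_at_rot H2.
have [_ _ [_ xb] _ _] := crossing_at_segment col H.
have [_ _ [_ xc] _ _] := crossing_at_segment col H2.
rewrite (crossing_at_across H) (crossing_at_across H3) (crossing_at_under H3); split=> //.
  by move: ud; rewrite (crossing_at_under H); case: (crossing_at_levels reg H); lia.
by rewrite xc xb negbK.
Qed.

Lemma core_coef_across d : under D d -> core_coef (across D d) = - core_coef d.
Proof.
move=> ud; have [ua aa xa] := under_across ud.
by rewrite /core_coef ua ud aa xa -[in RHS]mulNr -mulrN opprB.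
Qed.

(** Exactly one of [a] and [b] is an under-dart, so one term is zero and [crossing_at_middle]
    evaluates the other. *)
Lemma core_coef_crossing a b c d s1 s2 s3 s4 : crossing_at D a b c d s1 s2 s3 s4 -> xi a ->
  core_coef a + core_coef b = - (t a 0%N + \sum_(e <- s1) t e 0%N + t b 0%N).
Proof.
move=> H xa; have H2 := crossing_at_rot H; have H3 := crossing_at_rot H2.
have [_ _ [_ xb] _ _] := crossing_at_segment col H; rewrite xa in xb.
have [_ _ [_ xc] _ _] := crossing_at_segment col H2; rewrite xb in xc.
have [_ _ [_ xd] _ _] := crossing_at_segment col H3; rewrite xc in xd.
have [_] := crossing_at_middle H xa.
rewrite /core_coef /black_X (crossing_at_across H) (crossing_at_across H2) xa xb xc xd /=.
rewrite (crossing_at_X H) (crossing_at_X H3) (crossing_at_under H) (crossing_at_under H2).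
case: (crossing_at_levels reg H) => lev.
  rewrite (_ : (height D a < height D b)%N); last by lia.
  rewrite (_ : (height D b < height D c)%N = false); last by lia.
  by lra.
rewrite (_ : (height D a < height D b)%N = false); last by lia.
rewrite (_ : (height D b < height D c)%N); last by lia.
by lra.
Qed.

Lemma core_coef_nonstrand s : all (predC (strand D)) s -> \sum_(e <- s) core_coef e = 0.
Proof.
move=> ns; apply: sum_nonstrand => // e nse _.
by rewrite /core_coef; case: ifP => // /under_strand se; rewrite se in nse.
Qed.

Lemma size_around d e : same_vertex d e -> size (around D d) = size (around D e).
Proof.
move=> de; apply: perm_size; apply: perm_filter; apply: uniq_perm; rewrite ?orbit_uniq // => x.
by rewrite -!fconnect_orbit; apply: same_vertex_left.
Qed.

(** The bottom restriction vanishes inside white sectors. So at a 2-valent vertex the zero sum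
    around the vertex is the sum over the black sector, whereas at a crossing only the total over
    both black sectors is zero and the core carries the difference. *)
Lemma radical_cycle d : \sum_(e | sector xi d e) (t e 0%N + core_coef e) = 0.
Proof.
wlog xd : d / xi d.
  move=> IH; have [xd|nxd] := boolP (xi d); first exact: IH.
  pose e := finv node d; have eE : node e = d by rewrite /e f_finv //; apply: node_inj.
  have [xe|nxe] := boolP (xi e).
    rewrite -[RHS](IH e xe); apply: eq_bigl => x; apply/esym; rewrite -eE.
    exact: sector_eq (sector_node xe) x.
  have nsd : ~~ strand D d.
    by have := xi_node col e; rewrite eE (negPf nxd) (negPf nxe) /= => <-.
  have only x : sector xi d x -> x = d.
    case/connectP => q + ->; case: q => //= y q /andP[+ _].
    by rewrite (negPf nxd) /= => /andP[xy /eqP dy]; move: nxe; rewrite /e dy finv_f ?xy //; apply: node_inj.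
  rewrite big1 // => x /only->; have := class_nonstrand nsd; rewrite (negPf nxd) => ->.
  by rewrite add0r /core_coef; case: ifP => // /under_strand sd; rewrite sd in nsd.
case: (black_sector_base col xd) => [[a [sa xa da]]|allb]; last first.
  have [_ _ /(_ d 0%N isT)[u uE]] := tD.
  apply: (sector_sum0 (u := u)) => e de; last by have [->] := allb e de.
  have [_ ns] : xi (node e) /\ ~~ strand D (node e) by apply: allb; rewrite same_vertex_node.
  rewrite uE // /sg /= expr0 mul1r /core_coef; case: ifP => [/under_strand sn|_].
    by rewrite sn in ns.
  by rewrite addr0 [u e + _]addrC addrK.
have -> : \sum_(e | sector xi d e) (t e 0%N + core_coef e) =
          \sum_(e | sector xi a e) (t e 0%N + core_coef e).
  by apply: eq_bigl => x; apply: sector_eq.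
have [_ /(_ a sa)[sz2|[sz4 _ _]]] := reg; last first.
  have [b [c [e [s1 [s2 [s3 [s4 H]]]]]]] := crossing_exists sa sz4.
  rewrite big_split /= !(crossing_at_sector col _ H) // core_coef_nonstrand ?addr0.
    by rewrite (core_coef_crossing H xa) subrr.
  by have [_ + _] := H; rewrite !all_cat => /and4P[].
have [s sE] := orbit_cons a; move: (sz2); rewrite /around sE /= sa /=.
case E: [seq _ <- s | _] => [|b []] // _.
have [s1 [s2 [s12 n1 sb /filter_nil_all n2]]] := filter_cons_split E.
have oE : orbit node a = a :: s1 ++ b :: s2 by rewrite sE s12.
have oE' := orbit_rot_at (s := s1) oE.
have ab : same_vertex a b by rewrite /same_vertex fconnect_orbit oE inE mem_cat mem_head !orbT.
have nxb : xi b = false.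
  have [p _] := orbit_path oE; have := xi_node col (last a s1).
  by rewrite (segment_last p) (segment_xi col oE n1 (mem_last a s1)) xa sb.
have c0 e : same_vertex a e -> core_coef e = 0.
  move=> ae; rewrite /core_coef /under /crossing -(size_around ae) sz2.
  by rewrite andbF.
rewrite (sector_sum col _ oE n1 sa sb xa) /= (c0 a (connect0 _ _)) (c0 b ab) !addr0.
have -> : \sum_(e <- s1) (t e 0%N + core_coef e) = \sum_(e <- s1) t e 0%N.
  apply: eq_big_seq => e es; rewrite c0 ?addr0 //.
  by rewrite /same_vertex fconnect_orbit oE inE mem_cat es orbT.
have := vertex_sum0 a; rewrite sum_orbit oE big_cons big_cat big_cons /=.
rewrite [X in _ + (_ + (_ + X))]sum_nonstrand ?addr0 1?addrA // => e nse es.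
have := class_nonstrand nse; rewrite (segment_xi col oE' n2 (e := e)) ?nxb //.
by rewrite inE es orbT.
Qed.

Lemma black_X_node d : xi d -> black_X (node d) = black_X d.
Proof.
move=> xd; rewrite /black_X xd; have [sn|nsn] := boolP (strand D (node d)).
  by rewrite (xi_node col) xd sn /= -[X (edge _)]Xf face_edge_node.
by rewrite (xi_node col) xd (negPf nsn) /= X_node_nonstrand.
Qed.

Lemma black_X_sector d e : sector xi d e -> black_X d = black_X e.
Proof.
case/connectP => q + ->; elim: q d => //= y q IHq d /andP[dy /IHq <-].
by case/orP: dy => /andP[xx /eqP->]; rewrite black_X_node.
Qed.

Lemma black_X_edge d : xi d || xi (edge d) -> black_X (edge d) = black_X d.
Proof.
rewrite /black_X edgeK; have := xi_edge d.
have [sd|nsd] := boolP (strand D d); rewrite ?addbT ?addbF => ->; first by case: (xi d).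
by rewrite orbb => xd; have := class_nonstrand nsd; rewrite xd.
Qed.

Lemma sum_by_sectors (R : pzRingType) (f g : dart S -> R) :
    (forall d e, sector xi d e -> f d = f e) ->
    (forall d, \sum_(e | sector xi d e) g e = 0) ->
  \sum_d f d * g d = 0.
Proof.
move=> fs g0; pose rt := fingraph.root [rel d e | (xi d && (e == node d)) || (xi e && (d == node e))].
rewrite (partition_big rt xpredT) //= big1 // => r _.
rewrite (eq_bigl (fun d => (r == rt r) && sector xi r d)) => [|d].
  have [rr|] := eqVneq r (rt r); last by rewrite big_pred0_eq.
  rewrite (eq_bigr (fun d => f r * g d)) => [|d /= /fs->] //.
  by rewrite -mulr_sumr g0 mulr0.
rewrite /rt /sector -root_connect; last exact: sector_sym.
have rK x := root_root (sector_sym xi) x.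
by apply/eqP/andP => [<-|[/eqP rE /eqP dE]]; [rewrite !rK eqxx | rewrite [RHS]rE dE].
Qed.

Lemma sector_vertex d e : sector xi d e -> same_vertex d e.
Proof.
case/connectP => q + ->; elim: q d => [|y q IHq] d /=; first by move=> _; apply: connect0.
case/andP => dy /IHq; apply: same_vertex_trans.
case/orP: dy => /andP[_ /eqP->]; first by rewrite same_vertex_node; apply: connect0.
by rewrite same_vertex_sym same_vertex_node; apply: connect0.
Qed.

Lemma sum_across (V : zmodType) (F : dart S -> V) :
  \sum_(d | under D d) F (across D d) = \sum_(d | under D d) F d.
Proof.
rewrite [RHS](reindex_onto (across D) (across D)) /= => [|d ud]; last by have [] := under_across ud.
apply: eq_bigl => d; apply/idP/andP => [ud|[ud /eqP dE]]; have [ua aa _] := under_across ud.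
  by rewrite ua aa.
by rewrite -dE.
Qed.

Section Cycle.
Variable b : fchain S.
Hypothesis bc : is_cycle D xi b.

(** Each core leaves one black sector of its crossing and enters the opposite one, so its two
    coefficients cancel. *)
Lemma cycle_core_sum v : \sum_(e | same_vertex v e) b.2 e = 0.
Proof.
have [[_ _ b3 b4] _] := bc.
have uE : \sum_(e | same_vertex v e) b.2 e = \sum_(e | under D e) (same_vertex v e)%:R * b.2 e.
  rewrite big_mkcond [RHS]big_mkcond; apply: eq_bigr => e _.
  have [ue|nue] := boolP (under D e); last by rewrite b3 //; case: ifP.
  by case: ifP; rewrite ?mul1r ?mul0r.
have := sum_across (fun e => (same_vertex v e)%:R * b.2 e); rewrite -uE.
rewrite (eq_bigr (fun e => - ((same_vertex v e)%:R * b.2 e))) => [|e ue].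
  by rewrite sumrN -uE; lia.
have [z1 [z2 [z3 [s1 [s2 [s3 [s4 H]]]]]]] := crossing_of_under ue.
rewrite b4 // mulrN; congr (- (_%:R * _)); rewrite (crossing_at_across H).
have [a1 _ _ _ _] := crossing_at_segment col H.
have [a2 _ _ _ _] := crossing_at_segment col (crossing_at_rot H).
have ec := same_vertex_trans a1 a2.
by rewrite !(same_vertex_sym v) -(same_vertex_left ec).
Qed.

Lemma cycle_vertex_sum v : \sum_(e | same_vertex v e) b.1 e = 0.
Proof.
have := sum_by_sectors (f := fun e => (same_vertex v e)%:R : int) (g := fun e => b.1 e + b.2 e).
case: (bc) => _ b5 /(_ _ b5) => sum0.
rewrite -[LHS]addr0 -[X in _ + X](cycle_core_sum v) -big_split /= big_mkcond /=.
rewrite -[RHS]sum0; last first.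
  move=> d e /sector_vertex de; congr (_%:R).
  by rewrite !(same_vertex_sym v) (same_vertex_left de).
by apply: eq_bigr => e _; case: ifP; rewrite ?mul1r ?mul0r.
Qed.

(* [- weight / 2] is a primitive of [b.1] on the corners around each vertex. *)
Definition weight d : int := \sum_(e | same_vertex d e)
  Num.sg ((rank (e, false))%:Z - (rank (d, true))%:Z) * b.1 e.

(** When the corner moves past [node d], the sign of that dart alone changes, from +1 to -1. At the
    cut of [rank] the formula follows because [b.1] sums to zero around the vertex. *)
Lemma weight_node d : weight (node d) = weight d - 2%:R * b.1 (node d).
Proof.
pose r := froot node d; have rd : same_vertex r d.
  by rewrite same_vertex_sym; apply: connect_root.
have step e : same_vertex r e -> node e != r -> weight (node e) = weight e + (- (2%:R * b.1 (node e))).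
  move=> re ne; have rootE x : same_vertex e x -> froot node x = r.
    move=> ex; apply/eqP; rewrite -[r](root_root (fconnect_sym (@node_inj S))) -/(froot node d) -/r.
    rewrite same_vertex_froot same_vertex_sym; exact: same_vertex_trans re ex.
  have nE : findex node r (node e) = (findex node r e).+1.
    have := findex_max re; rewrite leq_eqVlt => /orP[/eqP oE|lt].
      by move: ne; rewrite -{1}(iter_findex re) -iterS oE iter_order ?eqxx //; apply: node_inj.
    by rewrite -{1}(iter_findex re) -iterS findex_iter.
  have een : same_vertex e (node e) by rewrite same_vertex_node; apply: connect0.
  rewrite /weight (eq_bigl (same_vertex e)) => [|x]; last by rewrite -(same_vertex_left een).
  rewrite -[LHS](subrK (weight e)) addrC /weight; congr (_ + _); rewrite -sumrB.
  rewrite (bigD1 (node e)) //= big1 ?addr0 => [|x /andP[ex nx]].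
    by rewrite /rank /= (rootE e (connect0 _ _)) (rootE _ een) nE -mulrBl -mulNr; congr (_ * _); lia.
  have rx : same_vertex r x := same_vertex_trans re ex.
  have nex : findex node r x <> (findex node r e).+1.
    rewrite -nE => E; case/eqP: nx.
    transitivity (iter (findex node r x) node r); first by rewrite iter_findex.
    by rewrite E nE iterS iter_findex.
  rewrite -mulrBl /rank /= (rootE e (connect0 _ _)) (rootE _ een) (rootE x ex) nE (_ : _ - _ = 0) ?mul0r //; lia.
have := partial_section_sum (@node_inj S) (t := fun e => - (2%:R * b.1 e)) step.
rewrite sumrN -mulr_sumr (cycle_vertex_sum r) mulr0 oppr0 addr0 => closing.
have [nr|] := eqVneq (node d) r; last exact: step.
by rewrite nr closing -nr finv_f //; apply: node_inj.
Qed.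

End Cycle.
Lemma weight_segment (b : fchain S) a c d e s1 s2 s3 s4 (bc : is_cycle D xi b) :
    crossing_at D a c d e s1 s2 s3 s4 -> ~~ xi a ->
  weight b (last a s1) = weight b a.
Proof.
move=> H nxa; have [_ _ [lE _] xs val] := crossing_at_segment col H.
have [[_ b2 _ _] _] := bc.
rewrite (val _ (weight b) (fun x => - (2%:R * b.1 x))) => [|x _ _]; last exact: weight_node.
rewrite sumrN -mulr_sumr sum_nonstrand ?mulr0 ?subr0 // => [|x nsx xs1].
  by have [_ + _] := H; rewrite !all_cat => /and4P[].
have nx : ~~ xi x by rewrite xs // inE xs1 orbT.
by apply: b2 => //; rewrite xi_edge (negPf nsx) addbF.
Qed.

(** Meant for strands: one of the two corners beside a strand is white, and the weight is taken
    there. *)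
Definition white_weight (b : fchain S) d : int :=
  if xi d then weight b (finv node d) else weight b d.

(** Between the two white corners lies one black sector, over which the cycle condition turns the
    sum of [b.1] into minus the core coefficient; the factor 2 comes from [weight_node]. *)
Lemma white_weight_across (b : fchain S) d (bc : is_cycle D xi b) : under D d ->
  white_weight b d - white_weight b (across D d) =
  (if xi d then -2%:R else 2%:R) * b.2 d.
Proof.
move=> ud; have [[_ _ b3 _] b5] := bc; rewrite /white_weight.
have [_ _ xac] := under_across ud; rewrite xac.
have key a c d' e s1 s2 s3 s4 : crossing_at D a c d' e s1 s2 s3 s4 -> xi a ->
    weight b c = weight b (finv node a) + 2%:R * (b.2 a + b.2 c).
  move=> H xa; have := b5 a; rewrite (crossing_at_sector col _ H) // big_split /=.
  have [_ ns _] := H; have n1 : all (predC (strand D)) s1.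
    by move: ns; rewrite !all_cat => /and4P[].
  have -> : \sum_(x <- s1) b.2 x = 0.
    apply: sum_nonstrand => // x nsx _.
    by apply: b3; apply: contra nsx; apply: under_strand.
  move=> sum0.
  have [_ _ [lE _] xs val] := crossing_at_segment col H.
  have wa : weight b a = weight b (finv node a) - 2%:R * b.1 a.
    by rewrite -{1}(f_finv (@node_inj S) a) weight_node // f_finv //; apply: node_inj.
  have := weight_node bc (last a s1); rewrite lE.
  rewrite (val _ (weight b) (fun x => - (2%:R * b.1 x))) => [|x _ _]; last exact: weight_node.
  by rewrite sumrN -mulr_sumr wa; move: sum0; lra.
have [c [d' [e [s1 [s2 [s3 [s4 H]]]]]]] := crossing_of_under ud.
have H2 := crossing_at_rot H; have H3 := crossing_at_rot H2; have H4 := crossing_at_rot H3.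
have [_ _ [l1 x1] _ _] := crossing_at_segment col H.
have [_ _ [l2 x2] _ _] := crossing_at_segment col H2.
have [_ _ [l3 x3] _ _] := crossing_at_segment col H3.
have [_ _ [l4 _] _ _] := crossing_at_segment col H4.
rewrite (crossing_at_across H).
have pred x y : node x = y -> finv node y = x by move=> <-; rewrite finv_f //; apply: node_inj.
have uc : under D c = false.
  by move: ud; rewrite (crossing_at_under H) (crossing_at_under H2); case: (crossing_at_levels reg H); lia.
have ue : under D e = false.
  move: ud; rewrite (crossing_at_under H) (crossing_at_under H4).
  by have [_] := crossing_at_heights reg H4; case: (crossing_at_levels reg H); lia.
have [xd|nxd] := boolP (xi d).
  have := key _ _ _ _ _ _ _ _ H xd; rewrite (b3 c) ?uc // addr0.
  have nxc : ~~ xi c by rewrite x1 xd.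
  by rewrite (pred _ _ _ l2) (weight_segment bc H2 nxc) => ->; ring.
have xe : xi e by rewrite x3 x2 x1 negbK.
have := key _ _ _ _ _ _ _ _ H4 xe; rewrite (b3 e) ?ue // add0r.
have nxd' : ~~ xi d' by rewrite x2 x1 negbK.
by rewrite (pred _ _ _ l3) (weight_segment bc H3 nxd') => ->; ring.
Qed.

(** A coefficient [z.2 d] enters [turn] in the two corners beside [d], of which only the white one
    counts. *)
Lemma gl_sum_white (z b : fchain S) : (forall d, ~~ under D d -> z.2 d = 0) ->
  gl_sum xi z b = \sum_(d | under D d) z.2 d * white_weight b d.
Proof.
move=> z3; transitivity (\sum_d turn xi z d * weight b d).
  rewrite /gl_sum; apply: eq_bigr => d _; rewrite /weight mulr_sumr.
  by apply: eq_bigr => e _; rewrite mulrCA mulrA.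
pose w d := if xi d then 0 else weight b d.
transitivity (\sum_d (z.2 d * w d + z.2 (node d) * w d)).
  apply: eq_bigr => d _; rewrite /turn /w.
  by case: (xi d); rewrite ?mul0r ?mulr0 ?addr0 // mulrDl.
rewrite big_split /= [X in _ + X](reindex_inj (finv_inj (@node_inj S))) /= -big_split /=.
rewrite [RHS]big_mkcond; apply: eq_bigr => d _; rewrite f_finv; last exact: node_inj.
case: ifP => [ud|/negbT/z3->]; last by rewrite !mul0r addr0.
rewrite -mulrDr /white_weight /w; congr (_ * _).
have := xi_node col (finv node d); rewrite f_finv; last exact: node_inj.
rewrite (under_strand ud) addbT => ->.
by case: (xi (finv node d)) => /=; rewrite ?addr0 ?add0r.
Qed.

(** Adding the terms of an under-dart and of its opposite produces a difference of white weights,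
    which [white_weight_across] converts into the core coefficient of [b]; its factor 2 cancels the
    1/2 in [core_coef]. The integer [m] clears denominators. *)
Lemma gl_sum_radical (m : int) (z b : fchain S) : is_cycle D xi b ->
    (forall d, ~~ under D d -> z.2 d = 0) ->
    (forall d, (z.2 d)%:~R = m%:~R * core_coef d) ->
  gl_sum xi z b = 0.
Proof.
move=> bc z3 zE; have [[b1 b2 b3 b4] b5] := bc; apply/eqP.
rewrite gl_sum_white // -(intr_eq0 rat) (rmorph_sum (intmul 1)) /=.
rewrite (eq_bigr (fun d => m%:~R * (core_coef d * (white_weight b d)%:~R))); last first.
  by move=> d _; rewrite intrM zE mulrA.
rewrite -mulr_sumr mulf_eq0; apply/orP; right.
set G := \sum_(_ | _) _.
have G1 : G = \sum_(d | under D d) core_coef (across D d) * (white_weight b (across D d))%:~R.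
  by rewrite (sum_across (fun d => core_coef d * (white_weight b d)%:~R)).
have G2 : 2%:R * G = \sum_(d | under D d) (black_X (across D d) - black_X d) * (b.2 d)%:~R.
  transitivity (G + G); first by ring.
  rewrite {2}G1 /G -big_split; apply: eq_bigr => d ud /=.
  rewrite core_coef_across // mulNr -mulrBr -intrB white_weight_across // intrM.
  by rewrite /core_coef ud; case: (xi d); rewrite ?rmorphN /=; field.
have sumX : \sum_(d | under D d) black_X d * (b.2 d)%:~R = 0.
  (* Exchanging [d] and [edge d] reverses [b.1] and preserves [black_X] wherever [b.1] can be
     nonzero, so the sum equals its negative. *)
  have B1 : \sum_d black_X d * (b.1 d)%:~R = 0.
    set B := \sum_d _; suff : B = - B by lra.
    rewrite {1}/B (reindex_inj (inv_inj (@edgeK S))) /= -sumrN; apply: eq_bigr => d _.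
    have [xx|] := boolP (xi d || xi (edge d)); first by rewrite black_X_edge // b1 rmorphN mulrN.
    by rewrite negb_or => /andP[n1 n2]; rewrite b1 b2 // !oppr0 !mulr0 oppr0.
  have := sum_by_sectors (f := black_X) (g := fun d => (b.1 d + b.2 d)%:~R) black_X_sector.
  have bs d : \sum_(e | sector xi d e) (b.1 e + b.2 e)%:~R = 0 :> rat by rewrite -(rmorph_sum (intmul 1)) b5.
  move=> /(_ bs).
  rewrite (eq_bigr (fun d => black_X d * (b.1 d)%:~R + black_X d * (b.2 d)%:~R)) => [|d _].
    rewrite big_split /= B1 add0r => sumE; rewrite -[RHS]sumE [LHS]big_mkcond; apply: eq_bigr => d _.
    by case: ifP => // /negbT/b3->; rewrite mulr0.
  by rewrite intrD mulrDr.
have sumX' : \sum_(d | under D d) black_X (across D d) * (b.2 d)%:~R = 0.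
  rewrite (eq_bigr (fun d => - (black_X (across D d) * (b.2 (across D d))%:~R))) => [|d ud].
    by rewrite sumrN (sum_across (fun d => black_X d * (b.2 d)%:~R)) sumX oppr0.
  by rewrite b4 // rmorphN mulrN opprK.
have : 2%:R * G = 0.
  rewrite G2 (eq_bigr (fun d => black_X (across D d) * (b.2 d)%:~R - black_X d * (b.2 d)%:~R)).
    by rewrite sumrB sumX sumX' subrr.
  by move=> d _; rewrite mulrBl.
by move/eqP; rewrite mulf_eq0.
Qed.

(** [black_X] is constant within a black sector and along a strand; a vanishing core coefficient
    identifies the values in the two black sectors of a crossing. *)
Lemma black_X_connected : connected_diagram D ->
    (forall d, under D d -> core_coef d = 0) ->
  forall d e, strand D d -> strand D e -> black_X d = black_X e.
Proof.
move=> conn c0.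
have across_eq d : under D d -> black_X (across D d) = black_X d.
  move=> ud; have := c0 d ud; rewrite /core_coef ud => /eqP.
  rewrite mulf_eq0 invr_eq0 /= orbF mulf_eq0 subr_eq0.
  by case: (xi d) => /= /eqP->.
have seg a b s r : orbit node a = a :: s ++ b :: r -> all (predC (strand D)) s ->
    strand D a -> strand D b -> xi a -> black_X a = black_X b.
  move=> oE ns sa sb xa; have [p _] := orbit_path oE; rewrite -(segment_last p).
  rewrite black_X_node ?(segment_xi col oE ns) ?mem_last //.
  elim: s (a) xa ns p {oE} => //= x s IHs a' xa /andP[nx ns] /andP[/eqP ax p].
  rewrite -(IHs x) // -ax ?black_X_node // (xi_node col) xa ax.
  by case: (strand D x) nx.
have vert d e : strand D d -> strand D e -> same_vertex d e -> black_X d = black_X e.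
  move=> sd se de; have [_ /(_ d sd)[sz2|[sz4 _ _]]] := reg.
    have [s sE] := orbit_cons d; move: (sz2); rewrite /around sE /= sd /=.
    case E: [seq _ <- s | _] => [|b []] // _.
    have [s1 [s2 [s12 n1 sb /filter_nil_all n2]]] := filter_cons_split E.
    have oE : orbit node d = d :: s1 ++ b :: s2 by rewrite sE s12.
    have oE' := orbit_rot_at (s := s1) oE.
    have db : black_X d = black_X b.
      have [xd|nxd] := boolP (xi d); first exact: seg oE n1 sd sb xd.
      symmetry; apply: (seg _ _ _ _ oE' n2 sb sd).
      have [p _] := orbit_path oE; rewrite -(segment_last p) (xi_node col) (segment_last p).
      by rewrite (segment_xi col oE n1 (mem_last d s1)) (negPf nxd) sb.
    have: e \in around D d by rewrite around_mem se.
    rewrite /around sE /= sd E inE in_cons orbF.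
    by case/orP => /eqP->.
  have [b [c [f [s1 [s2 [s3 [s4 H]]]]]]] := crossing_exists sd sz4.
  have H2 := crossing_at_rot H; have H3 := crossing_at_rot H2; have H4 := crossing_at_rot H3.
  have [_ _ [_ x1] _ _] := crossing_at_segment col H.
  have [_ _ [_ x2] _ _] := crossing_at_segment col H2.
  have [_ _ [_ x3] _ _] := crossing_at_segment col H3.
  have adj a1 a2 a3 a4 r1 r2 r3 r4 : crossing_at D a1 a2 a3 a4 r1 r2 r3 r4 -> xi a1 ->
      black_X a1 = black_X a2.
    move=> H'; have [oE _ _] := H'; have [sa sb _ _] := crossing_at_strands H'.
    apply: (seg _ _ _ _ oE _ sa sb); by have [_ + _] := H'; rewrite !all_cat => /and4P[].
  have opp a1 a2 a3 a4 r1 r2 r3 r4 : crossing_at D a1 a2 a3 a4 r1 r2 r3 r4 ->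
      black_X a1 = black_X a3 \/ black_X a2 = black_X a4.
    move=> H'; have H2' := crossing_at_rot H'.
    case: (crossing_at_levels reg H') => lev.
      left; rewrite -(crossing_at_across H') across_eq // (crossing_at_under H'); lia.
    right; rewrite -(crossing_at_across H2') across_eq // (crossing_at_under H2'); lia.
  have: e \in around D d by rewrite around_mem se.
  rewrite (crossing_at_around H) !inE.
  have [xd|nxd] := boolP (xi d).
    have e1 := adj _ _ _ _ _ _ _ _ H xd; have xc : xi c by rewrite x2 x1 xd.
    have e3 := adj _ _ _ _ _ _ _ _ H3 xc.
    by case: (opp _ _ _ _ _ _ _ _ H) => e2 /or4P[] /eqP->; congruence.
  have xb : xi b by rewrite x1.
  have e1 := adj _ _ _ _ _ _ _ _ H2 xb; have xf : xi f by rewrite x3 x2 x1 negbK.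
  have e3 := adj _ _ _ _ _ _ _ _ H4 xf.
  by case: (opp _ _ _ _ _ _ _ _ H) => e2 /or4P[] /eqP->; congruence.
move=> d e sd se; have /connectP[q + ->] := conn d e sd se.
elim: q d {sd} => //= y q IHq d /andP[/and3P[sd sy] dy /IHq <-].
case/orP: dy => [/eqP->|]; last exact: vert.
by rewrite black_X_edge //; have := xi_edge d; rewrite sd => ->; case: (xi d).
Qed.

Lemma determinant0_of_class : connected_diagram D ->
  (forall y, ~ flat_section D t y) -> determinant_is D xi 0.
Proof.
(* The class is rational but chains of [F] are integral, so everything is multiplied by the product
   [m] of all denominators. *)
move=> conn noy; have [[m g] /= [m_gt0 gE]] : exists mg : int * (dart S * bool -> int),
    0 < mg.1 /\ forall p, mg.1%:~R * (if p.2 then core_coef p.1 else t p.1 0%N) = (mg.2 p)%:~R.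
  pose f (p : dart S * bool) := if p.2 then core_coef p.1 else t p.1 0%N.
  pose m := \prod_p denq (f p).
  exists (m, fun p => numq (f p) * \prod_(q | q != p) denq (f q)); split=> [|p] /=.
    by apply: prodr_gt0 => p _; apply: denq_gt0.
  rewrite -/(f p) /m (bigD1 p) //= !intrM mulrAC [_%:~R * f p]mulrC; congr (_ * _).
  by rewrite -{1}(divq_num_den (f p)) divfK // intr_eq0 denq_eq0.
have m0 : m%:~R != 0 :> rat by rewrite intr_eq0 gt_eqF.
pose z : fchain S := ([ffun d => g (d, false)], [ffun d => g (d, true)]).
have z1 d : (z.1 d)%:~R = m%:~R * t d 0%N :> rat by rewrite ffunE -gE.
have z2 d : (z.2 d)%:~R = m%:~R * core_coef d :> rat by rewrite ffunE -gE.
have inj : injective (intmul (1 : rat)) by apply: intr_inj.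
have z3 d : ~~ under D d -> z.2 d = 0.
  by move=> nud; apply: inj; rewrite /= z2 /core_coef (negPf nud) mulr0.
have [T1 _ _] := tD.
have zc : is_cycle D xi z.
  split; first split=> // d.
  - by apply: inj; rewrite /= rmorphN /= !z1 T1 /sg /= expr0 mul1r mulrN.
  - move=> nx nxe; apply: inj; rewrite /= z1; have := xi_edge d.
    rewrite (negPf nx) (negPf nxe) /= => /esym/negbT nsd.
    by have := class_nonstrand nsd; rewrite (negPf nx) => ->; rewrite mulr0.
  - by move=> ud; apply: inj; rewrite /= rmorphN /= !z2 core_coef_across // mulrN.
  move=> d; apply: inj; rewrite /= (rmorph_sum (intmul 1)) /=.
  rewrite (eq_bigr (fun e => m%:~R * (t e 0%N + core_coef e))) => [|e _].
    by rewrite -mulr_sumr radical_cycle mulr0.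
  by rewrite intrD z1 z2 mulrDr.
have [d0 nd0] : exists d0, ~~ xi d0.
  have [d sd] := link_strand D; have := xi_edge d; rewrite sd addbT.
  by case: (boolP (xi d)) => [_ xe|nx _]; [exists (edge d); rewrite xe | exists d].
apply: (determinant0 (w := z) nd0 zc) => [[x [xf xoff xz1 xz2]]|b bc]; last first.
  exact: gl_sum_radical bc z3 z2.
have c0 d : under D d -> core_coef d = 0.
  move=> _; have := z2 d; rewrite xz2 => /esym/eqP.
  by rewrite mulf_eq0 (negPf m0) => /eqP.
have [d1 sd1] := link_strand D.
pose C := black_X d1.
have bC d : strand D d -> black_X d = C by move=> sd; apply: black_X_connected.
have tx d : t d 0%N = (x d)%:~R / m%:~R - (x (edge d))%:~R / m%:~R.
  apply: (mulfI m0); rewrite -z1 xz1 intrB mulrBr ![m%:~R * _]mulrC.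
  by rewrite !divfK.
(* Half of the common value C is added to the primitive: below the strands a constant cancels in the
   difference, and above a strand the reversed sign counts it twice, which gives the C required by
   [class_high]. *)
apply: (noy (fun d => (x d)%:~R / m%:~R + C / 2%:R)); split=> [d|d k]; first by rewrite xf.
have [low|high] := boolP (~~ strand D d || (k <= height D d)%N).
  rewrite class_low => [|sd]; last by move: low; rewrite sd.
  rewrite tx /sg par_diagram //; move: low; rewrite leqNgt -negb_and => /negPf->.
  by rewrite expr0 mul1r; ring.
move: high; rewrite negb_or negbK -ltnNge => /andP[sd lt].
rewrite (class_high sd lt) tx /sg par_diagram // sd lt expr1.
have := bC d sd; rewrite /black_X; have := xi_edge d; rewrite sd addbT.
case: (boolP (xi d)) => xd xe XC.
  by rewrite (xoff (edge d)) ?xe // XC; field.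
by rewrite (xoff d) // XC; field.
Qed.

End Radical.

Lemma coloring_dual (S : surface) (D : link S) xi :
  coloring D xi -> coloring D (dual_coloring xi).
Proof.
by case=> xif xie; split=> d; rewrite /dual_coloring ?xif // xie addNb.
Qed.

Lemma height_le_bound (S : surface) (D : link S) d : diagram D -> strand D d ->
  (height D d <= height_bound D)%N.
Proof.
move=> reg sd; rewrite leqNgt; apply/negP => lt.
by have [/(_ lt)] := arcs_bounded D d (height D d); rewrite hor_height.
Qed.

Lemma coloring_class (S : surface) (D : link S) xi :
  diagram D -> coloring D xi -> admits_class D false.
Proof.
move=> reg [xif xie]; exists xi, (fun _ _ => 0), false, (fun=> 0), (height_bound D).+1; split=> //.
- split=> // d k ltk; rewrite xie par_diagram //; case sd: (strand D d) => //=.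
  by rewrite (leq_trans _ ltk) // ltnS height_le_bound.
- split=> [d k||d k nv] //; first by rewrite mulr0 oppr0.
  by exists (fun=> 0) => e _; rewrite /step mulr0 addr0.
by split=> // d k _ /=; ring.
Qed.

Lemma class_determinant (S : surface) (D : link S) xi :
  diagram D -> connected_diagram D -> coloring D xi -> admits_class D true ->
  determinant_is D xi 0 \/ determinant_is D (dual_coloring xi) 0.
Proof.
move=> reg conn col; have [xif xie] := col.
case=> xi0 [t [s [X [K [[xi0f xi0E] tD [Xf XE] noy]]]]].
have [d0 _] := link_dart D; pose c := xi d0 (+) xi0 d0.
pose K1 := maxn K (height_bound D).+1.
have parK d : par D d K1 = strand D d.
  rewrite par_diagram //; case sd: (strand D d) => //=.
  by rewrite (leq_trans _ (leq_maxr _ _)) // ltnS height_le_bound.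
have cE d : xi0 d = xi d (+) c.
  suff <- : xi d (+) xi0 d = c by rewrite addKb.
  apply: (face_invariant_surface (x := fun d => xi d (+) xi0 d)) => e; first by rewrite xif xi0f.
  by rewrite xie (xi0E e K1) ?leq_maxl // parK -addbA [strand D e (+) _]addbC -!addbA addbb addbF.
(* White for [xi1] are the faces where the top sign [(-1) ^+ xi0 d] is opposite to [(-1) ^+ s].
   There the gauge by half of [X] below shifts the end function by its full value and makes it
   zero. *)
pose xi1 := if c (+) s then xi else dual_coloring xi.
have xi1E d : ~~ xi1 d = xi0 d (+) s.
  rewrite cE -addbA /xi1 /dual_coloring; case: (c (+) s); rewrite ?addbT ?addbF //.
  by rewrite negbK.
have col1 : coloring D xi1 by rewrite /xi1; case: (c (+) s) => //; apply: coloring_dual.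
have [xi1f _] := col1.
pose y d := if xi1 d then 0 else (-1) ^+ s * X d / 2%:R.
have yf d : y (face d) = y d by rewrite /y xi1f Xf.
suff : determinant_is D xi1 0 by rewrite /xi1; case: ifP; [left | right].
pose t1 d k := t d k + y d - sg D d k * y (edge d).
pose X1 d := if xi1 d then (-1) ^+ s * X d else 0.
apply: (@determinant0_of_class S D xi1 t1 X1 K1 reg col1 (cocycle_gauge yf tD)) => //.
- by move=> d; rewrite /X1 xi1f Xf.
- by move=> d nx; rewrite /X1 (negPf nx).
- move=> d k ltk; have Kk : (K <= k)%N by apply: leq_trans ltk; apply: leq_maxl.
  have pk : par D d k = strand D d.
    rewrite par_diagram //; case sd: (strand D d) => //=.
    by rewrite (leq_trans _ ltk) // (leq_trans _ (leq_maxr _ _)) // ltnS height_le_bound.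
  have [_ /(_ d) xi1e] := col1; have := XE d k Kk; rewrite /t1 /X1 /y /sg pk /= expr0 xi1e xi1E.
  have := xi1E d; case: (strand D d); case: (xi1 d); case: (xi0 d); case: (s) => //= _;
    rewrite ?expr0 ?expr1; lra.
by move=> z /(flat_section_gauge yf)/noy; apply.
Qed.

(** * Circles and their sides *)

Section Circle.
Variables (S : surface) (g : seq (dart S)).
Hypothesis circle : embedded_circle g.
Implicit Types d e v x : dart S.

Lemma circle_uniq : uniq g.
Proof. by case/and4P: circle => _ _ /map_uniq. Qed.

Lemma circle_next d : d \in g -> same_vertex (edge d) (next g d).
Proof. by case/and4P: circle => _ /next_cycle + _ _; apply. Qed.

Lemma circle_edge d : d \in g -> edge d \notin g.
Proof. by case/and4P: circle => _ _ _ /allP; apply. Qed.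

Lemma vertex_onP e : reflect (exists2 d, d \in g & same_vertex e d) (vertex_on g e).
Proof. exact: hasP. Qed.

Lemma vertex_on_same d e : same_vertex d e -> vertex_on g d = vertex_on g e.
Proof. by move=> de; apply: eq_has => x; apply: same_vertex_left. Qed.

Lemma edge_on_edge e : edge_on g (edge e) = edge_on g e.
Proof. by rewrite /edge_on edgeK orbC. Qed.

Lemma edge_on_vertex e : edge_on g e -> vertex_on g e.
Proof.
case/orP => eg; apply/vertex_onP; first by exists e => //; apply: connect0.
by exists (next g (edge e)); rewrite ?mem_next //; have := circle_next eg; rewrite edgeK.
Qed.

Lemma circle_count v : \sum_(d <- g) (same_vertex v d : nat) = vertex_on g v.
Proof.
have un : uniq [seq froot node d | d <- g] by case/and4P: circle.
have := count_uniq_mem (froot node v) un; rewrite count_map -sum1_count big_mkcond /=.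
rewrite (eq_bigr (fun d => (same_vertex v d : nat))) => [->|d _]; last first.
  by rewrite eq_sym same_vertex_froot; case: ifP.
congr nat_of_bool; apply/mapP/vertex_onP => -[d dg E]; exists d => //.
  by rewrite -same_vertex_froot E.
by apply/eqP; rewrite same_vertex_froot.
Qed.

Lemma sum_next (V : zmodType) (F : dart S -> V) :
  \sum_(d | d \in g) F (next g d) = \sum_(d | d \in g) F d.
Proof.
rewrite [RHS](reindex_inj (can_inj (prev_next circle_uniq))) /=.
by apply: eq_bigl => d; rewrite mem_next.
Qed.

Definition along_circle (a : dart S -> rat) d : rat :=
  (if d \in g then a d else 0) - (if edge d \in g then a (edge d) else 0).

Lemma along_circle_sum (a : dart S -> rat) v :
  \sum_(e | same_vertex v e) along_circle a e =
  \sum_(d | d \in g) (same_vertex v d)%:R * (a d - a (prev g d)).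
Proof.
have S1 : \sum_(e | same_vertex v e) (if e \in g then a e else 0) =
    \sum_(d | d \in g) (same_vertex v d)%:R * a d.
  rewrite big_mkcond [RHS]big_mkcond; apply: eq_bigr => e _.
  by do 2!case: ifP => _; rewrite ?mul1r ?mul0r.
have S2 : \sum_(e | same_vertex v e) (if edge e \in g then a (edge e) else 0) =
    \sum_(d | d \in g) (same_vertex v d)%:R * a (prev g d).
  rewrite -sum_next big_mkcond (reindex_inj (inv_inj (@edgeK S))) [RHS]big_mkcond /=.
  apply: eq_bigr => e _; rewrite edgeK prev_next ?circle_uniq //.
  case: (boolP (e \in g)) => [eg|_]; last by case: ifP.
  rewrite -!(same_vertex_sym _ v) (same_vertex_left (circle_next eg)).
  by case: ifP => _; rewrite ?mul1r ?mul0r.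
by rewrite sumrB S1 S2 -sumrB; apply: eq_bigr => d _; rewrite mulrBr.
Qed.

Lemma along_circle_edge a d : along_circle a (edge d) = - along_circle a d.
Proof. by rewrite /along_circle edgeK opprB. Qed.

Lemma along_circle_off a d : ~~ edge_on g d -> along_circle a d = 0.
Proof. by rewrite negb_or => /andP[/negPf dg /negPf eg]; rewrite /along_circle dg eg subrr. Qed.

Lemma side_face d0 e : e \in side g d0 -> face e \in side g d0.
Proof.
by rewrite !inE => H; apply: connect_trans H (connect1 _); rewrite /= eqxx.
Qed.

Lemma side_edge d0 e : e \in side g d0 -> ~~ edge_on g e -> edge e \in side g d0.
Proof.
by rewrite !inE => H ne; apply: connect_trans H (connect1 _); rewrite /= ne eqxx orbT.
Qed.

Lemma side_edge_node d0 e : e \in side g d0 -> edge (node e) \in side g d0.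
Proof.
move=> eU; have: fconnect (@face S) e (edge (node e)).
  rewrite fconnect_sym; last exact: face_inj.
  by have := fconnect1 (@face S) (edge (node e)); rewrite face_edge_node.
by move: (edge (node e)); apply: (orbit_ind (f := @face S)) => // x _ xU _; apply: side_face.
Qed.

(** No edge at a vertex off the circle belongs to the circle, so turning around the vertex never
    leaves the side. *)
Lemma side_vertex d0 v e : v \in side g d0 -> ~~ vertex_on g v -> same_vertex v e ->
  e \in side g d0 /\ ~~ edge_on g e.
Proof.
move=> vU nv ve; have non x : same_vertex v x -> ~~ edge_on g x.
  by move=> vx; apply: contra nv => /edge_on_vertex; rewrite (vertex_on_same vx).
split; last exact: non.
move: e ve; apply: (orbit_ind (f := node)) => // e ve eU _.
rewrite -[node e]edgeK; apply: side_edge; first exact: side_edge_node.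
by rewrite edge_on_edge; apply: non; rewrite same_vertex_node.
Qed.

Lemma side_invariant (V : Type) (y : dart S -> V) d0 :
    (forall d, y (face d) = y d) ->
    (forall d, d \in side g d0 -> ~~ edge_on g d -> y (edge d) = y d) ->
  forall d, d \in side g d0 -> y d = y d0.
Proof.
move=> yf ye d; rewrite inE => /connectP[q + ->].
have d0U : d0 \in side g d0 by rewrite inE; apply: connect0.
suff: forall z, z \in side g d0 -> path [rel x y | (y == face x) || (~~ edge_on g x && (y == edge x))] z q ->
    y (last z q) = y z by apply.
elim: q => //= x q IHq z zU /andP[zx /IHq ->].
  by case/orP: zx => [/eqP->|/andP[nz /eqP->]]; [rewrite yf | rewrite ye].
by case/orP: zx => [/eqP->|/andP[nz /eqP->]]; [apply: side_face | apply: side_edge].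
Qed.

End Circle.

Lemma euler_count (v e f : nat) : (e - v <= f)%N -> (v <= e)%N ->
  (f - (e - v))%N = 1%N -> (v + f = e + 1)%N.
Proof. lia. Qed.

Section Euler.
Variables (S : surface) (g : seq (dart S)) (d0 : dart S).
Hypotheses (circle : embedded_circle g) (d0_on : edge_on g d0).
Implicit Types d e x : dart S.

Let U := side g d0.
Let A : {set dart S} := [set froot node e | e in U & ~~ vertex_on g e].
Let B : {set dart S} := [set froot (@face S) e | e in U].
Let C : {set {set dart S}} := [set [set e; edge e] | e in U & ~~ edge_on g e].

Let inner e := (e \in U) && ~~ edge_on g e.

Lemma inner_edge e : inner (edge e) = inner e.
Proof.
apply/andP/andP => -[eU ne]; split; rewrite ?edge_on_edge // in ne *.
  by rewrite -[e]edgeK; apply: side_edge; rewrite ?edge_on_edge.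
exact: side_edge.
Qed.

Let orient e : rat := if (enum_rank e < enum_rank (edge e))%N then 1 else -1.

Lemma orient_edge e : orient (edge e) = - orient e.
Proof.
rewrite /orient edgeK; case: (ltngtP (enum_rank e) (enum_rank (edge e))) => [||/val_inj/enum_rank_inj E].
- by rewrite ?opprK.
- by rewrite ?opprK.
by have := edge_neq e; rewrite -E eqxx.
Qed.

Lemma orient_sqr e : orient e * orient e = 1.
Proof. by rewrite /orient; case: ifP => _; rewrite ?mul1r // mulrNN mul1r. Qed.

Lemma cellP (c : 'I_#|C|) : exists2 e, inner e & enum_val c = [set e; edge e].
Proof. by have /imsetP[e] := enum_valP c; rewrite inE => ie ->; exists e. Qed.

Lemma cell_edge (c : 'I_#|C|) e : (edge e \in enum_val c) = (e \in enum_val c).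
Proof.
have [x _ ->] := cellP c; rewrite !inE orbC (inj_eq (inv_inj (@edgeK S))).
by rewrite (inv_eq (@edgeK S)).
Qed.

Lemma cell_inner (c : 'I_#|C|) e : e \in enum_val c -> inner e.
Proof.
by have [x ix ->] := cellP c; rewrite !inE => /orP[]/eqP->; rewrite ?inner_edge.
Qed.

Lemma cell_eq (c : 'I_#|C|) e : e \in enum_val c -> enum_val c = [set e; edge e].
Proof.
have [x ix ->] := cellP c; rewrite !inE => /orP[]/eqP-> //.
by rewrite edgeK setUC.
Qed.

Lemma cell_of e : inner e -> exists c : 'I_#|C|, e \in enum_val c.
Proof.
move=> ie; have eC : [set e; edge e] \in C by apply/imsetP; exists e; rewrite // inE.
by exists (enum_rank_in eC [set e; edge e]); rewrite enum_rankK_in // !inE eqxx.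
Qed.

Definition chain_of (v : 'rV[rat]_#|C|) e : rat :=
  \sum_(c < #|C|) v 0 c * (if e \in enum_val c then orient e else 0).

Lemma chain_of_edge v e : chain_of v (edge e) = - chain_of v e.
Proof.
rewrite /chain_of -sumrN; apply: eq_bigr => c _; rewrite cell_edge orient_edge.
by case: ifP; rewrite ?mulr0 ?oppr0 ?mulrN.
Qed.

Lemma chain_of_off v e : ~~ inner e -> chain_of v e = 0.
Proof.
move=> ne; rewrite /chain_of big1 // => c _.
by case: ifP => [/cell_inner|_]; rewrite ?(negPf ne) ?mulr0.
Qed.

Lemma chain_ofE v (c : 'I_#|C|) e : e \in enum_val c -> chain_of v e = v 0 c * orient e.
Proof.
move=> ec; rewrite /chain_of (bigD1 c) //= ec big1 ?addr0 // => c' nc.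
case: ifP => [ec'|_]; rewrite ?mulr0 //.
by case/eqP: nc; apply: enum_val_inj; rewrite (cell_eq ec) (cell_eq ec').
Qed.

(** [M2] and [M1] are the boundary maps, acting on row vectors, of the cellular chains of the closed
    side relative to the circle: faces, inner edges, vertices off the circle. *)
Let M1 : 'M[rat]_(#|C|, #|A|) := \matrix_(c < #|C|, a < #|A|)
  \sum_(e in enum_val c) (froot node e == enum_val a)%:R * orient e.
Let M2 : 'M[rat]_(#|B|, #|C|) := \matrix_(b < #|B|, c < #|C|)
  \sum_(e in enum_val c) (froot (@face S) e == enum_val b)%:R * orient e.

Definition face_fun (w : 'rV[rat]_#|B|) e : rat :=
  \sum_(b < #|B|) w 0 b * (froot (@face S) e == enum_val b)%:R.

Definition vertex_fun (f : 'rV[rat]_#|A|) e : rat :=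
  \sum_(a < #|A|) f 0 a * (froot node e == enum_val a)%:R.

Lemma mul_M1 v a : (v *m M1) 0 a = \sum_(e | froot node e == enum_val a) chain_of v e.
Proof.
rewrite mxE /chain_of exchange_big /=; apply: eq_bigr => c _.
rewrite mxE -mulr_sumr; congr (_ * _); rewrite big_mkcond [RHS]big_mkcond.
by apply: eq_bigr => e _; do 2!case: ifP => _; rewrite ?mul1r ?mul0r.
Qed.

Lemma cell_sum (F : dart S -> rat) (c : 'I_#|C|) e : e \in enum_val c ->
  \sum_(x in enum_val c) F x * orient x = (F e - F (edge e)) * orient e.
Proof.
move=> ec; rewrite (cell_eq ec) big_setU1 /=; last by rewrite inE eq_sym edge_neq.
by rewrite big_set1 orient_edge; ring.
Qed.

Lemma mul_M2 w (c : 'I_#|C|) e : e \in enum_val c ->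
  (w *m M2) 0 c = (face_fun w e - face_fun w (edge e)) * orient e.
Proof.
move=> ec; rewrite -(cell_sum _ ec) mxE /face_fun.
under [RHS]eq_bigr do rewrite mulr_suml.
rewrite exchange_big /=; apply: eq_bigr => b _; rewrite mxE mulr_sumr.
by apply: eq_bigr => x _; rewrite mulrA.
Qed.

Lemma chain_of_boundary w e : inner e ->
  chain_of (w *m M2) e = face_fun w e - face_fun w (edge e).
Proof.
case/cell_of => c ec; rewrite (chain_ofE _ ec) (mul_M2 _ ec) -mulrA orient_sqr mulr1 //.
Qed.

Lemma face_fun_face w e : face_fun w (face e) = face_fun w e.
Proof.
apply: eq_bigr => b _; congr (_ * (_ == _)%:R); apply/eqP.
rewrite root_connect; last by apply: fconnect_sym; apply: face_inj.
by rewrite fconnect_sym ?fconnect1 //; apply: face_inj.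
Qed.

Lemma face_of e : e \in U -> exists b : 'I_#|B|, froot (@face S) e = enum_val b.
Proof.
move=> eU; have eB : froot (@face S) e \in B by apply/imsetP; exists e.
by exists (enum_rank_in eB (froot (@face S) e)); rewrite enum_rankK_in.
Qed.

Lemma face_funE w e (b : 'I_#|B|) : froot (@face S) e = enum_val b -> face_fun w e = w 0 b.
Proof.
move=> eb; rewrite /face_fun (bigD1 b) //= eb eqxx mulr1 big1 ?addr0 // => b' nb.
by rewrite (inj_eq enum_val_inj) eq_sym (negPf nb) mulr0.
Qed.

Lemma inner_vertex (a : 'I_#|A|) e : froot node e = enum_val a -> inner e /\ ~~ vertex_on g e.
Proof.
move=> ea; have /imsetP[x] := enum_valP a; rewrite inE -ea => /andP[xU nx] /eqP.
rewrite same_vertex_froot same_vertex_sym => xe.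
have [eU ne] := side_vertex circle xU nx xe.
by rewrite /inner eU ne -(vertex_on_same _ xe).
Qed.

Lemma M2M1 : M2 *m M1 = 0.
Proof.
apply/row_matrixP => b; rewrite row0 rowE mulmxA; set w := delta_mx 0 b.
apply/rowP => a; rewrite mul_M1 mxE.
rewrite (eq_bigr (fun e => face_fun w e - face_fun w (edge e))) => [|e /eqP ea]; last first.
  by apply: chain_of_boundary; have [] := inner_vertex ea.
have /imsetP[v _ av] := enum_valP a.
rewrite (eq_bigl (same_vertex v)) => [|e]; last by rewrite av same_vertex_froot same_vertex_sym.
rewrite sumrB [X in _ - X](reindex_inj (@node_inj S)) /=; apply/eqP; rewrite subr_eq0; apply/eqP.
apply: eq_big => [e|e _]; first by rewrite same_vertex_node.
by rewrite -[RHS]face_fun_face face_edge_node.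
Qed.

(** Relative H_0 vanishes: a function killed by the coboundary is constant along inner edges and,
    extended by zero, vanishes on the circle, to which every vertex of the side is joined. *)
Lemma rank_M1 : \rank M1 = #|A|.
Proof.
rewrite -mxrank_tr; apply/eqP; rewrite -/(row_free _) -kermx_eq0; apply/rowV0P => f.
move/sub_kermxP => fM; have fE e : inner e -> vertex_fun f e = vertex_fun f (edge e).
  case/cell_of => c ec; have := congr1 (fun m : 'rV_#|C| => m 0 c) fM; rewrite mxE [RHS]mxE.
  rewrite (eq_bigr (fun a => \sum_(x in enum_val c) f 0 a * (froot node x == enum_val a)%:R * orient x)); last first.
    by move=> a _; rewrite !mxE mulr_sumr; apply: eq_bigr => x _; rewrite mulrA.
  rewrite exchange_big /= (eq_bigr (fun x => vertex_fun f x * orient x)) => [|x _]; last first.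
    by rewrite mulr_suml.
  rewrite (cell_sum _ ec) => /eqP; rewrite mulf_eq0 [orient e == 0](_ : _ = false) ?orbF.
    by rewrite subr_eq0 => /eqP.
  by rewrite /orient; case: ifP.
have f_on e : vertex_on g e -> vertex_fun f e = 0.
  move=> von; rewrite /vertex_fun big1 // => a _; case: eqP => [ea|_]; last exact: mulr0.
  by have [_] := inner_vertex ea; rewrite von.
have f_vertex x y : same_vertex x y -> vertex_fun f x = vertex_fun f y.
  by move=> xy; apply: eq_bigr => a _; congr (_ * (_ == _)%:R); apply/eqP; rewrite same_vertex_froot.
have f0 e : e \in U -> ~~ vertex_on g e -> vertex_fun f e = 0.
  (* The induction walks over the whole surface from [e]. Either the walk has stayed in the side off
     the circle and kept the value, or the circle was met and the value is zero; as [d0] lies on the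
     circle, the latter happens. *)
  move=> eU ne; pose P z := vertex_fun f e = 0 \/ [/\ z \in U, ~~ vertex_on g z & vertex_fun f e = vertex_fun f z].
  have Pall : forall z, P z.
    apply: (surface_ind (d := e)); first by right.
      move=> z [z0|[zU nz zE]]; [by left|right].
      have zz : same_vertex z (node z) by rewrite same_vertex_node; apply: connect0.
      have [zU' _] := side_vertex circle zU nz zz.
      by rewrite -(vertex_on_same g zz) zE (f_vertex _ _ zz).
    move=> z [z0|[zU nz zE]]; first by left.
    have iz : inner z by rewrite /inner zU; apply: contra nz; apply: edge_on_vertex.
    have [von|nvon] := boolP (vertex_on g (edge z)); first by left; rewrite zE fE // f_on.
    by right; have := iz; rewrite -inner_edge => /andP[-> _]; rewrite zE fE.
  by case: (Pall d0) => // -[_]; rewrite (edge_on_vertex circle d0_on).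
apply/rowP => a; rewrite mxE; have /imsetP[x] := enum_valP a; rewrite inE => /andP[xU nx] xa.
rewrite -[RHS](f0 x xU nx) /vertex_fun (bigD1 a) //= xa eqxx mulr1 big1 ?addr0 // => a' na.
by rewrite -xa (inj_eq enum_val_inj) eq_sym (negPf na) mulr0.
Qed.

(** Relative H_2 is one-dimensional: a 2-chain with zero boundary has equal coefficients across
    inner edges, hence on the whole side. *)
Lemma rank_ker_M2 : \rank (kermx M2) = 1%N.
Proof.
have d0U : d0 \in U by rewrite inE; apply: connect0.
have [b0 b0E] := face_of d0U.
pose one : 'rV[rat]_#|B| := const_mx 1.
have one1 e : e \in U -> face_fun one e = 1.
  by case/face_of => b eb; rewrite (face_funE _ eb) mxE.
have oneM : one *m M2 = 0.
  apply/rowP => c; have [e ie ec] := cellP c.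
  have ec' : e \in enum_val c by rewrite ec !inE eqxx.
  rewrite (mul_M2 _ ec') !mxE !one1 ?subrr ?mul0r //; last by case/andP: ie.
  by have := ie; rewrite -inner_edge => /andP[].
have one_n0 : one != 0.
  apply/eqP => /rowP/(_ b0); rewrite !mxE => /eqP.
  by rewrite oner_eq0.
have <- : \rank one = 1%N by rewrite rank_rV one_n0.
apply/eqP; rewrite eqn_leq; apply/andP; split; apply: mxrankS; last exact/sub_kermxP.
apply/rV_subP => w /sub_kermxP wM; apply/sub_rVP; exists (w 0 b0).
apply/rowP => b; rewrite !mxE mulr1 -(face_funE w b0E).
have /imsetP[e eU be] := enum_valP b.
rewrite -(face_funE w (b := b) (e := e)) //; apply: side_invariant eU => [e'|e' e'U ne].
  exact: face_fun_face.
have [c ec] := cell_of (introT andP (conj e'U ne)).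
have := mul_M2 w ec; rewrite wM mxE => /esym/eqP; rewrite mulf_eq0.
rewrite [orient e' == 0](_ : _ = false) ?orbF; first by rewrite subr_eq0 => /eqP.
by rewrite /orient; case: ifP.
Qed.

(** The two rank computations give relative H_1 the dimension 1 - (V - E + F), which is nonzero
    unless the side counts as a disc. The cycle is a row of [kermx M1] outside the row space of
    [M2]. *)
Lemma relative_cycle_exists : ~~ disc g U -> exists t : dart S -> rat,
  [/\ forall e, t (edge e) = - t e,
      forall e, ~~ ((e \in U) && ~~ edge_on g e) -> t e = 0,
      forall v, ~~ vertex_on g v -> \sum_(e | same_vertex v e) t e = 0 &
      forall x : dart S -> rat, (forall e, x (face e) = x e) ->
        exists e, (e \in U) && ~~ edge_on g e /\ x e - x (edge e) <> t e].
Proof.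
move=> ndisc; have nsub : ~~ (kermx M1 <= M2)%MS.
  apply: contra ndisc => sub; rewrite /disc -/A -/B -/C; apply/eqP.
  have eqr : \rank M2 = \rank (kermx M1).
    by apply/eqP; rewrite eqn_leq !mxrankS //; apply/sub_kermxP; apply: M2M1.
  have := rank_ker_M2; rewrite mxrank_ker eqr mxrank_ker rank_M1.
  have := rank_leq_row M1; have := rank_leq_row M2; rewrite eqr mxrank_ker rank_M1.
  exact: euler_count.
have [i nrow] := row_subPn nsub; set v := row i (kermx M1) in nrow.
have vM : v *m M1 = 0 by apply/sub_kermxP; apply: row_sub.
exists (chain_of v); split.
- exact: chain_of_edge.
- exact: chain_of_off.
- move=> w nw; have [wU|nwU] := boolP (w \in U); last first.
    rewrite big1 // => e we; apply: chain_of_off; apply: contra nwU => /andP[eU _].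
    have ne : ~~ vertex_on g e by rewrite -(vertex_on_same g we).
    by rewrite same_vertex_sym in we; have [] := side_vertex circle eU ne we.
  have wA : froot node w \in A by apply/imsetP; exists w; rewrite // inE wU.
  have := congr1 (fun m : 'rV_#|A| => m 0 (enum_rank_in wA (froot node w))) vM.
  rewrite mul_M1 mxE enum_rankK_in // => sum0; rewrite -[RHS]sum0; apply: eq_bigl => e.
  by rewrite same_vertex_froot same_vertex_sym.
move=> x xf; apply: NNPP => none; case/negP: nrow; apply/submxP.
exists (\row_b x (enum_val b)); apply/rowP => c; have [e ie ec] := cellP c.
have ec' : e \in enum_val c by rewrite ec !inE eqxx.
have o0 : orient e != 0 by rewrite /orient; case: ifP.
apply: (mulIf o0); rewrite -(chain_ofE v ec') (mul_M2 _ ec') -mulrA orient_sqr mulr1.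
have xE y : y \in U -> face_fun (\row_b x (enum_val b)) y = x y.
  case/face_of => b yb; rewrite (face_funE _ yb) mxE -yb.
  have := connect_root (frel (@face S)) y; move: (froot _ _).
  by apply: (orbit_ind (f := @face S)) => // z _ zy _; rewrite xf.
rewrite !xE; first last.
- by case/andP: ie.
- by have := ie; rewrite -inner_edge => /andP[].
by apply: NNPP => ne; apply: none; exists e; split=> // /esym.
Qed.

End Euler.

(** * Destabilizable links *)

Section ClassOfCycle.
Variables (S : surface) (L : link S).
Implicit Types (d e v : dart S).

Definition free_vertex v : Prop :=
  forall e k, same_vertex v e -> ~~ L (Hor e k).

Lemma par_free d k : (forall j, ~~ L (Hor d j)) -> par L d k = false.
Proof. by move=> free; elim: k => //= k ->; rewrite (negPf (free k)). Qed.

Lemma sg_free d k : (forall j, ~~ L (Hor d j)) -> sg L d k = 1.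
Proof. by move=> free; rewrite /sg par_free. Qed.

(** The class is the same in every layer and supported where all signs are +1. Its ends differ only
    by the sign of the colour, so [X = 0] works because the support sees a single colour [s]. *)
Lemma class_of_cycle (tau : dart S -> rat) xi K s :
    end_colouring L xi K ->
    (forall e, tau (edge e) = - tau e) ->
    (forall v, \sum_(e | same_vertex v e) tau e = 0) ->
    (forall e k, tau e <> 0 -> ~~ L (Hor e k)) ->
    (forall v, (forall e, same_vertex v e -> tau e = 0) \/ free_vertex v) ->
    (forall e, tau e <> 0 -> xi e = s) ->
    (forall y, ~ flat_section L (fun d _ => tau d) y) ->
  admits_class L true.
Proof.
move=> col tauN tau0 tauL tauV tauxi noy.
have sgt d k : sg L d k * tau d = tau d.
  have [->|/eqP nz] := eqVneq (tau d) 0; first by rewrite mulr0.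
  by rewrite sg_free ?mul1r // => j; apply: tauL.
exists xi, (fun d _ => tau d), s, (fun=> 0), K; split=> //.
- split=> [d k|//|d k _]; first by rewrite tauN sgt.
  case: (tauV d) => [t0|free].
    exists (fun=> 0) => e de; rewrite /step mulr0 add0r t0 //.
    by rewrite same_vertex_node.
  have [u uE] := section_exists (@node_inj S) (tau0 d); exists u => e de.
  by rewrite /step uE // sg_free ?mul1r // => j; apply: free; rewrite same_vertex_node.
split=> // d k _; have [->|/eqP nz] := eqVneq (tau d) 0; first by rewrite !mulr0; ring.
by rewrite tauxi //; ring.
Qed.

End ClassOfCycle.

Section Destabilize.
Variables (S : surface) (L : link S) (g : seq (dart S)).
Hypotheses (circle : embedded_circle g) (ess : essential g) (disj : annulus_disjoint L g).
Implicit Types (d e v : dart S).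

Lemma circle_free v : vertex_on g v -> free_vertex L v.
Proof.
case/vertex_onP => d dg vd e k ve; apply/negP => Le.
have de : same_vertex d e by rewrite -(same_vertex_left vd).
by have := disj k dg; rewrite degreeE (bigD1 e) //= Le.
Qed.

Lemma edge_on_free e k : edge_on g e -> ~~ L (Hor e k).
Proof. by move/(edge_on_vertex circle)/circle_free; apply; apply: connect0. Qed.

(** No horizontal arc touches the circle, so the colour cannot change around its vertices or across
    its edges. *)
Lemma circle_colour xi K : end_colouring L xi K ->
  exists s, forall e, vertex_on g e -> xi e = s.
Proof.
case=> xif xiE; have free d : (forall j, ~~ L (Hor d j)) -> xi (edge d) = xi d.
  by move=> fd; rewrite (xiE d K) // par_free // addbF.
have vert d e : vertex_on g d -> same_vertex d e -> xi e = xi d.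
  move=> von; move: e; apply: (orbit_ind (f := node)) => // e de <- _.
  rewrite -[RHS](congr1 xi (face_edge_node e)) xif free // => j.
  by apply: (circle_free von); rewrite same_vertex_node.
have [d0 d0g] : exists d0, d0 \in g.
  by case/and4P: circle; case: (g) => // d0 g' _ _ _ _; exists d0; rewrite mem_head.
exists (xi d0) => e /vertex_onP[d dg ed].
have don : vertex_on g d by apply/vertex_onP; exists d => //; apply: connect0.
rewrite -(vert e d) //; last by rewrite (vertex_on_same g ed).
have : fconnect (next g) d0 d.
  by rewrite (fconnect_cycle (cycle_next (circle_uniq circle)) d0g).
have nextg x : fconnect (next g) d0 x -> x \in g.
  by rewrite (fconnect_cycle (cycle_next (circle_uniq circle)) d0g).
move: d {dg ed don}; apply: (orbit_ind (f := next g)) => // d d0d <- _.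
have dg := nextg d d0d; have ed := circle_next circle dg.
have eon : edge_on g (edge d) by rewrite /edge_on edgeK dg orbT.
rewrite (vert _ _ (edge_on_vertex circle eon) ed) free // => j.
by apply: edge_on_free; rewrite -edge_on_edge.
Qed.

Lemma sum_off_circle (t : dart S -> rat) :
    (forall v, ~~ vertex_on g v -> \sum_(e | same_vertex v e) t e = 0) ->
  \sum_(e | ~~ vertex_on g e) t e = 0.
Proof.
move=> t0; rewrite (partition_big (froot node) xpredT) //= big1 // => r _.
have [rr|nr] := eqVneq (froot node r) r; last first.
  rewrite big_pred0 // => e; apply: contraNF nr => /andP[_ /eqP <-].
  by rewrite (root_root (fconnect_sym (@node_inj S))).
have [von|nvon] := boolP (vertex_on g r).
  rewrite big_pred0 // => e; apply: contraTF von => /andP[ne /eqP re].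
  by rewrite -(vertex_on_same g (d := e)) // -same_vertex_froot re rr.
rewrite -[RHS](t0 r nvon); apply: eq_bigl => e.
rewrite -{1}rr same_vertex_froot same_vertex_sym andb_idl // => er.
by rewrite -(vertex_on_same g er).
Qed.

(** By antisymmetry all outward flows of [t] add up to zero, so those at the vertices of the circle
    do; [section_exists], applied to [next g], then finds multiples of the edges of the circle that
    cancel them. *)
Lemma close_relative_cycle (t : dart S -> rat) :
    (forall e, t (edge e) = - t e) ->
    (forall v, ~~ vertex_on g v -> \sum_(e | same_vertex v e) t e = 0) ->
  exists a : dart S -> rat, forall v,
    \sum_(e | same_vertex v e) (t e + along_circle g a e) = 0.
Proof.
move=> tN t0; pose b v := \sum_(e | same_vertex v e) t e.
have cnt v : \sum_(d | d \in g) (same_vertex v d)%:R = (vertex_on g v)%:R :> rat.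
  by rewrite -natr_sum -big_uniq ?(circle_uniq circle) //= circle_count.
have bE v w : same_vertex v w -> b v = b w.
  by move=> vw; apply: eq_bigl => e; apply: same_vertex_left.
have total : \sum_e t e = 0.
  set T := \sum_e t e; suff: T = - T by lra.
  by rewrite {1}/T (reindex_inj (inv_inj (@edgeK S))) /= -sumrN; apply: eq_bigr => e _; apply: tN.
have on0 : \sum_(d | d \in g) b d = 0.
  have : \sum_(e | vertex_on g e) t e = 0.
    by have := total; rewrite (bigID (vertex_on g)) /= sum_off_circle // addr0.
  move=> onE; rewrite -[RHS]onE (eq_bigr (fun d => \sum_e if same_vertex d e then t e else 0)); last first.
    by move=> d _; rewrite /b big_mkcond.
  rewrite exchange_big [RHS]big_mkcond /=; apply: eq_bigr => e _.
  transitivity (\sum_(d | d \in g) (same_vertex e d)%:R * t e).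
    by apply: eq_bigr => d _; rewrite same_vertex_sym; case: ifP; rewrite ?mul1r ?mul0r.
  rewrite -mulr_suml cnt.
  by case: (vertex_on g e); rewrite ?mul1r ?mul0r.
have [d0 d0g] : exists d0, d0 \in g.
  by case/and4P: circle; case: (g) => // d0 g' _ _ _ _; exists d0; rewrite mem_head.
have gE d : fconnect (next g) d0 d = (d \in g).
  by rewrite (fconnect_cycle (cycle_next (circle_uniq circle)) d0g).
have [|a aE] := @section_exists _ _ (can_inj (prev_next (circle_uniq circle))) rat (fun d => - b d) d0.
  by rewrite (eq_bigl _ _ gE) sumrN on0 oppr0.
exists a => v; rewrite big_split /= along_circle_sum //.
rewrite [X in _ + X](eq_bigr (fun d => (same_vertex v d)%:R * - b v)) => [|d dg]; last first.
  have := aE (prev g d); rewrite gE mem_prev next_prev ?(circle_uniq circle) // => /(_ dg) ->.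
  rewrite addrC addKr; case vd: (same_vertex v d); last by rewrite !mul0r.
  by rewrite (bE v d).
rewrite -mulr_suml cnt.
rewrite -/(b v); have [von|nvon] := boolP (vertex_on g v); first by rewrite mul1r subrr.
by rewrite mul0r addr0 /b t0.
Qed.

Lemma destabilizing_class : admits_class L false -> admits_class L true.
Proof.
case=> xi [_ [_ [_ [K [col _ _ _]]]]]; have [s xis] := circle_colour col.
have [d0 d0g] : exists d0, d0 \in g.
  by case/and4P: circle; case: (g) => // d0 g' _ _ _ _; exists d0; rewrite mem_head.
pose gam := along_circle g (fun=> 1).
have gam_on e : gam e <> 0 -> edge_on g e.
  by move=> ne; apply/negPn/negP => /along_circle_off/ne.
have [noy|] := classic (forall y, ~ flat_section L (fun d _ => gam d) y).
  apply: (class_of_cycle (xi := xi) (K := K) (s := s) col _ _ _ _ _ noy).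
  - by move=> e; apply: along_circle_edge.
  - by move=> v; rewrite along_circle_sum // big1 // => d _; rewrite subrr mulr0.
  - by move=> e k /gam_on; apply: edge_on_free.
  - move=> v; have [von|nvon] := boolP (vertex_on g v); first by right; apply: circle_free.
    left=> e ve; apply: along_circle_off; apply: contra nvon => /(edge_on_vertex circle).
    by rewrite (vertex_on_same g ve).
  by move=> e /gam_on/(edge_on_vertex circle)/xis.
(* A flat section [y] is constant on each side and jumps by 1 across the circle. It is zero next to
   an arc of [L], as the layers just below and above the arc have opposite signs. So a side on which
   [y] is nonzero has no arc of [L] along its faces. *)
move=> /not_all_ex_not[y /NNPP[yf yE]].
have y0 e : ~~ edge_on g e -> y (edge e) = y e.
  move=> ne; have := yE e 0%N; rewrite /gam along_circle_off // /sg expr0 mul1r.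
  by move/eqP; rewrite subr_eq0 => /eqP.
have yL e k : L (Hor e k) -> y e = 0.
  move=> Le; have ne : ~~ edge_on g e by apply: contraL Le => /(edge_on_free k).
  have := yE e k; have := yE e k.+1; rewrite /gam along_circle_off // sgS Le; lra.
have [d1 [d1on yd1]] : exists d1, edge_on g d1 /\ y d1 <> 0.
  have don : edge_on g d0 by rewrite /edge_on d0g.
  have := yE d0 0%N; rewrite /gam /along_circle d0g (negPf (circle_edge circle d0g)).
  rewrite /sg expr0 mul1r subr0; have [yd|/eqP yd] := eqVneq (y d0) 0; last by exists d0.
  by move=> E; exists (edge d0); rewrite edge_on_edge; split=> // ye; move: E; rewrite yd ye; lra.
pose U := side g d1.
have UL e k : e \in U -> ~~ L (Hor e k).
  move=> eU; apply/negP => /yL ye; apply: yd1.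
  by rewrite -ye; apply/esym; apply: side_invariant eU => // d _; apply: y0.
have [xif xiE] := col.
have Uxi e : e \in U -> xi e = s.
  move=> eU; rewrite -(xis d1) ?edge_on_vertex //; apply: (side_invariant (g := g)) eU => // d dU _.
  by rewrite (xiE d K) // par_free ?addbF // => j; apply: UL.
have [t [tN toff t0 tx]] := relative_cycle_exists circle d1on (ess d1).
(* The correction lies on the circle, while nontriviality of [t] is detected on inner edges, so it
   survives. *)
have [a aE] := close_relative_cycle tN t0.
pose tau e := t e + along_circle g a e.
have tau_supp e : tau e <> 0 -> e \in U \/ edge_on g e.
  move=> ne; have [eon|neon] := boolP (edge_on g e); first by right.
  left; apply/negPn/negP => neU; apply: ne.
  by rewrite /tau along_circle_off // toff ?addr0 // (negPf neU).
apply: (class_of_cycle (tau := tau) (xi := xi) (K := K) (s := s) col).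
- by move=> e; rewrite /tau tN along_circle_edge; ring.
- exact: aE.
- by move=> e k /tau_supp[/UL|/edge_on_free].
- move=> v; have [von|nvon] := boolP (vertex_on g v); first by right; apply: circle_free.
  have [vU|nvU] := boolP (v \in U).
    by right=> e k ve; apply: UL; have [] := side_vertex circle vU nvon ve.
  left=> e ve; apply: NNPP => /tau_supp[eU|/(edge_on_vertex circle)].
    have ne : ~~ vertex_on g e by rewrite -(vertex_on_same g ve).
    rewrite same_vertex_sym in ve; have [vU _] := side_vertex circle eU ne ve.
    by rewrite /U vU in nvU.
  by rewrite -(vertex_on_same g ve) (negPf nvon).
- by move=> e /tau_supp[/Uxi|/(edge_on_vertex circle)/xis].
move=> z [zf zE]; have [e [/andP[_ ne] nz]] := tx z zf; apply: nz.
by have := zE e 0%N; rewrite /sg expr0 mul1r /tau along_circle_off // addr0.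
Qed.

End Destabilize.

Theorem theorem3p1 (S : surface) (L : link S)
  (hL : nonsplit L) (hcol : checkerboard_colorable L)
  (hmin : ~ minimal_genus L)
  (S' : surface) (D : link S') (hD : isotopic L D) (hreg : diagram D)
  (xi : dart S' -> bool) (hxi : coloring D xi) :
  determinant_is D xi 0%R \/ determinant_is D (dual_coloring xi) 0%R.
Proof.
have /NNPP[S1 [L1 [g [iso1 circle ess disj]]]] := hmin.
apply: class_determinant => //; first exact: hL hD hreg.
apply/(isotopic_class _ hD)/(isotopic_class _ iso1).
apply: (destabilizing_class circle ess disj).
apply/(isotopic_class _ iso1)/(isotopic_class _ hD).
exact: coloring_class hreg hxi.
Qed.
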